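(* Assume the setting of the context (one-dimensional exponential covariance model) with some $\delta\in[0,1)$. Let the regressors $x_1(\cdot),\dots,x_p(\cdot)$ be independent white-noise processes with $x_j(s)\sim N(0,v_j^2)$, $s\in[0,n^\delta]$, where $v_j^2>0$, $j=1,\dots,p$. Suppose that, conditional on $\mathbf X$, $\mathbf Z\sim N(\mathbf X\boldsymbol\beta_0,\boldsymbol\Sigma(\boldsymbol\theta_0))$, where $\boldsymbol\beta_0=(\beta_{0,0},\dots,\beta_{0,p})'\in\mathbb R^{p+1}$ and $\boldsymbol\theta_0=(v_0^2,\sigma_0^2,\kappa_0)'\in\Theta\subseteq(0,\infty)^3$ are constant vectors. Assume that $\mathcal A^0\neq\varnothing$, that $\Theta$ is compact and that $$\boldsymbol\theta_0+\Big(\sum_{j\in\alpha^0\setminus\alpha}\beta_{0,j}^2v_j^2,\,0,\,0\Big)'\in\Theta\qquad\text{for all }\alpha\in\mathcal A.$$ If $\lim_{n\to\infty}\tau_n=\infty$ and $\tau_n=o(n)$, then $\lim_{n\to\infty}P\{\hat\alpha_{\tau_n}=\alpha^0\}=1$.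
   Context: For each $n$, $D=[0,n^\delta]\subset\mathbb R$ and data $\mathbf Z=(Z(s_1),\dots,Z(s_n))'$ are observed at sites $s_i=s_{ni}=i\,n^{-(1-\delta)}$, $i=1,\dots,n$. The covariance parameter is $\boldsymbol\theta=(v^2,\sigma^2,\kappa)'\in\Theta$ and $\boldsymbol\Sigma(\boldsymbol\theta)=\boldsymbol\Sigma_\eta+v^2\mathbf I$, where $\boldsymbol\Sigma_\eta$ has $(i,j)$ entry $\sigma^2\exp(-\kappa|s_i-s_j|)$. The number $p$ of regressors, the set $\mathcal A\subseteq2^{\{1,\dots,p\}}$ of candidate models, the set $\mathcal A^0\subseteq\mathcal A$ of correct models, and the smallest correct model $\alpha^0=\arg\min_{\alpha\in\mathcal A^0}p(\alpha)$ do not depend on $n$. $\mathbf X$ is the $n\times(p+1)$ matrix with rows $(1,x_1(s_i),\dots,x_p(s_i))$; $p(\alpha)$ is the number of elements of $\alpha$; $\mathbf X(\alpha)$ consists of the column $\mathbf 1$ and the columns of $\mathbf X$ indexed by $\alpha$. A model $\alpha$ is correct if the true mean function $\mu_0(s)=\beta_{0,0}+\sum_{j=1}^p\beta_{0,j}x_j(s)$ can be written as $\beta_0+\sum_{j\in\alpha}\beta_jx_j(s)$ for all $s\in D$. $\hat{\boldsymbol\mu}(\alpha;\boldsymbol\theta)=\mathbf X(\alpha)(\mathbf X(\alpha)'\boldsymbol\Sigma^{-1}(\boldsymbol\theta)\mathbf X(\alpha))^{-1}\mathbf X(\alpha)'\boldsymbol\Sigma^{-1}(\boldsymbol\theta)\mathbf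 Z$ (the inverses are assumed to exist), $$\ell(\alpha;\boldsymbol\theta)=-\tfrac n2\log(2\pi)-\tfrac12\log\det\boldsymbol\Sigma(\boldsymbol\theta)-\tfrac12(\mathbf Z-\hat{\boldsymbol\mu}(\alpha;\boldsymbol\theta))'\boldsymbol\Sigma^{-1}(\boldsymbol\theta)(\mathbf Z-\hat{\boldsymbol\mu}(\alpha;\boldsymbol\theta)),$$ and the ML estimate $\hat{\boldsymbol\theta}(\alpha)\in\Theta$ satisfies $\ell(\alpha;\hat{\boldsymbol\theta}(\alpha))=\sup_{\boldsymbol\theta\in\Theta}\ell(\alpha;\boldsymbol\theta)$. For a tuning parameter $\tau_n$, $\Gamma_{\tau_n}(\alpha)=-2\ell(\alpha;\hat{\boldsymbol\theta}(\alpha))+\tau_np(\alpha)$ (GIC) and $\hat\alpha_{\tau_n}=\arg\min_{\alpha\in\mathcal A}\Gamma_{\tau_n}(\alpha)$. *)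

(* Defs.v *)
From HB Require Import structures.
From mathcomp Require Import all_boot all_order all_algebra finmap.
From mathcomp Require Import all_classical all_reals all_analysis.
From mathcomp Require Import measurable_realfun.

Set Implicit Arguments.
Unset Strict Implicit.
Unset Printing Implicit Defensive.

Import Order.TTheory GRing.Theory Num.Theory.
Import numFieldNormedType.Exports.

Local Open Scope classical_set_scope.
Local Open Scope ring_scope.

Section probability_notions.
Context (R : realType) (d : measure_display) (T : measurableType d)
  (P : probability T R).

(* Mutual independence of the random variables [X i], [i] in [D]: the product
   rule over every finite subfamily. *)
Definition mutually_independent (I : choiceType) (D : set I)
    (X : I -> {RV P >-> R}) : Prop :=
  forall (J : {fset I}) (B : I -> set R),
    (forall i, i \in J -> D i /\ measurable (B i)) ->
    P (\bigcap_(i in [set i | i \in J]) (X i @^-1` B i)) =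
    (\prod_(i <- J) P (X i @^-1` B i))%E.

(* N(m, v) with variance [v >= 0]. The library's [normal_prob] takes a standard
   deviation and is not a point mass when the latter is 0. *)
Definition normal_law (m v : R) (B : set R) : \bar R :=
  if v == 0 then \d_m B else normal_prob m (Num.sqrt v) B.

(* A law on R^n is N(m, S) when each linear form a'z has law N(a'm, a'Sa). *)
Definition is_multinormal (n : nat) (mu : probability (n.-tuple R) R)
    (m : 'cV[R]_n) (S : 'M[R]_n) : Prop :=
  forall (a : 'rV[R]_n) (B : set R), measurable B ->
    mu [set z | B (\sum_(i < n) a ord0 i * tnth z i)] =
    normal_law ((a *m m) ord0 ord0) ((a *m S *m a^T) ord0 ord0) B.

(* Generators of the sigma-algebra of a random matrix. *)
Definition mx_events (m k : nat) (X : T -> 'M[R]_(m, k)) : set (set T) :=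
  [set E | exists i j (B : set R),
    measurable B /\ E = [set w | B (X w i j)]].

(* [K] is a regular conditional distribution of [Y] given [<<s G>>]. *)
Definition is_conditional_law (G : set (set T)) (d' : measure_display)
    (T' : measurableType d') (Y : {RV P >-> T'})
    (K : T -> probability T' R) : Prop :=
  (forall B : set T', measurable B ->
     measurable_fun [set: g_sigma_algebraType G]
       ((fun w => K w B) : g_sigma_algebraType G -> \bar R)) /\
  (forall (E : set T) (B : set T'), <<s G >> E -> measurable B ->
     P (E `&` Y @^-1` B) = (\int[P]_(w in E) K w B)%E).

Definition conditionally_multinormal (n m k : nat) (X : T -> 'M[R]_(m, k))
    (Y : {RV P >-> n.-tuple R}) (mean : T -> 'cV[R]_n) (S : 'M[R]_n) : Prop :=
  exists K : T -> probability (n.-tuple R) R,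
    is_conditional_law (mx_events X) Y K /\
    forall w, is_multinormal (K w) (mean w) S.

End probability_notions.

Section covariance_model.
Context (R : realType) (delta : R) (n : nat).

Definition site (i : 'I_n) : R := i.+1%:R * n%:R `^ (- (1 - delta)).

Definition domain : set R := `[0, n%:R `^ delta].

(* Covariance parameters are triples (v^2, sigma^2, kappa). *)
Definition v2 (t : R * R * R) : R := t.1.1.
Definition sigma2 (t : R * R * R) : R := t.1.2.
Definition kappa (t : R * R * R) : R := t.2.

Definition cov_eta (t : R * R * R) : 'M[R]_n :=
  \matrix_(i, j) (sigma2 t * expR (- kappa t * `|site i - site j|)).

Definition cov (t : R * R * R) : 'M[R]_n := cov_eta t + (v2 t)%:M.

End covariance_model.

Section regression.
Context (R : realType) (p : nat) (delta : R) (n : nat).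

(* A realization of the regressors is [x : 'I_p -> R -> R]; regressor [j] is
   the (j+1)-th one, and its coefficient has index [rshift 1 j] in a vector of
   1 + p coefficients, the intercept having index 0. *)
Definition mean_fun (b : 'cV[R]_(1 + p)) (x : 'I_p -> R -> R) (s : R) : R :=
  b ord0 ord0 + \sum_(j < p) b (rshift 1 j) ord0 * x j s.

Definition sub_mean_fun (a : {set 'I_p}) (b : 'cV[R]_(1 + p))
    (x : 'I_p -> R -> R) (s : R) : R :=
  b ord0 ord0 + \sum_(j in a) b (rshift 1 j) ord0 * x j s.

Definition regressors (x : 'I_p -> R -> R) : 'M[R]_(n, p) :=
  \matrix_(i, j) x j (site delta i).

Definition design (x : 'I_p -> R -> R) : 'M[R]_(n, 1 + p) :=
  row_mx (const_mx 1) (regressors x).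

Definition sub_design (a : {set 'I_p}) (x : 'I_p -> R -> R) :
    'M[R]_(n, 1 + #|a|) :=
  row_mx (const_mx 1) (\matrix_(i, k) regressors x i (enum_val k)).

Definition gram (a : {set 'I_p}) (t : R * R * R) (x : 'I_p -> R -> R) :
    'M[R]_(1 + #|a|) :=
  (sub_design a x)^T *m invmx (cov delta n t) *m sub_design a x.

Definition inverses_exist (a : {set 'I_p}) (t : R * R * R)
    (x : 'I_p -> R -> R) : Prop :=
  cov delta n t \in unitmx /\ gram a t x \in unitmx.

Definition mu_hat (a : {set 'I_p}) (t : R * R * R) (x : 'I_p -> R -> R)
    (z : 'cV[R]_n) : 'cV[R]_n :=
  sub_design a x *m invmx (gram a t x) *m (sub_design a x)^T
    *m invmx (cov delta n t) *m z.

Definition loglik (a : {set 'I_p}) (t : R * R * R) (x : 'I_p -> R -> R)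
    (z : 'cV[R]_n) : R :=
  let r := z - mu_hat a t x z in
  - (n%:R / 2 * ln (2 * pi)) - 2^-1 * ln (\det (cov delta n t))
  - 2^-1 * (r^T *m invmx (cov delta n t) *m r) ord0 ord0.

(* The supremum is taken in the extended reals, so that attaining it entails
   that the log-likelihood is bounded above on [Theta]. *)
Definition is_ml_estimate (Theta : set (R * R * R)) (a : {set 'I_p})
    (x : 'I_p -> R -> R) (z : 'cV[R]_n) (t : R * R * R) : Prop :=
  Theta t /\
  (loglik a t x z)%:E = ereal_sup [set (loglik a t' x z)%:E | t' in Theta].

Definition gic (tau : R) (a : {set 'I_p}) (t : R * R * R)
    (x : 'I_p -> R -> R) (z : 'cV[R]_n) : R :=
  - 2 * loglik a t x z + tau * #|a|%:R.

End regression.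

Section random_regression.
Context (R : realType) (p n : nat) (delta : R) (d : measure_display)
  (T : measurableType d) (P : probability T R)
  (x : 'I_p -> R -> {RV P >-> R}).

Definition realization (w : T) : 'I_p -> R -> R := fun j s => x j s w.

(* The regressors being random, equality of mean functions is meant almost
   surely; the coefficients are constants. *)
Definition correct_model (beta0 : 'cV[R]_(1 + p)) (a : {set 'I_p}) : Prop :=
  exists b : 'cV[R]_(1 + p),
    {ae P, forall w, forall s, domain delta n s ->
       mean_fun beta0 (realization w) s = sub_mean_fun a b (realization w) s}.

(* Independent white-noise processes: the x_j(s), over all j and all s in D,
   are mutually independent and x_j(s) ~ N(0, vx2 j). *)
Definition white_noise_regressors (vx2 : 'I_p -> R) : Prop :=
  mutually_independent [set js : 'I_p * R | domain delta n js.2]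
    (fun js => x js.1 js.2) /\
  forall j s, domain delta n s -> forall B : set R, measurable B ->
    distribution P (x j s) B = normal_law 0 (vx2 j) B.

End random_regression.

Definition tuple_col (R : realType) (n : nat) (z : n.-tuple R) : 'cV[R]_n :=
  \col_i tnth z i.

Definition is_argmin (R : realType) (I : finType) (A : {set I}) (f : I -> R)
    (a : I) : Prop :=
  a \in A /\ forall a', a' \in A -> f a <= f a'.

Definition is_the_argmin (R : realType) (I : finType) (A : {set I})
    (f : I -> R) (a : I) : Prop :=
  forall a', is_argmin A f a' <-> a' = a.

(* Main.v *)
(** On the grid of sites the exponential covariance matrix is the inverse of a
   tridiagonal matrix [a I + b L + c B], where [L] is the Laplacian of a path,
   [B] is the projection on its two ends, and [a], [b], [c] have orders [D],
   [1 / D] and [1] for the spacing [D] of the sites.  Writing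
   [Sigma = s2 R + v2 I], the form [f' Sigma^-1 f] is the minimum over [u] of
   [|f - u|^2 / v2 + u' R^-1 u / s2], so it penalizes roughness of [f] and is
   bounded below by [f' S f / v2] for a fixed smoother [S] whose trace is almost
   [n].  Moreover [log det Sigma] is at least [n log v2], and almost equal to it
   at the true parameter.

   If a regressor with nonzero coefficient is missing, its white noise adds a
   positive amount to the apparent nugget variance, and
   [log v2 + A / v2 >= 1 + log A] shows that [-2 loglik] increases by a multiple
   of [n], whatever the parameter.  If the model is correct but too large, the
   spurious regressors reduce [-2 loglik] by a bounded amount: their information
   matrix is of order [n] and their scores [x_j' Sigma^-1 e] are of order
   [sqrt n], uniformly in the parameter.  The uniformity comes from a finite
   grid of reference parameters and a geometric expansion of the resolvent
   around each of them.  A penalty that tends to infinity but is [o(n)] thus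
   selects the smallest correct model.  All stochastic bounds are Markov
   inequalities for second and fourth moments. *)
Require Import Defs.
From HB Require Import structures.
From mathcomp Require Import all_boot all_order all_algebra finmap.
From mathcomp Require Import all_classical all_reals all_analysis.
From mathcomp Require Import measurable_realfun.
From mathcomp Require Import ring lra zify.

Set Implicit Arguments.
Unset Strict Implicit.
Unset Printing Implicit Defensive.

Import Order.TTheory GRing.Theory Num.Theory.
Import numFieldNormedType.Exports.

Local Open Scope classical_set_scope.
Local Open Scope ring_scope.

(** * Quadratic forms *)

Section dot.
Context (R : rcfType).
Implicit Types n : nat.

(** Nothing is known about where the estimated covariance parameter lies, so it is never located. A
    correct model is compared with [alpha0] at one common parameter, the estimate of the larger
    model; this is enough, because the estimate of [alpha0] does at least as well for [alpha0]. The
    intercept is the delicate regressor. Constants have no roughness, so [1' Sigma^-1 1] can stay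
    bounded (spacing of order [1 / n]) instead of growing like [n]. It is therefore projected out
    first, and [x_j' Sigma^-1 1] is bounded relative to [1' Sigma^-1 1] rather than to [n]. The
    randomness is confined to a finite list of inequalities, the record [good]; all comparisons of
    likelihoods are deterministic consequences of it. The resolvent is expanded to a depth equal to
    the sample size, so that a remainder [4^-n] absorbs norms of order [n]. One margin [eta] closes
    the argument: up to common terms, [-2 loglik] is at least [3 eta n] for incorrect models and at
    most [2 eta n] for [alpha0] at the truth, and penalties stay below [eta n]. *)

Definition dot n (u v : 'cV[R]_n) : R := \sum_i u i ord0 * v i ord0.

Lemma dotE n (u v : 'cV[R]_n) : (u^T *m v) ord0 ord0 = dot u v.
Proof. by rewrite mxE; apply: eq_bigr => i _; rewrite mxE. Qed.

Lemma dotC n (u v : 'cV[R]_n) : dot u v = dot v u.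
Proof. by apply: eq_bigr => i _; rewrite mulrC. Qed.

Lemma dotDr n (u v w : 'cV[R]_n) : dot u (v + w) = dot u v + dot u w.
Proof. by rewrite -big_split; apply: eq_bigr => i _; rewrite mxE mulrDr. Qed.

Lemma dotZr n (u v : 'cV[R]_n) k : dot u (k *: v) = k * dot u v.
Proof. by rewrite mulr_sumr; apply: eq_bigr => i _; rewrite mxE mulrCA. Qed.

Lemma dotNr n (u v : 'cV[R]_n) : dot u (- v) = - dot u v.
Proof. by rewrite -scaleN1r dotZr mulN1r. Qed.

Lemma dotBr n (u v w : 'cV[R]_n) : dot u (v - w) = dot u v - dot u w.
Proof. by rewrite dotDr dotNr. Qed.

Lemma dotDl n (u v w : 'cV[R]_n) : dot (v + w) u = dot v u + dot w u.
Proof. by rewrite dotC dotDr !(dotC u). Qed.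

Lemma dotZl n (u v : 'cV[R]_n) k : dot (k *: u) v = k * dot u v.
Proof. by rewrite dotC dotZr dotC. Qed.

Lemma dotNl n (u v : 'cV[R]_n) : dot (- u) v = - dot u v.
Proof. by rewrite dotC dotNr dotC. Qed.

Lemma dotBl n (u v w : 'cV[R]_n) : dot (v - w) u = dot v u - dot w u.
Proof. by rewrite dotDl dotNl. Qed.

Lemma dot0r n (u : 'cV[R]_n) : dot u 0 = 0.
Proof. by rewrite /dot big1// => i _; rewrite mxE mulr0. Qed.

Lemma dot0l n (u : 'cV[R]_n) : dot 0 u = 0.
Proof. by rewrite dotC dot0r. Qed.

Lemma dot_sumr n (I : Type) (s : seq I) (Pr : pred I) (u : 'cV[R]_n) (f : I -> 'cV[R]_n) :
  dot u (\sum_(i <- s | Pr i) f i) = \sum_(i <- s | Pr i) dot u (f i).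
Proof. by apply: (big_morph (dot u)) => [x y|]; [exact: dotDr|exact: dot0r]. Qed.

Lemma dot_suml n (I : Type) (s : seq I) (Pr : pred I) (u : 'cV[R]_n) (f : I -> 'cV[R]_n) :
  dot (\sum_(i <- s | Pr i) f i) u = \sum_(i <- s | Pr i) dot (f i) u.
Proof. by rewrite dotC dot_sumr; apply: eq_bigr => i _; rewrite dotC. Qed.

Lemma dot_ge0 n (u : 'cV[R]_n) : 0 <= dot u u.
Proof. by apply: sumr_ge0 => i _; rewrite -expr2 sqr_ge0. Qed.

Lemma dot_mulmx m n (u : 'cV[R]_m) (A : 'M[R]_(m, n)) (v : 'cV[R]_n) :
  dot u (A *m v) = dot (A^T *m u) v.
Proof. by rewrite -!dotE trmx_mul trmxK mulmxA. Qed.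

Lemma dot_col m n (x z : 'cV[R]_m) (y t : 'cV[R]_n) :
  dot (col_mx x y) (col_mx z t) = dot x z + dot y t.
Proof.
rewrite /dot big_split_ord/=; congr (_ + _); apply: eq_bigr => i _.
  by rewrite !col_mxEu.
by rewrite !col_mxEd.
Qed.

Lemma dot1 (x y : 'cV[R]_1) : dot x y = x ord0 ord0 * y ord0 ord0.
Proof. by rewrite /dot big_ord1. Qed.

Lemma dot_delta n (u : 'cV[R]_n) i : dot u (delta_mx i ord0) = u i ord0.
Proof.
rewrite /dot (bigD1 i)//= !mxE !eqxx mulr1 big1 ?addr0// => j ji.
by rewrite mxE (negbTE ji) mulr0.
Qed.

Lemma form_delta n (A : 'M[R]_n) i j :
  dot (delta_mx i ord0) (A *m delta_mx j ord0) = A i j.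
Proof. by rewrite dotC dot_delta -colE mxE. Qed.

Lemma trace_form n (A : 'M[R]_n) :
  \tr A = \sum_i dot (delta_mx i ord0) (A *m delta_mx i ord0).
Proof. by apply: eq_bigr => i _; rewrite form_delta. Qed.

Definition psd n (A : 'M[R]_n) := A^T = A /\ forall u, 0 <= dot u (A *m u).

Definition loewner n (A B : 'M[R]_n) := forall u, dot u (A *m u) <= dot u (B *m u).

Lemma psd_sym n (A : 'M[R]_n) u v : A^T = A -> dot u (A *m v) = dot v (A *m u).
Proof. by move=> As; rewrite dot_mulmx As dotC. Qed.

Lemma quad_discr (a b c : R) : (forall t, 0 <= a + 2 * t * b + t ^+ 2 * c) ->
  b ^+ 2 <= a * c.
Proof.
move=> H; have c0 : 0 <= c.
  rewrite leNgt; apply/negP => c0.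
  have a0 := H 0; rewrite mulr0 mul0r expr0n mul0r !addr0 in a0.
  (* With [c = - k], this point is [x + b / k] where [x k = a + 1 + b^2 / k]; as [x >= 1], the
     trinomial there is at most [-1]. *)
  have := H ((a + 1 + b ^+ 2 / - c) / - c + b / - c).
  have [k ck k0] : exists2 k, c = - k & 0 < k by exists (- c); rewrite ?opprK ?oppr_gt0.
  rewrite ck opprK leNgt => /negP; apply.
  set x := (a + 1 + b ^+ 2 / k) / k.
  have xk : x * k = a + 1 + b ^+ 2 / k by rewrite divfK ?gt_eqF.
  have bk : 0 <= b ^+ 2 / k by rewrite divr_ge0 ?sqr_ge0 ?ltW.
  have -> : a + 2 * (x + b / k) * b + (x + b / k) ^+ 2 * (- k) =
    a + b ^+ 2 / k - x * (x * k) by field; rewrite gt_eqF.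
  have H3 : k <= a.
    have := H 1; have := H (-1); rewrite ck sqrrN !expr1n; lra.
  have x1 : 1 <= x by rewrite ler_pdivlMr// mul1r; lra.
  rewrite xk; nra.
have [cE|c1] := eqVneq c 0.
  rewrite cE mulr0; have [->|b0] := eqVneq b 0; first by rewrite expr0n.
  have := H ((- a - 1) / (2 * b)); rewrite cE mulr0 addr0.
  have -> : 2 * ((- a - 1) / (2 * b)) * b = - a - 1 by field.
  lra.
have {}c0 : 0 < c by rewrite lt0r c1.
have := H (- b / c).
have -> : a + 2 * (- b / c) * b + (- b / c) ^+ 2 * c = a - b ^+ 2 / c by field.
by rewrite subr_ge0 ler_pdivrMr.
Qed.

Lemma psd_CS n (A : 'M[R]_n) u v : psd A ->
  dot u (A *m v) ^+ 2 <= dot u (A *m u) * dot v (A *m v).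
Proof.
move=> [As A0]; apply: quad_discr => t.
have := A0 (u + t *: v).
rewrite mulmxDr -scalemxAr !dotDl !dotDr !dotZl !dotZr (psd_sym v u As) => H.
by apply: (le_trans H); rewrite le_eqVlt; apply/orP; left; apply/eqP; ring.
Qed.

Lemma psd1 n : psd (1%:M : 'M[R]_n).
Proof. by split=> [|u]; rewrite ?trmx1// mul1mx dot_ge0. Qed.

Lemma psd_dotCS n (u v : 'cV[R]_n) : dot u v ^+ 2 <= dot u u * dot v v.
Proof. by have := psd_CS u v (psd1 n); rewrite !mul1mx. Qed.

Lemma psdD n (A B : 'M[R]_n) : psd A -> psd B -> psd (A + B).
Proof.
move=> [As A0] [Bs B0]; split=> [|u]; first by rewrite linearD/= As Bs.
by rewrite mulmxDl dotDr addr_ge0.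
Qed.

Lemma psdZ n k (A : 'M[R]_n) : 0 <= k -> psd A -> psd (k *: A).
Proof.
move=> k0 [As A0]; split=> [|u]; first by rewrite linearZ/= As.
by rewrite -scalemxAl dotZr mulr_ge0.
Qed.

Lemma psd_parallelogram n (A : 'M[R]_n) u v : psd A ->
  dot (u + v) (A *m (u + v)) <= 2 * dot u (A *m u) + 2 * dot v (A *m v).
Proof.
move=> [As /(_ (u - v))].
rewrite mulmxBr !mulmxDr !(dotBl, dotBr, dotDl, dotDr) (psd_sym v u As); lra.
Qed.

(** The form at [u - k v], divided by [k], is nonnegative. The free weight [k] is tuned in
    [qf_lower]. *)
Lemma psd_young n (A : 'M[R]_n) u v k : psd A -> 0 < k ->
  dot (u + v) (A *m (u + v)) <=
  (1 + k^-1) * dot u (A *m u) + (1 + k) * dot v (A *m v).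
Proof.
move=> [As /(_ (u - k *: v))] + k0.
rewrite mulmxBr !mulmxDr -scalemxAr !(dotDl, dotDr, dotNl, dotNr, dotZl, dotZr).
rewrite (psd_sym v u As); set a := dot u _; set b := dot u _; set c := dot v _.
have ki0 : 0 <= k^-1 by rewrite invr_ge0 ltW.
move=> /(mulr_ge0 ki0) H; rewrite -subr_ge0; apply: le_trans H _.
rewrite le_eqVlt; apply/orP; left; apply/eqP; field; rewrite ?gt_eqF//.
Qed.

(** Induction on the size through the Schur complement of the upper left entry. One pass yields a
    square root, a lower bound for the determinant and Hadamard's inequality. *)
Lemma pd_chol n (A : 'M[R]_n) (v : R) : 0 < v -> A^T = A ->
  (forall u, v * dot u u <= dot u (A *m u)) ->
  exists C : 'M[R]_n,
    [/\ A = C *m C^T, v ^+ n <= \det A & \det A <= \prod_i A i i].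
Proof.
move=> v0; elim: n A => [|n IHn] A As Av.
  by exists A; rewrite det_mx00 expr0 big_ord0; split=> //; apply/matrixP => -[].
rewrite -[A](@submxK _ 1 n 1 n) in As Av *.
set a := ulsubmx _ in As Av *; set b := ursubmx _ in As Av *.
set b' := dlsubmx _ in As Av *; set D := drsubmx _ in As Av *.
move: As; rewrite (@tr_block_mx _ 1 n 1 n) => /(@eq_block_mx _ 1 n 1 n)[_ _ b'E Ds].
have formE (x : 'cV[R]_1) (y : 'cV[R]_n) :
  dot (col_mx x y) (block_mx a b b' D *m col_mx x y) =
  a ord0 ord0 * x ord0 ord0 ^+ 2 + 2 * x ord0 ord0 * dot b^T y + dot y (D *m y).
  rewrite mul_block_col dot_col !dotDr -b'E [dot y (b^T *m x)]dot_mulmx trmxK !dot1.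
  have -> : (a *m x) ord0 ord0 = a ord0 ord0 * x ord0 ord0 by rewrite mxE big_ord1.
  rewrite -[(b *m y) _ _]/((b *m y) ord0 ord0).
  have -> : (b *m y) ord0 ord0 = dot b^T y by rewrite -dotE trmxK.
  ring.
have dotcE (x : 'cV[R]_1) (y : 'cV[R]_n) : dot (col_mx x y) (col_mx x y) =
    x ord0 ord0 ^+ 2 + dot y y by rewrite dot_col dot1 expr2.
set a0 := a ord0 ord0 in formE.
have va : v <= a0.
  have := Av (col_mx (1%:M : 'cV_1) (0 : 'cV_n)); rewrite formE dotcE !(dot0l, dot0r, mulmx0) !mxE eqxx.
  rewrite /= !expr1n; lra.
have a_gt0 : 0 < a0 by exact: lt_le_trans va.
pose S := D - a0^-1 *: (b^T *m b).
have formS y : dot y (S *m y) = dot y (D *m y) - a0^-1 * dot b^T y ^+ 2.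
  rewrite mulmxBl dotBr -scalemxAl dotZr; congr (_ - _ * _).
  rewrite -mulmxA dot_mulmx trmxK -dotE mxE big_ord1 !mxE expr2.
  congr (_ * _); last by rewrite -dotE trmxK mxE.
  by rewrite -dotE trmxK mxE.
have SvS y : v * dot y y <= dot y (S *m y).
  (* This first coordinate minimizes the form for given [y]. The minimum is the form of the Schur
     complement, which thus inherits the bound [v]. *)
  have := Av (col_mx ((- a0^-1 * dot b^T y)%:M : 'cV_1) y); rewrite formE dotcE !mxE eqxx mulr1n.
  rewrite formS => H.
  have : v * dot y y <= v * ((- a0^-1 * dot b^T y) ^+ 2 + dot y y).
    by rewrite ler_pM2l// lerDr sqr_ge0.
  move=> /le_trans/(_ H)/le_trans; apply; rewrite le_eqVlt; apply/orP; left; apply/eqP.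
  by field; rewrite gt_eqF.
have Ss : S^T = S by rewrite linearB linearZ/= trmx_mul trmxK Ds.
have [C [SC dS1 dS2]] := IHn S Ss SvS.
have sa0 : Num.sqrt a0 != 0 by rewrite gt_eqF// sqrtr_gt0.
have sqa : Num.sqrt a0 * Num.sqrt a0 = a0 by rewrite -expr2 sqr_sqrtr// ltW.
pose L : 'M[R]_(1 + n) := block_mx (Num.sqrt a0)%:M 0 ((Num.sqrt a0)^-1 *: b^T) C.
have LE : block_mx a b b' D = L *m L^T.
  rewrite tr_block_mx mulmx_block !(mul0mx, mulmx0, trmx0) !addr0 tr_scalar_mx.
  rewrite linearZ/= trmxK -scalar_mxM sqa mul_scalar_mx mul_mx_scalar !scalerA.
  rewrite divff// !scale1r -b'E -SC -scalemxAl -scalemxAr scalerA -invfM sqa.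
  by rewrite [X in block_mx X]mx11_scalar /S addrC subrK.
have dE : \det (block_mx a b b' D : 'M[R]_(1 + n)) = a0 * \det S.
  rewrite LE det_mulmx det_tr (@det_lblock _ 1 n) SC det_mulmx det_tr det_scalar1.
  rewrite -{3}sqa; ring.
exists L; split=> //; rewrite dE.
  by rewrite exprS ler_pM// ?exprn_ge0// ltW.
rewrite (@big_split_ord _ _ _ 1 n) big_ord1/= (@block_mxEul _ 1 n 1 n).
rewrite ler_pM2l//; apply: (le_trans dS2); apply: ler_prod => i _.
rewrite (@block_mxEdr _ 1 n 1 n); apply/andP; split.
  rewrite -(form_delta S); apply: le_trans (SvS _); rewrite mulr_ge0 ?dot_ge0//.
  exact: ltW.
rewrite -!form_delta formS gerBl mulr_ge0 ?sqr_ge0// invr_ge0 ltW//.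
Qed.

Lemma pd_unitmx n (A : 'M[R]_n) (v : R) : 0 < v -> A^T = A ->
  (forall u, v * dot u u <= dot u (A *m u)) -> A \in unitmx.
Proof.
move=> v0 As Av; have [C [_ + _]] := pd_chol v0 As Av.
move=> Adet; rewrite unitmxE unitfE gt_eqF//; apply: lt_le_trans Adet.
by rewrite exprn_gt0.
Qed.

Lemma inv_sym n (W : 'M[R]_n) : W^T = W -> (invmx W)^T = invmx W.
Proof. by move=> Ws; rewrite trmx_inv Ws. Qed.

Lemma psd_inv n (W : 'M[R]_n) : W \in unitmx -> psd W -> psd (invmx W).
Proof.
move=> Wu [Ws W0]; split=> [|u]; first exact: inv_sym.
have -> : dot u (invmx W *m u) = dot (invmx W *m u) (W *m (invmx W *m u)).
  by rewrite mulKVmx// dotC.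
exact: W0.
Qed.

(** Cauchy-Schwarz for [A] between [y] and [t = W^-1 A y]: [(t' W t)^2 = (t' A y)^2 <= (t' A t) (y'
    A y) <= (t' W t) (y' A y)], and [t' W t] cancels. *)
Lemma form_inv_le n (A W : 'M[R]_n) y : W \in unitmx -> W^T = W -> psd A ->
  loewner A W -> dot (A *m y) (invmx W *m (A *m y)) <= dot y (A *m y).
Proof.
move=> Wu Ws pA AW; set t := invmx W *m (A *m y).
have tE : dot t (W *m t) = dot (A *m y) t by rewrite /t mulKVmx// dotC.
rewrite -tE; have := psd_CS t y pA.
rewrite (dotC t (A *m y)) -tE => H.
have := AW t; have := pA.2 y; have := pA.2 t.
move: H; set X := dot t (W *m t); set Y := dot y _; set Z := dot t (A *m t).
move=> H Z0 Y0 ZX; have [X0|X0] := ltP 0 X; last exact: le_trans X0 Y0.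
rewrite -(ler_pM2l X0) -expr2 (le_trans H)// ler_wpM2r//.
Qed.

End dot.

(** * Precision matrix of the first-order autoregression *)

Section smoothing.
Context (R : rcfType) (n : nat).
Implicit Types G : 'M[R]_n.

(* [dot f (smooth G *m f)] is the minimum over [u] of [|f - u|^2 + u' G u]. *)
Definition smooth G : 'M[R]_n := 1%:M - invmx (1%:M + G).

Lemma unit1D G : psd G -> 1%:M + G \in unitmx.
Proof.
move=> [Gs G0]; apply: (@pd_unitmx _ _ _ 1) => // [|u].
  by rewrite linearD/= trmx1 Gs.
by rewrite mulmxDl mul1mx dotDr mul1r lerDl.
Qed.

Lemma sym1D G : psd G -> (1%:M + G)^T = 1%:M + G.
Proof. by move=> [Gs _]; rewrite linearD/= trmx1 Gs. Qed.

Lemma psd1D G : psd G -> psd (1%:M + G).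
Proof. by move=> pG; apply: psdD => //; exact: psd1. Qed.

Lemma smooth_sym G : psd G -> (smooth G)^T = smooth G.
Proof. by move=> pG; rewrite linearB/= trmx1 inv_sym// sym1D. Qed.

(** Completion of the square: [h] is the deviation of [u] from the minimizer [(I + G)^-1 f]. *)
Lemma smoothE G f h : psd G ->
  let u := invmx (1%:M + G) *m f + h in
  dot (f - u) (f - u) + dot u (G *m u) =
  dot f (smooth G *m f) + dot h ((1%:M + G) *m h).
Proof.
move=> pG u; set W := 1%:M + G.
have Wu : W \in unitmx by exact: unit1D.
have key x : dot (f - x) (f - x) + dot x (G *m x) = dot f f - 2 * dot f x + dot x (W *m x).
  rewrite /W mulmxDl mul1mx !(dotDl, dotDr, dotNl, dotNr) (dotC x f); ring.
rewrite key /u mulmxDr mulKVmx// /smooth mulmxBl mul1mx -/W.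
rewrite !(dotDl, dotDr, dotNl, dotNr).
rewrite (psd_sym (invmx W *m f) h (sym1D pG)) -/W mulKVmx// (dotC (invmx W *m f) f).
rewrite (dotC h f); ring.
Qed.

Lemma smooth_le G f u : psd G ->
  dot f (smooth G *m f) <= dot (f - u) (f - u) + dot u (G *m u).
Proof.
move=> pG; have := smoothE f (u - invmx (1%:M + G) *m f) pG.
rewrite /= subrKC => ->; rewrite lerDl; exact: (psd1D pG).2.
Qed.

Lemma smooth_attained G f : psd G -> exists u,
  dot f (smooth G *m f) = dot (f - u) (f - u) + dot u (G *m u).
Proof.
move=> pG; exists (invmx (1%:M + G) *m f).
by have := smoothE f 0 pG; rewrite /= !addr0 mulmx0 dot0r addr0 => ->.
Qed.

Lemma smooth_psd G : psd G -> psd (smooth G).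
Proof.
move=> pG; split=> [|f]; first exact: smooth_sym.
by have [u ->] := smooth_attained f pG; rewrite addr_ge0 ?dot_ge0//; apply: pG.2.
Qed.

Lemma smooth_le1 G f : psd G -> dot f (smooth G *m f) <= dot f f.
Proof.
by move=> pG; have := smooth_le f 0 pG; rewrite subr0 dot0l addr0.
Qed.

Lemma smooth_leG G f : psd G -> dot f (smooth G *m f) <= dot f (G *m f).
Proof.
by move=> pG; have := smooth_le f f pG; rewrite subrr dot0l add0r.
Qed.

Lemma smooth_ker G (f : 'cV[R]_n) : psd G -> G *m f = 0 -> smooth G *m f = 0.
Proof.
move=> pG Gf; rewrite /smooth mulmxBl mul1mx.
have <- : (1%:M + G) *m f = f by rewrite mulmxDl mul1mx Gf addr0.
by rewrite mulKmx ?unit1D// mulmxDl mul1mx Gf addr0 subrr.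
Qed.

(** [0 <= S <= I] gives [S^2 <= S]; this is [form_inv_le] with [W = I]. *)
Lemma smooth_contract G f : psd G ->
  dot (smooth G *m f) (smooth G *m f) <= dot f (smooth G *m f).
Proof.
move=> pG; have pS := smooth_psd pG.
have := @form_inv_le _ _ (smooth G) 1%:M f (unitmx1 _ _) (trmx1 _ _) pS.
rewrite invmx1 mul1mx; apply => u; rewrite mul1mx; exact: smooth_le1.
Qed.

Lemma smooth_norm G f : psd G -> dot (smooth G *m f) (smooth G *m f) <= dot f f.
Proof.
by move=> pG; apply: le_trans (smooth_contract f pG) (smooth_le1 f pG).
Qed.

End smoothing.

(** * Autoregressive correlations and their tridiagonal inverse *)

Section ar1.
Context (R : rcfType) (n : nat).

Definition ndist (i j : nat) : nat := ((i - j) + (j - i))%N.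

Definition corr (rho : R) : 'M[R]_n.+1 := \matrix_(i, j) rho ^+ ndist i j.

(** Indexed by [nat], so that [ev k.+1] and [ev n] need no proof of being in range; beyond [n] the
    vector is zero. *)
Definition ev (k : nat) : 'cV[R]_n.+1 := \col_i (i == k :> nat)%:R.

Definition lap : 'M[R]_n.+1 :=
  \sum_(k < n) (ev k.+1 - ev k) *m (ev k.+1 - ev k)^T.

Definition bdry : 'M[R]_n.+1 := ev 0 *m (ev 0)^T + ev n *m (ev n)^T.

Definition prec (a b c : R) : 'M[R]_n.+1 := a%:M + b *: lap + c *: bdry.

Lemma rank1_form (e u v : 'cV[R]_n.+1) :
  dot u (e *m e^T *m v) = dot e u * dot e v.
Proof.
rewrite -mulmxA dot_mulmx -dotE mxE big_ord1 !dotE.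
by rewrite mxE dotE dotC (dotC e v) -(dotE v e) -dotE !dotE (dotC v).
Qed.

Lemma dot_ev (u : 'cV[R]_n.+1) (k : 'I_n.+1) : dot (ev k) u = u k ord0.
Proof.
rewrite dotC -dot_delta; congr dot; apply/colP => i; rewrite !mxE andbT.
by congr (_%:R); rewrite -val_eqE.
Qed.

Lemma lap_form u v : dot u (lap *m v) =
  \sum_(k < n) dot (ev k.+1 - ev k) u * dot (ev k.+1 - ev k) v.
Proof.
rewrite /lap mulmx_suml dot_sumr; apply: eq_bigr => k _; exact: rank1_form.
Qed.

Lemma bdry_form u v : dot u (bdry *m v) =
  dot (ev 0) u * dot (ev 0) v + dot (ev n) u * dot (ev n) v.
Proof. by rewrite /bdry mulmxDl dotDr !rank1_form. Qed.

Lemma lap_psd : psd lap.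
Proof.
split=> [|u]; last by rewrite lap_form sumr_ge0// => k _; rewrite -expr2 sqr_ge0.
rewrite /lap linear_sum/=; apply: eq_bigr => k _.
by rewrite trmx_mul trmxK.
Qed.

Lemma bdry_psd : psd bdry.
Proof.
split=> [|u]; last by rewrite bdry_form -!expr2 addr_ge0 ?sqr_ge0.
by rewrite /bdry linearD/= !trmx_mul !trmxK.
Qed.

Lemma scalar_psd a : 0 <= a -> psd (a%:M : 'M[R]_n.+1).
Proof. by move=> a0; rewrite -scalemx1; apply: psdZ => //; exact: psd1. Qed.

Lemma prec_psd a b c : 0 <= a -> 0 <= b -> 0 <= c -> psd (prec a b c).
Proof.
move=> a0 b0 c0; apply: psdD; first apply: psdD.
- exact: scalar_psd.
- by apply: psdZ => //; exact: lap_psd.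
- by apply: psdZ => //; exact: bdry_psd.
Qed.

Lemma prec_form a b c u : dot u (prec a b c *m u) =
  a * dot u u + b * dot u (lap *m u) + c * dot u (bdry *m u).
Proof.
by rewrite /prec 2!mulmxDl 2!dotDr mul_scalar_mx -!scalemxAl !dotZr.
Qed.

Definition ones : 'cV[R]_n.+1 := const_mx 1.

Lemma dot_ev_ones (k : nat) : (k < n.+1)%N -> dot (ev k) ones = 1.
Proof. by move=> kn; have := dot_ev ones (Ordinal kn); rewrite mxE. Qed.

Lemma lap_ones : lap *m ones = 0.
Proof.
rewrite /lap mulmx_suml big1// => k _; rewrite -mulmxA.
suff -> : (ev k.+1 - ev k)^T *m ones = 0 by rewrite mulmx0.
have kn : (k < n.+1)%N by rewrite ltnS ltnW.
have kn1 : (k.+1 < n.+1)%N by rewrite ltnS.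
by apply/matrixP => i j; rewrite !ord1 dotE mxE dotBl !dot_ev_ones ?subrr.
Qed.

Lemma bdry_ones : bdry *m ones = ev 0 + ev n.
Proof.
have H k : (k < n.+1)%N -> ev k *m (ev k)^T *m ones = ev k.
  move=> kn; rewrite -mulmxA; have -> : (ev k)^T *m ones = 1%:M.
    by apply/matrixP => i j; rewrite !ord1 dotE mxE eqxx dot_ev_ones.
  by rewrite mulmx1.
by rewrite /bdry mulmxDl !H.
Qed.

Lemma corr_ev rho i (k : 'I_n.+1) : (corr rho *m ev k) i ord0 = rho ^+ ndist i k.
Proof.
rewrite mxE (bigD1 k)//= !mxE eqxx mulr1 big1 ?addr0// => j jk.
by rewrite !mxE -val_eqE in jk *; rewrite (negbTE jk) mulr0.
Qed.

Lemma sum_pick (f : nat -> R) (m N : nat) :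
  \sum_(k < N) f k * (m == k :> nat)%:R = if (m < N)%N then f m else 0.
Proof.
case: ifPn => mN.
  rewrite (bigD1 (Ordinal mN))//= eqxx mulr1 big1 ?addr0// => j.
  by rewrite -val_eqE /= eq_sym => /negbTE ->; rewrite mulr0.
rewrite big1// => j _; case: eqVneq => [mj|_]; last by rewrite mulr0.
by rewrite mj ltn_ord in mN.
Qed.

Lemma corr_outer rho (u v : 'cV[R]_n.+1) i j :
  (corr rho *m (u *m v^T)) i j = (corr rho *m u) i ord0 * v j ord0.
Proof. by rewrite mulmxA mxE big_ord1 [v^T _ _]mxE. Qed.

Lemma corr_lap rho i j : (corr rho *m lap) i j =
  (if (0 < j)%N then rho ^+ ndist i j - rho ^+ ndist i j.-1 else 0) -
  (if (j < n)%N then rho ^+ ndist i j.+1 - rho ^+ ndist i j else 0).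
Proof.
rewrite /lap mulmx_sumr summxE.
pose f k : R := rho ^+ ndist i k.+1 - rho ^+ ndist i k.
transitivity (\sum_(k < n) (f k * (j == k.+1 :> nat)%:R - f k * (j == k :> nat)%:R)).
  apply: eq_bigr => k _; rewrite corr_outer.
  have k1 : (k.+1 < n.+1)%N by rewrite ltnS.
  have k2 : (k < n.+1)%N by rewrite ltnS ltnW.
  have -> : (corr rho *m (ev k.+1 - ev k)) i ord0 = f k.
    rewrite mulmxBr [LHS]mxE [X in _ + X]mxE.
    by rewrite (corr_ev rho i (Ordinal k1)) (corr_ev rho i (Ordinal k2)).
  by rewrite !mxE mulrBr.
rewrite sumrB sum_pick; congr (_ - _).
case: j => -[|j] /= jn.
  by rewrite big1// => k _; rewrite mulr0.
by under eq_bigr do rewrite eqSS; rewrite sum_pick ltnS in jn *; rewrite jn.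
Qed.

Lemma corr_bdry rho i j : (corr rho *m bdry) i j =
  rho ^+ ndist i 0 * (j == 0 :> nat)%:R + rho ^+ ndist i n * (j == n :> nat)%:R.
Proof.
rewrite /bdry mulmxDr mxE !corr_outer (corr_ev rho i ord0) (corr_ev rho i ord_max).
by rewrite !mxE.
Qed.

(** Checked entrywise: each entry combines at most three consecutive powers of [rho], and the
    boundary term compensates for the missing neighbour in the first and last columns. *)
Lemma corr_prec rho : 0 < rho < 1 ->
  corr rho *m prec ((1 - rho) / (1 + rho)) (rho / (1 - rho ^+ 2)) (rho / (1 + rho))
  = 1%:M.
Proof.
move=> /andP[r0 r1]; apply/matrixP => i j.
have r2 : 1 - rho ^+ 2 != 0.
  by rewrite gt_eqF// subr_gt0 expr_lt1// ltW.
have r3 : 1 + rho != 0 by rewrite gt_eqF// addr_gt0.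
have r4 : 1 - rho != 0 by rewrite subr_eq0 gt_eqF.
rewrite /prec !mulmxDr mul_mx_scalar -!scalemxAr.
rewrite mxE [X in X + _]mxE [X in _ + X + _]mxE [X in _ + X]mxE [X in X + _ + _]mxE.
rewrite [corr rho i j]mxE [1%:M i j]mxE.
rewrite corr_lap corr_bdry.
have -> : (i == j) = (i == j :> nat) by [].
have := ltn_ord i; have := ltn_ord j.
case: i j => [i /= _] [j /= _]; rewrite !ltnS => jn i_n.
case: (ltngtP i j) => [ij|ij|ij].
- have [d dE] : exists d, j = (i + d.+1)%N by exists (j - i).-1; lia.
  have e1 := exprS rho d; have e2 : rho ^+ d.+2 = rho * (rho * rho ^+ d) by rewrite !exprS.
  have -> : ndist i j = d.+1 by rewrite /ndist; lia.
  have -> : ndist i j.-1 = d by rewrite /ndist; lia.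
  have -> : ndist i j.+1 = d.+2 by rewrite /ndist; lia.
  have -> : (0 < j)%N by lia.
  have -> : (j == 0)%N = false by lia.
  have [jn'|jn'] := ltnP j n.
    have -> : (j == n) = false by lia.
    rewrite /= ?e1 ?e2 /nat_of_bool ?mulr0n ?mulr1n ?mulr0 ?mulr1; by field; rewrite ?r2 ?r3.
  have -> : (j == n) by lia.
  have -> : ndist i n = d.+1 by rewrite /ndist; lia.
  rewrite /= ?e1 ?e2 /nat_of_bool ?mulr0n ?mulr1n ?mulr0 ?mulr1; by field; rewrite ?r2 ?r3.
- have [d dE] : exists d, i = (j + d.+1)%N by exists (i - j).-1; lia.
  have e1 := exprS rho d; have e2 : rho ^+ d.+2 = rho * (rho * rho ^+ d) by rewrite !exprS.
  have -> : ndist i j = d.+1 by rewrite /ndist; lia.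
  have -> : ndist i j.+1 = d by rewrite /ndist; lia.
  have -> : (j < n)%N by lia.
  have -> : (j == n)%N = false by lia.
  have [jn'|jn'] := posnP j.
    have -> : ndist i 0 = d.+1 by rewrite /ndist; lia.
    rewrite /= ?e1 ?e2 /nat_of_bool ?mulr0n ?mulr1n ?mulr0 ?mulr1; by field; rewrite ?r2 ?r3.
  have -> : ndist i j.-1 = d.+2 by rewrite /ndist; lia.
  rewrite /= ?e1 ?e2 /nat_of_bool ?mulr0n ?mulr1n ?mulr0 ?mulr1; by field; rewrite ?r2 ?r3.
- have -> : ndist i j = 0 by rewrite /ndist; lia.
  have -> : ndist i j.+1 = 1 by rewrite /ndist; lia.
  have [jn'|jn'] := ltnP j n; have [j0|j0] := posnP j.
  + have -> : (j == n)%N = false by lia.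
    have -> : ndist i 0 = 0 by rewrite /ndist; lia.
    rewrite /nat_of_bool ?mulr0n ?mulr1n ?expr0 ?expr1 ?mulr0 ?mulr1; by field; rewrite ?r2 ?r3.
  + have -> : (j == n)%N = false by lia.
    have -> : ndist i j.-1 = 1 by rewrite /ndist; lia.
    rewrite /nat_of_bool ?mulr0n ?mulr1n ?expr0 ?expr1 ?mulr0 ?mulr1; by field; rewrite ?r2 ?r3.
  + have -> : (j == n)%N by lia.
    have -> : ndist i 0 = 0 by rewrite /ndist; lia.
    have -> : ndist i n = 0 by rewrite /ndist; lia.
    rewrite /nat_of_bool ?mulr0n ?mulr1n ?expr0 ?expr1 ?mulr0 ?mulr1; by field; rewrite ?r2 ?r3.
  + have -> : (j == n)%N by lia.
    have -> : ndist i j.-1 = 1 by rewrite /ndist; lia.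
    have -> : ndist i n = 0 by rewrite /ndist; lia.
    rewrite /nat_of_bool ?mulr0n ?mulr1n ?expr0 ?expr1 ?mulr0 ?mulr1; by field; rewrite ?r2 ?r3.
Qed.

Lemma sqr_sum_le N (f : 'I_N -> R) :
  (\sum_(k < N) f k) ^+ 2 <= N%:R * \sum_(k < N) f k ^+ 2.
Proof.
have := psd_dotCS (const_mx 1 : 'cV[R]_N) (\col_k f k).
rewrite /dot; under eq_bigr do rewrite !mxE mul1r.
under [X in _ <= X * _]eq_bigr do rewrite !mxE mul1r.
under [X in _ <= _ * X]eq_bigr do rewrite !mxE -expr2.
by rewrite sumr_const card_ord.
Qed.

(** Telescoping between the two indices, then Cauchy-Schwarz on the [ndist i j] increments. *)
Lemma lap_osc (u : 'cV[R]_n.+1) (i j : 'I_n.+1) :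
  (u i ord0 - u j ord0) ^+ 2 <= (ndist i j)%:R * dot u (lap *m u).
Proof.
wlog ij : i j / (i <= j)%N => [H|].
  have [/H//|/ltnW/H] := leqP i j.
  by rewrite -sqrrN opprB /ndist addnC.
pose g k := dot (ev k) u.
have gE (k : 'I_n.+1) : u k ord0 = g k by rewrite /g dot_ev.
rewrite !gE -sqrrN opprB -(telescope_sumr g ij).
have -> : ndist i j = (j - i)%N by rewrite /ndist; lia.
have CS (a b : nat) : (\sum_(a <= k < b) (g k.+1 - g k)) ^+ 2 <=
   (b - a)%:R * \sum_(a <= k < b) (g k.+1 - g k) ^+ 2.
  by rewrite -{1 3}[a]add0n !big_addn !big_mkord; exact: sqr_sum_le.
apply: le_trans (CS i j) _; rewrite ler_wpM2l// lap_form.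
have -> : \sum_(k < n) dot (ev k.+1 - ev k) u * dot (ev k.+1 - ev k) u =
   \sum_(0 <= k < n) (g k.+1 - g k) ^+ 2.
  by rewrite big_mkord; apply: eq_bigr => k _; rewrite dotBl -expr2.
have jn : (j <= n)%N by rewrite -ltnS.
rewrite (big_cat_nat (n := i) (leq0n i) (leq_trans ij jn))/=.
rewrite (big_cat_nat (n := j) ij jn)/= addrCA lerDl.
by rewrite addr_ge0// sumr_ge0// => k _; rewrite sqr_ge0.
Qed.

End ar1.

(** * Covariance matrices *)

Section reference_smoother.
Context (R : rcfType) (n : nat).

(* A smoother that does not depend on the covariance parameters; it replaces
   averaging over blocks of length [m]. *)
Definition refsm (m : nat) : 'M[R]_n.+1 := smooth (m%:R ^+ 2 *: lap R n).

Lemma refG_psd m : psd (m%:R ^+ 2 *: lap R n).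
Proof. by apply: psdZ; [rewrite sqr_ge0|exact: lap_psd]. Qed.

Lemma refsm_psd m : psd (refsm m).
Proof. exact/smooth_psd/refG_psd. Qed.

Lemma refsm_le1 m f : dot f (refsm m *m f) <= dot f f.
Proof. exact/smooth_le1/refG_psd. Qed.

Lemma refsm_contract m f :
  dot (refsm m *m f) (refsm m *m f) <= dot f (refsm m *m f).
Proof. exact/smooth_contract/refG_psd. Qed.

Lemma refsm_norm m f : dot (refsm m *m f) (refsm m *m f) <= dot f f.
Proof. exact/smooth_norm/refG_psd. Qed.

Lemma refsm_lap m f : dot f (refsm m *m f) <= m%:R ^+ 2 * dot f (lap R n *m f).
Proof. by rewrite -dotZr scalemxAl; exact/smooth_leG/refG_psd. Qed.

Lemma refsm_ones m : refsm m *m ones R n = 0.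
Proof.
by apply: smooth_ker; [exact: refG_psd|rewrite -scalemxAl lap_ones scaler0].
Qed.

(* A diagonal entry [g = u i] of [W^-1], with [u = W^-1 e_i], satisfies
   [g = u' W u] and, averaging [u i] over a window of length [m],
   [m g^2 <= 2 u' W u]. *)
Lemma refsm_diag m (i : 'I_n.+1) : (0 < m <= n.+1)%N ->
  (1%:M - refsm m) i i <= 2 / m%:R.
Proof.
move=> /andP[m0 mn]; rewrite /refsm /smooth opprB addrC subrK.
set G := _ *: _; set W := 1%:M + G.
pose u : 'cV[R]_n.+1 := invmx W *m delta_mx i ord0.
have pG := refG_psd m.
have Wu : W \in unitmx := unit1D pG.
have gE : invmx W i i = u i ord0 by rewrite /u -colE mxE.
have gW : u i ord0 = dot u u + m%:R ^+ 2 * dot u (lap R n *m u).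
  rewrite -dotZr scalemxAl -dotDr -[X in dot u (X + _)]mul1mx -mulmxDl -/W.
  by rewrite /u mulKVmx// dot_delta.
have mR : 0 < m%:R :> R by rewrite ltr0n.
have L0 : 0 <= dot u (lap R n *m u) := (lap_psd R n).2 u.
suff H : m%:R * u i ord0 ^+ 2 <= 2 * u i ord0.
  rewrite gE ler_pdivlMr//.
  have [g0|g0] := ltP 0 (u i ord0); last first.
    by rewrite (le_trans _ (ler0n _ 2))// mulr_le0_ge0// ltW.
  by rewrite -(ler_pM2l g0); move: H; rewrite expr2; lra.
have ar (s D L x M : R) : s <= D -> M * x ^+ 2 <= 2 * s + M * (2 * (M * L)) ->
    x = D + M ^+ 2 * L -> M * x ^+ 2 <= 2 * x by rewrite expr2; lra.
(* The window of length [m] ends at [i], or starts at [0] when [i] is too small for that; either way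
   it contains [i] and stays in range. *)
pose w0 := if (i.+1 < m)%N then 0%N else (i.+1 - m)%N.
have wP k : (k < m)%N -> (w0 + k < n.+1)%N.
  by rewrite /w0; case: ifPn; have := ltn_ord i; lia.
pose w (k : 'I_m) : 'I_n.+1 := Ordinal (wP _ (ltn_ord k)).
have wd k : (ndist i (w k) <= m)%N.
  by rewrite /ndist /w /= /w0; case: ifPn; have := ltn_ord k; lia.
have winj : injective w.
  by move=> k l /(congr1 val)/= /addnI/val_inj.
have step k : u i ord0 ^+ 2 <= 2 * u (w k) ord0 ^+ 2 + 2 * (m%:R * dot u (lap R n *m u)).
  have := lap_osc u i (w k).
  have : (ndist i (w k))%:R * dot u (lap R n *m u) <= m%:R * dot u (lap R n *m u).
    by rewrite ler_wpM2r// ler_nat.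
  have : 0 <= (u i ord0 - 2 * u (w k) ord0) ^+ 2 by rewrite sqr_ge0.
  set x := u i ord0; set y := u (w k) ord0; nra.
have : \sum_(k < m) u i ord0 ^+ 2 <=
   \sum_(k < m) (2 * u (w k) ord0 ^+ 2 + 2 * (m%:R * dot u (lap R n *m u))).
  by apply: ler_sum => k _; exact: step.
rewrite sumr_const card_ord big_split/= sumr_const card_ord -mulr_sumr.
have : \sum_(k < m) u (w k) ord0 ^+ 2 <= dot u u.
  rewrite /dot; under [leRHS]eq_bigr do rewrite -expr2.
  rewrite -(big_imset (fun j => u j ord0 ^+ 2))/=; last by move=> ? ? _ _ /winj.
  rewrite [leRHS](bigID (mem (w @: 'I_m)))/= lerDl sumr_ge0// => j _.
  exact: sqr_ge0.
move=> h1; rewrite -[X in X <= _]mulr_natl -[X in _ <= _ + X]mulr_natl => h2; exact: ar h1 h2 gW.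
Qed.

Lemma refsm_trace m : (0 < m <= n.+1)%N ->
  n.+1%:R - \tr (refsm m) <= 2 * n.+1%:R / m%:R.
Proof.
move=> hm; have -> : n.+1%:R = \tr (1%:M : 'M[R]_n.+1) by rewrite mxtrace1.
rewrite -linearB/= {2}/mxtrace /mxtrace.
apply: (@le_trans _ _ (\sum_(i < n.+1) (2 / m%:R : R))).
  by apply: ler_sum => i _; exact: refsm_diag.
rewrite sumr_const card_ord -mulr_natl.
have -> : \sum_i (1%:M : 'M[R]_n.+1) i i = n.+1%:R by exact: mxtrace1.
lra.
Qed.

End reference_smoother.

(** * The inverse covariance matrix as a smoother *)

Section covariance.
Context (R : rcfType) (n : nat) (rho s2 v2 : R).
Hypotheses (rho01 : 0 < rho < 1) (s2_gt0 : 0 < s2) (v2_gt0 : 0 < v2).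

Definition ca (rho : R) := (1 - rho) / (1 + rho).
Definition cb (rho : R) := rho / (1 - rho ^+ 2).
Definition cc (rho : R) := rho / (1 + rho).

Definition sig : 'M[R]_n.+1 := s2 *: corr n rho + v2%:M.

Local Notation Rm := (corr n rho).
Local Notation Q := (prec n (ca rho) (cb rho) (cc rho)).
Local Notation r := (v2 / s2).
Local Notation W := (1%:M + r *: Q).

Lemma ca_gt0 : 0 < ca rho.
Proof. by rewrite /ca; move: rho01 => /andP[? ?]; rewrite divr_gt0//; lra. Qed.
Lemma cb_gt0 : 0 < cb rho.
Proof.
by rewrite /cb; move: rho01 => /andP[? ?]; rewrite divr_gt0// subr_gt0 expr_lt1// ltW.
Qed.
Lemma cc_gt0 : 0 < cc rho.
Proof. by rewrite /cc; move: rho01 => /andP[? ?]; rewrite divr_gt0//; lra. Qed.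

Lemma Q_psd : psd Q.
Proof. by apply: prec_psd; rewrite ltW ?ca_gt0 ?cb_gt0 ?cc_gt0. Qed.

Lemma r_gt0 : 0 < r. Proof. by rewrite divr_gt0. Qed.

Lemma rQ_psd : psd (r *: Q).
Proof. by apply: psdZ; [rewrite ltW ?r_gt0|exact: Q_psd]. Qed.

Lemma RQ : Rm *m Q = 1%:M. Proof. exact: corr_prec. Qed.
Lemma QR : Q *m Rm = 1%:M. Proof. exact: mulmx1C RQ. Qed.

Lemma corr_sym : Rm^T = Rm.
Proof. by apply/matrixP => i j; rewrite !mxE /ndist addnC. Qed.

Lemma corr_psd : psd Rm.
Proof.
split=> [|u]; first exact: corr_sym.
have -> : dot u (Rm *m u) = dot (Rm *m u) (Q *m (Rm *m u)).
  by rewrite mulmxA QR mul1mx dotC.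
exact: Q_psd.2.
Qed.

Lemma Q_unit : Q \in unitmx. Proof. by have [] := mulmx1_unit QR. Qed.

Lemma invQ : invmx Q = Rm.
Proof. by rewrite -[LHS]mulmx1 -QR mulKmx// Q_unit. Qed.

Lemma sig_sym : sig^T = sig.
Proof. by rewrite linearD linearZ/= corr_sym tr_scalar_mx. Qed.

Lemma sig_form u : dot u (sig *m u) = s2 * dot u (Rm *m u) + v2 * dot u u.
Proof. by rewrite mulmxDl dotDr -scalemxAl mul_scalar_mx !dotZr. Qed.

Lemma sig_pd u : v2 * dot u u <= dot u (sig *m u).
Proof. by rewrite sig_form lerDr mulr_ge0 ?(ltW s2_gt0)//; exact: corr_psd.2. Qed.

Lemma sig_psd : psd sig.
Proof.
split=> [|u]; first exact: sig_sym.
by apply: le_trans (sig_pd u); rewrite mulr_ge0 ?dot_ge0// ltW.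
Qed.

Lemma sig_unit : sig \in unitmx.
Proof. by apply: (pd_unitmx v2_gt0); [exact: sig_sym|exact: sig_pd]. Qed.

(** As [Rm *m Q] is the identity, [sig = s2 Rm (I + r Q)], whence
    [sig^-1 = v2^-1 (I + r Q)^-1 r Q]. *)
Lemma sig_inv : invmx sig = v2^-1 *: smooth (r *: Q).
Proof.
suff H : sig *m (v2^-1 *: smooth (r *: Q)) = 1%:M.
  by rewrite -[LHS]mulmx1 -H mulKmx// sig_unit.
have Wu : W \in unitmx by apply: unit1D; exact: rQ_psd.
have -> : sig = s2 *: (Rm *m W).
  rewrite mulmxDr mulmx1 -scalemxAr RQ scalerDr scalerA scalemx1.
  by rewrite /sig mulrCA divff ?mulr1// gt_eqF.
rewrite -scalemxAl -scalemxAr /smooth mulmxBr mulmx1 mulmxK//.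
rewrite mulmxDr mulmx1 addrC addKr -scalemxAr RQ !scalerA scalemx1.
by congr (_%:M); field; rewrite !gt_eqF.
Qed.

Definition qf (f : 'cV[R]_n.+1) := dot f (invmx sig *m f).

Lemma qfE f : qf f = v2^-1 * dot f (smooth (r *: Q) *m f).
Proof. by rewrite /qf sig_inv -scalemxAl dotZr. Qed.

Lemma qf_le f u : qf f <= v2^-1 * dot (f - u) (f - u) + s2^-1 * dot u (Q *m u).
Proof.
rewrite qfE; have := smooth_le f u rQ_psd.
rewrite -scalemxAl dotZr -(ler_pM2l (_ : 0 < v2^-1)) ?invr_gt0// => /le_trans; apply.
by rewrite le_eqVlt; apply/orP; left; apply/eqP; field; rewrite !gt_eqF.
Qed.

Lemma qf_attained f : exists u,
  qf f = v2^-1 * dot (f - u) (f - u) + s2^-1 * dot u (Q *m u).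
Proof.
have [u uE] := smooth_attained f rQ_psd; exists u; rewrite qfE uE -scalemxAl dotZr.
by field; rewrite !gt_eqF.
Qed.

Lemma qf_psd : psd (invmx sig).
Proof. by apply: psd_inv; [exact: sig_unit|exact: sig_psd]. Qed.

(** Young's inequality at the minimizer [u]. The weight satisfies [M m^2 = r cb], so that the
    smoothed part of [u] costs no more than its share [r u' Q u] of the minimum. For close sites
    [cb] is large and the factor tends to [1]. *)
Lemma qf_lower m f (M := r * cb rho / m%:R ^+ 2) : (0 < m)%N ->
  dot f (refsm R n m *m f) <= (1 + M^-1) * (v2 * qf f).
Proof.
move=> m0; have mR : 0 < m%:R ^+ 2 :> R by rewrite exprn_gt0// ltr0n.
have M0 : 0 < M by rewrite divr_gt0// mulr_gt0 ?r_gt0 ?cb_gt0.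
have [u ->] := qf_attained f.
have := psd_young (f - u) u (refsm_psd R n m) M0; rewrite subrK => /le_trans; apply.
have h1 := refsm_le1 m (f - u); have h2 := refsm_lap m u.
set A := dot (f - u) _ in h1 *; set B := dot u (refsm _ _ _ *m u) in h2 *.
set Lu := dot u _ in h2.
have h3 : cb rho * Lu <= dot u (Q *m u).
  rewrite prec_form -/Lu; have := ca_gt0; have := cc_gt0.
  have := dot_ge0 u; have := (bdry_psd R n).2 u => *.
  by rewrite -addrA addrCA lerDl addr_ge0// mulr_ge0// ltW.
have -> : (1 + M^-1) * A + (1 + M) * B = (1 + M^-1) * (A + M * B).
  by field; rewrite gt_eqF.
rewrite ler_pM2l ?addr_gt0 ?invr_gt0//.
have -> : v2 * (v2^-1 * dot (f - u) (f - u) + s2^-1 * dot u (Q *m u)) =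
  dot (f - u) (f - u) + r * dot u (Q *m u) by field; rewrite !gt_eqF.
rewrite lerD//; have -> : M * B = r * (cb rho * (B / m%:R ^+ 2)).
  by rewrite /M; ring.
rewrite ler_pM2l ?r_gt0//; apply: le_trans h3.
by rewrite ler_pM2l ?cb_gt0// ler_pdivrMr// mulrC.
Qed.

(* [S Rm S] is small because [S <= m^2 lap <= (m^2 / cb) Rm^-1]. *)
Lemma refsm_corr m y : (0 < m)%N ->
  dot (refsm R n m *m y) (Rm *m (refsm R n m *m y)) <=
  m%:R ^+ 2 / cb rho * dot y y.
Proof.
move=> m0; have mR : 0 < m%:R ^+ 2 :> R by rewrite exprn_gt0// ltr0n.
have b0 := cb_gt0.
set k := m%:R ^+ 2 / cb rho; have k0 : 0 < k by rewrite divr_gt0.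
set S := refsm R n m.
have H := @form_inv_le _ _ (k^-1 *: S) Q y Q_unit Q_psd.1.
have {H} : dot (k^-1 *: S *m y) (invmx Q *m (k^-1 *: S *m y)) <=
   dot y (k^-1 *: S *m y).
  apply: H; first by apply: psdZ; [rewrite invr_ge0 ltW|exact: refsm_psd].
  move=> u; rewrite -scalemxAl dotZr prec_form /k invf_div.
  have h2 := refsm_lap m u.
  rewrite mulrC mulrA ler_pdivrMr//.
  have := ca_gt0; have := cc_gt0.
  have := dot_ge0 u; have := (bdry_psd R n).2 u => h3 h4 h5 h6.
  have h7 : dot u (S *m u) * cb rho <= (m%:R ^+ 2 * dot u (lap R n *m u)) * cb rho.
    by rewrite ler_pM2r.
  have : 0 <= (ca rho * dot u u + cc rho * dot u (bdry R n *m u)) * m%:R ^+ 2.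
    by apply: mulr_ge0 (ltW mR); apply: addr_ge0; apply: mulr_ge0 => //; exact: ltW.
  by move: h7; rewrite -/S; nra.
rewrite invQ -!scalemxAl -scalemxAr !(dotZl, dotZr) ler_pM2l ?invr_gt0//.
rewrite ler_pdivrMl// => h.
by apply: le_trans h _; rewrite ler_pM2l//; exact: refsm_le1.
Qed.

Lemma refsm_sig m y : (0 < m)%N ->
  dot (refsm R n m *m y) (sig *m (refsm R n m *m y)) <=
  (v2 + s2 * (m%:R ^+ 2 / cb rho)) * dot y y.
Proof.
move=> m0; rewrite sig_form addrC mulrDl lerD//.
  by rewrite ler_pM2l//; exact: refsm_norm.
by rewrite -mulrA ler_pM2l//; exact: refsm_corr.
Qed.

Lemma sig_diag i : sig i i = s2 + v2.
Proof. by rewrite !mxE /ndist subnn addn0 expr0 mulr1 eqxx mulr1n. Qed.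

Lemma sig_trace : \tr sig = n.+1%:R * (s2 + v2).
Proof.
rewrite /mxtrace; under eq_bigr do rewrite sig_diag.
by rewrite sumr_const card_ord mulr_natl.
Qed.

Lemma prec_ones : Q *m ones R n = ca rho *: ones R n + cc rho *: (ev R n 0 + ev R n n).
Proof.
rewrite /prec 2!mulmxDl mul_scalar_mx -!scalemxAl lap_ones bdry_ones scaler0.
by rewrite addr0.
Qed.

(** As [lap] kills constants, only [ca], of the order of the spacing, and [cc] at the two ends
    survive. [cross_ones] depends on this exact cancellation. *)
Lemma sig_inv_ones : invmx sig *m ones R n =
  s2^-1 *: (invmx W *m (ca rho *: ones R n + cc rho *: (ev R n 0 + ev R n n))).
Proof.
have Wu : W \in unitmx by apply: unit1D; exact: rQ_psd.
rewrite sig_inv -prec_ones.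
have -> : smooth (r *: Q) = invmx W *m (r *: Q).
  rewrite /smooth -{1}(mulVmx Wu) -[X in _ - X]mulmx1 -mulmxBr; congr (_ *m _).
  by rewrite addrC addKr.
rewrite -scalemxAr !scalemxAl scalerA !mulmxA; congr (_ *: _ *m _ *m _).
by field; rewrite !gt_eqF.
Qed.

Lemma dot_ones : dot (ones R n) (ones R n) = n.+1%:R.
Proof.
rewrite /dot; under eq_bigr do rewrite !mxE mulr1.
by rewrite sumr_const card_ord.
Qed.

Lemma corr_ones_le1 : dot (ones R n) (Rm *m ones R n) <= n.+1%:R ^+ 2.
Proof.
rewrite /dot; under eq_bigr do rewrite mxE mul1r mxE.
apply: (@le_trans _ _ (\sum_(i < n.+1) \sum_(j < n.+1) (1 : R))).
  apply: ler_sum => i _; apply: ler_sum => j _; rewrite !mxE mulr1.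
  by move: rho01 => /andP[? ?]; rewrite exprn_ile1// ltW.
by rewrite !sumr_const !card_ord expr2 mulr_natl.
Qed.

(** [ca I <= Q] gives [ca Q^-1 <= I], and [Q^-1] is the correlation matrix. *)
Lemma corr_ones_le2 : ca rho * dot (ones R n) (Rm *m ones R n) <= n.+1%:R.
Proof.
have a0 := ca_gt0.
have := @form_inv_le _ _ ((ca rho)%:M) Q (ones R n) Q_unit Q_psd.1 (scalar_psd n (ltW a0)).
rewrite invQ !mul_scalar_mx -scalemxAr !dotZl !dotZr dot_ones ler_pM2l//.
apply => u; rewrite prec_form mul_scalar_mx dotZr -addrA lerDl.
by rewrite addr_ge0// mulr_ge0 ?(ltW cb_gt0) ?(ltW cc_gt0)//;
  [exact: (lap_psd R n).2|exact: (bdry_psd R n).2].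
Qed.

(** Cauchy-Schwarz for [sig] between [sig^-1 1] and [1]. *)
Lemma qf_ones_ge : n.+1%:R ^+ 2 <= qf (ones R n) *
  (s2 * dot (ones R n) (Rm *m ones R n) + v2 * n.+1%:R).
Proof.
have := psd_CS (invmx sig *m ones R n) (ones R n) sig_psd.
rewrite (psd_sym _ _ sig_sym) mulKVmx ?sig_unit// dot_ones.
rewrite (dotC (invmx sig *m _)) sig_form dot_ones.
by rewrite /qf.
Qed.

(** This bound and the next match the two vectors of [sig_inv_ones]: [1] is the order of the
    contribution of the ends, [n ca^2] that of the constant vector. *)
Lemma qf_ones_ge1 : 1 <= qf (ones R n) * (s2 + v2).
Proof.
have N0 : 1 <= n.+1%:R :> R by rewrite ler1n.
have h1 := corr_ones_le1; have h2 := qf_ones_ge.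
have X0 : 0 <= qf (ones R n) := qf_psd.2 _.
have h3 : n.+1%:R ^+ 2 <= qf (ones R n) * (s2 * n.+1%:R ^+ 2 + v2 * n.+1%:R ^+ 2).
  apply: le_trans h2 _; rewrite ler_wpM2l// lerD// ler_pM2l//.
  by rewrite expr2 ler_peMl//; lra.
rewrite -mulrDl mulrA ler_pMl// in h3; rewrite exprn_gt0//; lra.
Qed.

Lemma qf_ones_ge2 : ca rho <= 1 ->
  n.+1%:R * ca rho ^+ 2 <= qf (ones R n) * (s2 + v2).
Proof.
move=> a1; have a0 := ca_gt0.
have N0 : 1 <= n.+1%:R :> R by rewrite ler1n.
have h1 := corr_ones_le2; have h2 := qf_ones_ge.
have X0 : 0 <= qf (ones R n) := qf_psd.2 _.
have h3 : ca rho * n.+1%:R ^+ 2 <= qf (ones R n) * ((s2 + v2) * n.+1%:R).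
  apply: (@le_trans _ _ (qf (ones R n) *
     (s2 * (ca rho * dot (ones R n) (Rm *m ones R n)) + ca rho * (v2 * n.+1%:R)))).
    have -> : qf (ones R n) *
     (s2 * (ca rho * dot (ones R n) (Rm *m ones R n)) + ca rho * (v2 * n.+1%:R)) =
     ca rho * (qf (ones R n) *
       (s2 * dot (ones R n) (Rm *m ones R n) + v2 * n.+1%:R)) by ring.
    by rewrite ler_pM2l.
  rewrite ler_wpM2l// mulrDl lerD//; first by rewrite ler_pM2l.
  by rewrite ler_piMl// mulr_ge0 ?ltW//; lra.
have {}h3 : ca rho * n.+1%:R <= qf (ones R n) * (s2 + v2).
  rewrite -(ler_pM2r (_ : 0 < n.+1%:R)); last by lra.
  by move: h3; rewrite expr2 !mulrA.
have h4 : ca rho * (ca rho * n.+1%:R) <= ca rho * n.+1%:R.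
  by rewrite ler_piMl// mulr_ge0//; lra.
have -> : n.+1%:R * ca rho ^+ 2 = ca rho * (ca rho * n.+1%:R) by ring.
exact: (le_trans h4).
Qed.

End covariance.

(** The minimizer for the second parameter competes in the minimum for the first. One factor [K]
    pays for the coefficients of the precision matrix, another for the variance in front of it. *)
Lemma qf_compare (R : rcfType) (n : nat) (rho s2 v2 rho' s2' v2' K : R)
    (f : 'cV[R]_n.+1) :
  0 < rho < 1 -> 0 < s2 -> 0 < v2 -> 0 < rho' < 1 -> 0 < s2' -> 0 < v2' -> 1 <= K ->
  ca rho <= K * ca rho' -> cb rho <= K * cb rho' -> cc rho <= K * cc rho' ->
  s2^-1 <= K * s2'^-1 -> v2^-1 <= K * v2'^-1 ->
  qf rho s2 v2 f <= K ^+ 2 * qf rho' s2' v2' f.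
Proof.
move=> r1 s0 v0 r1' s0' v0' K1 ha hb hc hs hv.
have [u ->] := qf_attained r1' s0' v0' f.
apply: le_trans (qf_le r1 s0 v0 f u) _.
have K0 : 0 < K by lra.
rewrite mulrDr !mulrA lerD//.
  rewrite ler_wpM2r ?dot_ge0//; apply: le_trans hv _.
  by rewrite ler_pM2r ?invr_gt0// expr2 ler_peMl// ltW.
rewrite -mulrA.
apply: (@le_trans _ _ (s2^-1 * (K * dot u (prec n (ca rho') (cb rho') (cc rho') *m u)))).
  rewrite ler_pM2l ?invr_gt0// !prec_form !mulrDr.
  rewrite !lerD// [leRHS]mulrA; apply: ler_wpM2r => //.
  - exact: dot_ge0.
  - exact: (lap_psd R n).2.
  - exact: (bdry_psd R n).2.
rewrite [leRHS]mulrA.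
have -> : K ^+ 2 / s2' * dot u (prec n (ca rho') (cb rho') (cc rho') *m u) =
  (K * s2'^-1) * (K * dot u (prec n (ca rho') (cb rho') (cc rho') *m u)) by ring.
apply: ler_wpM2r => //; apply: mulr_ge0; first lra.
exact: (Q_psd n r1').2.
Qed.

(** * Expanding the resolvent *)

Section resolvent.
Context (R : rcfType) (n : nat).

(** Cauchy-Schwarz for [V] between [W^-1 z] and [V^-1 z]. *)
Lemma inv_antitone (V W : 'M[R]_n) k z : V \in unitmx -> W \in unitmx ->
  psd V -> psd W -> 0 < k -> (forall u, dot u (V *m u) <= k * dot u (W *m u)) ->
  dot z (invmx W *m z) <= k * dot z (invmx V *m z).
Proof.
move=> Vu Wu pV pW k0 VW; set t := invmx W *m z.
have tE : dot z t = dot t (W *m t) by rewrite /t mulKVmx// dotC.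
have := psd_CS t (invmx V *m z) pV; rewrite mulKVmx// (dotC t z) (dotC (invmx V *m z) z).
have := VW t; rewrite -tE; set X := dot z t; set Y := dot z _; set Z := dot t _.
have Y0 : 0 <= Y := (psd_inv Vu pV).2 z.
move=> h1 h2; have [X0|X0] := ltP 0 X; last first.
  by apply: (le_trans X0); rewrite mulr_ge0// ltW.
rewrite -(ler_pM2l X0) -expr2; apply: (le_trans h2).
by apply: (@le_trans _ _ (k * X * Y)); [rewrite ler_wpM2r|rewrite mulrCA mulrA].
Qed.

Lemma inv_le1 (V : 'M[R]_n) z : psd V ->
  dot z (invmx (1%:M + V) *m z) <= dot z z.
Proof.
move=> pV; have := (smooth_psd pV).2 z; rewrite /smooth mulmxBl mul1mx dotBr.
by rewrite subr_ge0.
Qed.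

Lemma inv_norm (V : 'M[R]_n) z : psd V ->
  dot (invmx (1%:M + V) *m z) (invmx (1%:M + V) *m z) <=
  dot z (invmx (1%:M + V) *m z).
Proof.
move=> pV; set t := invmx _ *m z.
have -> : dot z t = dot t ((1%:M + V) *m t) by rewrite /t mulKVmx ?unit1D// dotC.
by rewrite mulmxDl mul1mx dotDr lerDl; exact: pV.2.
Qed.

Variables (A : 'I_3 -> 'M[R]_n).

Local Notation Wb := (\sum_i A i).

(* For fixed [x], a quadratic form in [y] that dominates [(x' W^-1 y)^2], up to
   an error of order [4^-k], simultaneously for all [W] near [Wb]: it comes from
   iterating the resolvent identity and squaring. Not depending on [W], it can
   be bounded in probability. *)
Fixpoint chain (k : nat) (x y : 'cV[R]_n) : R :=
  if k is k'.+1 then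
    3 / 2 * (dot x (invmx Wb *m y) ^+ 2 +
             6^-1 * \sum_i chain k' x (A i *m (invmx Wb *m y)))
  else 0.

(** The expectation of [chain k x y] when [x] is white noise of variance [v], for then [(x' f)^2]
    has mean [v |f|^2]. *)
Fixpoint chain_mean (v : R) (k : nat) (y : 'cV[R]_n) : R :=
  if k is k'.+1 then
    3 / 2 * (v * dot (invmx Wb *m y) (invmx Wb *m y) +
             6^-1 * \sum_i chain_mean v k' (A i *m (invmx Wb *m y)))
  else 0.

Hypothesis pA : forall i, psd (A i).
Hypothesis A0 : A ord0 = 1%:M.

Lemma Wb_psd : psd (\sum_(i < 2) A (lift ord0 i)).
Proof.
elim/big_ind : _ => // [|x y px py]; last exact: psdD.
by split=> [|u]; rewrite ?trmx0// mul0mx dot0r.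
Qed.

Lemma WbE : Wb = 1%:M + \sum_(i < 2) A (lift ord0 i).
Proof. by rewrite big_ord_recl A0. Qed.

Lemma Wb_unit : Wb \in unitmx.
Proof. by rewrite WbE; apply: unit1D; exact: Wb_psd. Qed.

(** Each [A i] is at most [Wb], so [form_inv_le] applies termwise, and the resulting bounds
    [t' A_i t] add up to [t' Wb t]. Branching thus never increases the total. *)
Lemma chain_step y :
  \sum_i dot (A i *m (invmx Wb *m y)) (invmx Wb *m (A i *m (invmx Wb *m y)))
  <= dot y (invmx Wb *m y).
Proof.
set t := invmx Wb *m y.
have -> : dot y t = \sum_i dot t (A i *m t).
  by rewrite -dot_sumr -mulmx_suml /t mulKVmx ?Wb_unit// dotC.
apply: ler_sum => i _; apply: form_inv_le => //; first exact: Wb_unit.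
  by rewrite WbE; apply: sym1D; exact: Wb_psd.
move=> u; rewrite mulmx_suml dot_sumr (bigD1 i)//= lerDl sumr_ge0// => j _.
exact: (pA j).2.
Qed.

(** The factor [2] reproduces itself under the recursion: [3/2 (1 + 2/6) = 2]. *)
Lemma chain_mean_le v k y : 0 <= v ->
  chain_mean v k y <= 2 * v * dot y (invmx Wb *m y).
Proof.
move=> v0; elim: k y => [|k IHk] y /=.
  rewrite mulr_ge0// ?mulr_ge0// WbE; apply: (psd_inv _ (psd1D Wb_psd)).2.
  by apply: unit1D; exact: Wb_psd.
have h1 : v * dot (invmx Wb *m y) (invmx Wb *m y) <= v * dot y (invmx Wb *m y).
  by rewrite ler_wpM2l// WbE; apply: inv_norm; exact: Wb_psd.
have h2 : \sum_i chain_mean v k (A i *m (invmx Wb *m y)) <=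
    2 * v * dot y (invmx Wb *m y).
  apply: (@le_trans _ _ (2 * v * \sum_i dot (A i *m (invmx Wb *m y))
      (invmx Wb *m (A i *m (invmx Wb *m y))))); last first.
    by rewrite ler_wpM2l ?mulr_ge0//; exact: chain_step.
  by rewrite mulr_sumr; apply: ler_sum => i _; exact: IHk.
by move: h1 h2; rewrite -mulrA; lra.
Qed.

Variable c : 'I_3 -> R.
Hypothesis c6 : forall i, `|c i| <= 6^-1.
Hypothesis c0 : c ord0 = 0.

Local Notation W := (\sum_i (1 + c i) *: A i).

Lemma W_psd : psd (\sum_(i < 2) (1 + c (lift ord0 i)) *: A (lift ord0 i)).
Proof.
elim/big_ind : _ => // [|x y px py|i _]; [|exact: psdD|].
  by split=> [|u]; rewrite ?trmx0// mul0mx dot0r.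
by apply: psdZ => //; have := c6 (lift ord0 i); rewrite ler_norml; lra.
Qed.

Lemma WE : W = 1%:M + \sum_(i < 2) (1 + c (lift ord0 i)) *: A (lift ord0 i).
Proof. by rewrite big_ord_recl c0 addr0 scale1r A0. Qed.

Lemma W_unit : W \in unitmx.
Proof. by rewrite WE; apply: unit1D; exact: W_psd. Qed.

Lemma resolvent_step (y : 'cV[R]_n) :
  invmx W *m y = invmx Wb *m y - \sum_i c i *: (invmx W *m (A i *m (invmx Wb *m y))).
Proof.
have -> : invmx Wb *m y = invmx W *m (W *m (invmx Wb *m y)) by rewrite mulKmx ?W_unit.
have -> : \sum_i c i *: (invmx W *m (A i *m (invmx W *m (W *m (invmx Wb *m y))))) =
  invmx W *m ((\sum_i c i *: A i) *m (invmx Wb *m y)).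
  rewrite [in RHS]mulmx_suml mulmx_sumr; apply: eq_bigr => i _.
  by rewrite mulKmx ?W_unit// -scalemxAl -scalemxAr.
rewrite -mulmxBr -mulmxBl; congr (_ *m _).
have -> : W - \sum_i c i *: A i = Wb.
  by rewrite -sumrB; apply: eq_bigr => i _; rewrite scalerDl scale1r addrK.
by rewrite mulKVmx ?Wb_unit.
Qed.

(** With [e] the subtracted sum, [(p - e)^2 <= 3/2 p^2 + 3 e^2], and Cauchy-Schwarz gives
    [e^2 <= 3/36] times the sum of the [q i ^+ 2]. *)
Lemma wsum3 (p : R) (q : 'I_3 -> R) :
  (p - \sum_i c i * q i) ^+ 2 <= 3 / 2 * (p ^+ 2 + 6^-1 * \sum_i q i ^+ 2).
Proof.
rewrite !big_ord_recr !big_ord0/= !add0r.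
have := c6 ord_max; have := c6 (widen_ord (leqnSn 2) ord_max).
have := c6 (widen_ord (leqnSn 2) (widen_ord (leqnSn 1) ord_max)).
set a := c _; set b := c _; set d := c _; set s := q _; set t := q _; set u := q _.
move=> ha hb hd.
have sq (z : R) : `|z| <= 6^-1 -> z ^+ 2 <= 36^-1.
  move=> hz; rewrite -[z ^+ 2]ger0_norm ?sqr_ge0// normrX.
  by rewrite (_ : 36^-1 = 6^-1 ^+ 2); [rewrite lerXn2r ?nnegrE ?invr_ge0|field].
have := sq _ ha; have := sq _ hb; have := sq _ hd => h1 h2 h3.
have CS : (a * s + b * t + d * u) ^+ 2 <=
    (a ^+ 2 + b ^+ 2 + d ^+ 2) * (s ^+ 2 + t ^+ 2 + u ^+ 2).
  rewrite -subr_ge0; have -> : (a ^+ 2 + b ^+ 2 + d ^+ 2) * (s ^+ 2 + t ^+ 2 + u ^+ 2) -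
    (a * s + b * t + d * u) ^+ 2 =
    (a * t - b * s) ^+ 2 + (a * u - d * s) ^+ 2 + (b * u - d * t) ^+ 2 by ring.
  by rewrite !addr_ge0 ?sqr_ge0.
have {}CS : (a * s + b * t + d * u) ^+ 2 <= 12^-1 * (s ^+ 2 + t ^+ 2 + u ^+ 2).
  apply: le_trans CS _; rewrite ler_wpM2r ?addr_ge0 ?sqr_ge0//; lra.
have aux (p' e E : R) : e ^+ 2 <= 12^-1 * E ->
    (p' - e) ^+ 2 <= 3 / 2 * (p' ^+ 2 + 6^-1 * E).
  by have := sqr_ge0 (p' + 2 * e); rewrite !expr2; lra.
exact: aux.
Qed.

(** Each use of the resolvent identity multiplies the remainder by [3/2 * 1/6 = 1/4]. At depth zero,
    Cauchy-Schwarz is combined with [I <= W] and [Wb <= 2 W]. *)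
Lemma chain_bound k x y : dot x (invmx W *m y) ^+ 2 <=
  chain k x y + 4^-1 ^+ k * (2 * dot x x * dot y (invmx Wb *m y)).
Proof.
elim: k y => [|k IHk] y.
  rewrite /= add0r expr0 mul1r.
  have piW : psd (invmx W).
    by apply: psd_inv; [exact: W_unit|rewrite WE; apply: psd1D; exact: W_psd].
  apply: le_trans (psd_CS x y piW) _.
  rewrite (mulrC 2) -mulrA ler_pM//; [exact: piW.2|exact: piW.2| |].
    by rewrite WE; apply: inv_le1; exact: W_psd.
  apply: inv_antitone => //; [exact: Wb_unit|exact: W_unit| | |].
  - by rewrite WbE; apply: psd1D; exact: Wb_psd.
  - by rewrite WE; apply: psd1D; exact: W_psd.
  - move=> u; rewrite !mulmx_suml !dot_sumr mulr_sumr; apply: ler_sum => i _.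
    rewrite -scalemxAl dotZr mulrA ler_peMl ?(pA i).2//.
    by have := c6 i; rewrite ler_norml; lra.
rewrite resolvent_step dotBr.
have -> : dot x (\sum_i c i *: (invmx W *m (A i *m (invmx Wb *m y)))) =
    \sum_i c i * dot x (invmx W *m (A i *m (invmx Wb *m y))).
  by rewrite dot_sumr; apply: eq_bigr => i _; rewrite dotZr.
apply: le_trans (wsum3 _ _) _ => /=.
set p2 := dot x _ ^+ 2; set D := dot y _.
have h1 := chain_step y; rewrite -/D in h1.
set e : R := 4^-1 ^+ k.
have e0 : 0 <= e by rewrite exprn_ge0// invr_ge0.
have h2 : \sum_i dot x (invmx W *m (A i *m (invmx Wb *m y))) ^+ 2 <=
  \sum_i chain k x (A i *m (invmx Wb *m y)) + e * (2 * dot x x * D).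
  apply: (@le_trans _ _ (\sum_i (chain k x (A i *m (invmx Wb *m y)) +
    e * (2 * dot x x * dot (A i *m (invmx Wb *m y))
       (invmx Wb *m (A i *m (invmx Wb *m y))))))).
    by apply: ler_sum => i _; exact: IHk.
  rewrite big_split/= lerD2l -mulr_sumr ler_wpM2l// -mulr_sumr ler_wpM2l//.
  by rewrite mulr_ge0// dot_ge0.
rewrite exprS -/e; set S1 := \sum_i chain _ _ _ in h2 *.
set S2 := \sum_i _ in h2 *; set Y := _ * D in h2 *.
have -> : 3 / 2 * (p2 + 6^-1 * S1) + 4^-1 * e * Y =
  3 / 2 * (p2 + 6^-1 * (S1 + e * Y)) by field.
by rewrite ler_pM2l ?divr_gt0// lerD2l ler_pM2l// invr_gt0.
Qed.

End resolvent.

(** * Determinants and a grid of parameters *)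

Section determinants.
Context (R : realType).

(** Hadamard's inequality, then [x <= exp (x - 1)] on the diagonal. *)
Lemma det_le_exp n (A : 'M[R]_n) (v : R) : 0 < v -> A^T = A ->
  (forall u, v * dot u u <= dot u (A *m u)) -> \det A <= expR (\tr A - n%:R).
Proof.
move=> v0 As Av; have [C [_ _ /le_trans]] := pd_chol v0 As Av; apply.
have -> : \tr A - n%:R = \sum_i (A i i - 1).
  by rewrite sumrB sumr_const card_ord.
rewrite expR_sum; apply: ler_prod => i _; apply/andP; split; last first.
  by have := expR_ge1Dx (A i i - 1); rewrite addrC subrK.
by rewrite -form_delta; apply: le_trans (Av _); rewrite mulr_ge0 ?dot_ge0 ?ltW.
Qed.

Lemma det_ge1 n (A : 'M[R]_n) : A^T = A ->
  (forall u, dot u u <= dot u (A *m u)) -> 1 <= \det A.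
Proof.
move=> As A1; have A1' u : 1 * dot u u <= dot u (A *m u) by rewrite mul1r.
by have [C [_ + _]] := pd_chol ltr01 As A1'; rewrite expr1n.
Qed.

Variables (n : nat) (rho s2 v2 : R).
Hypotheses (rho01 : 0 < rho < 1) (s2_gt0 : 0 < s2) (v2_gt0 : 0 < v2).

Local Notation N := (n.+1%:R : R).

Lemma sig_det_ge : v2 ^+ n.+1 <= \det (sig n rho s2 v2).
Proof.
by have [C [_ ? _]] := pd_chol v2_gt0 (sig_sym n rho s2 v2)
  (sig_pd v2 rho01 s2_gt0).
Qed.

(* [det A <= exp (tr (K A K) - N) / det K ^ 2] for every symmetric [K]. Taking
   for [K] the filter [(1 - t) I + t S] makes [K A K] close to the identity
   while [tr (I - K)] stays small. *)
Lemma sig_det_le (m : nat) (t : R) : (0 < m <= n.+1)%N -> 0 < t < 1 ->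
  \det (sig n rho s2 v2) <= v2 ^+ n.+1 *
    expR (N * (s2 / v2 * (2 * (1 - t) ^+ 2 + 2 * (m%:R ^+ 2 / cb rho))
               + 4 * (t / (1 - t)) / m%:R)).
Proof.
move=> mn /andP[t0 t1]; have m0 : (0 < m)%N by case/andP: mn.
set Sg := sig n rho s2 v2; set S := refsm R n m; set P := 1%:M - S.
have pS : psd S by exact: refsm_psd.
have Ps : P^T = P by rewrite linearB/= trmx1 pS.1.
have PE : P = invmx (1%:M + m%:R ^+ 2 *: lap R n).
  by rewrite /P /S /refsm /smooth opprB addrC subrK.
pose g := t / (1 - t).
have t1' : 0 < 1 - t by rewrite subr_gt0.
have g0 : 0 < g by rewrite divr_gt0.
pose K := 1%:M - t *: P.
have Ks : K^T = K by rewrite linearB linearZ/= trmx1 Ps.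
have KE : K = (1 - t)%:M + t *: S.
  by rewrite /K /P scalerBr scalemx1 opprB addrCA -raddfB/= addrC.
have Kform u : dot u (K *m u) = (1 - t) * dot u u + t * dot u (S *m u).
  by rewrite KE mulmxDl dotDr mul_scalar_mx -scalemxAl !dotZr.
have S0 u : 0 <= dot u (S *m u) := pS.2 u.
have S1 u : dot u (S *m u) <= dot u u by exact: refsm_le1.
have K0 u : (1 - t) * dot u u <= dot u (K *m u).
  by rewrite Kform lerDl; apply: mulr_ge0 => //; exact: ltW.
have K1 u : dot u (K *m u) <= dot u u.
  rewrite Kform; have : t * dot u (S *m u) <= t * dot u u by rewrite ler_pM2l.
  lra.
have pK : psd K.
  by split=> // u; apply: le_trans (K0 u); apply: mulr_ge0 (ltW t1') (dot_ge0 _).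
have Kn1 u : dot (K *m u) (K *m u) <= dot u u.
  apply: le_trans (K1 u).
  have := @form_inv_le _ _ K 1%:M u (unitmx1 _ _) (trmx1 _ _) pK.
  by rewrite invmx1 mul1mx; apply => w; rewrite mul1mx.
have Kn0 u : (1 - t) ^+ 2 * dot u u <= dot (K *m u) (K *m u).
  have := psd_dotCS u (K *m u); have := K0 u; have := dot_ge0 u.
  set a := dot u u; set b := dot u _; set c := dot (K *m u) _ => a0 h1 h2.
  have [a0'|a0'] := ltP 0 a; last first.
    have -> : a = 0 by apply/eqP; rewrite eq_le a0' a0.
    by rewrite mulr0 dot_ge0.
  rewrite -(ler_pM2l a0'); apply: le_trans h2.
  have : ((1 - t) * a) ^+ 2 <= b ^+ 2.
    have p := mulr_ge0 (ltW t1') a0.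
    by rewrite lerXn2r// nnegrE// (le_trans p).
  by apply: le_trans; rewrite le_eqVlt; apply/orP; left; apply/eqP; ring.
have detK : 1 <= \det K * expR (2 * g * N / m%:R).
  (* [H] nearly inverts [K]: as [0 <= P <= I], [K H = I + t g (P - P^2) >= I]. A lower bound for
     [det K] thus follows from an upper bound for [det H]. *)
  pose H := 1%:M + g *: P.
  have Hpd u : 1 * dot u u <= dot u (H *m u).
    rewrite mul1r mulmxDl mul1mx dotDr lerDl -scalemxAl dotZr.
    apply: mulr_ge0; first exact: ltW.
    by rewrite /P mulmxBl mul1mx dotBr subr_ge0.
  have Hs : H^T = H by rewrite linearD linearZ/= trmx1 Ps.
  have detH : \det H <= expR (2 * g * N / m%:R).
    apply: (le_trans (det_le_exp ltr01 Hs Hpd)); rewrite ler_expR.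
    rewrite linearD linearZ/= mxtrace1 addrC addKr.
    have := refsm_trace R mn; rewrite -/S => h.
    have -> : 2 * g * N / m%:R = g * (2 * N / m%:R) by ring.
    rewrite ler_pM2l//; apply: le_trans h.
    by rewrite /P linearB/= mxtrace1.
  have KH : K *m H = 1%:M + (t * g) *: (P - P *m P).
    have gt : g = t + t * g by rewrite /g; field; rewrite gt_eqF.
    suff E (X : 'M[R]_n.+1) : (1%:M - t *: X) *m (1%:M + g *: X) =
       1%:M + (t * g) *: (X - X *m X) by exact: E.
    rewrite mulmxBl mul1mx -scalemxAl mulmxDr mulmx1 -scalemxAr {1}gt.
    rewrite scalerDl -addrA; congr (_ + _).
    by rewrite scalerDr scalerBr scalerA opprD addrACA subrr add0r.
  have : 1 <= \det (K *m H).
    rewrite KH; apply: det_ge1.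
      by rewrite linearD linearZ linearB/= trmx1 trmx_mul Ps.
    move=> u; rewrite mulmxDl mul1mx dotDr lerDl -scalemxAl dotZr mulr_ge0//.
      by rewrite mulr_ge0 ?ltW.
    rewrite mulmxBl dotBr subr_ge0 -mulmxA dot_mulmx Ps PE.
    by apply: inv_norm; exact: refG_psd.
  rewrite det_mulmx => /le_trans; apply; rewrite ler_wpM2l//.
  have [C [_ h _]] := pd_chol t1' Ks K0.
  by apply: le_trans h; rewrite exprn_ge0 ?ltW.
pose A := v2^-1 *: Sg.
have AE u : dot u (A *m u) = dot u u + s2 / v2 * dot u (corr n rho *m u).
  by rewrite -scalemxAl dotZr sig_form; field; rewrite gt_eqF.
pose B := K *m A *m K.
have Bform u : dot u (B *m u) = dot (K *m u) (A *m (K *m u)).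
  by rewrite /B -!mulmxA dot_mulmx Ks.
have As : A^T = A by rewrite linearZ/= sig_sym.
have Bs : B^T = B by rewrite !trmx_mul As Ks mulmxA.
have sv0 : 0 < s2 / v2 by rewrite divr_gt0.
have pR : psd (corr n rho) by exact: corr_psd.
have Bpd u : (1 - t) ^+ 2 * dot u u <= dot u (B *m u).
  rewrite Bform AE; apply: (le_trans (Kn0 u)); rewrite lerDl.
  by apply: mulr_ge0; [exact: ltW|exact: pR.2].
have detB := det_le_exp (exprn_gt0 2 t1') Bs Bpd.
(* The filter splits a basis vector [e] into [(1 - t) e], which meets the unit diagonal of the
   correlation matrix, and [t S e], which is controlled by [refsm_corr]. *)
have trB : \tr B - N <= N * (s2 / v2 * (2 * (1 - t) ^+ 2 + 2 * (m%:R ^+ 2 / cb rho))).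
  rewrite lerBlDr trace_form.
  apply: (@le_trans _ _ (\sum_(i < n.+1)
     (s2 / v2 * (2 * (1 - t) ^+ 2 + 2 * (m%:R ^+ 2 / cb rho)) + 1))); last first.
    by rewrite sumr_const card_ord -mulr_natl; lra.
  apply: ler_sum => i _; rewrite Bform AE addrC.
  set e := delta_mx i ord0.
  have e1 : dot e e = 1 by rewrite dot_delta mxE !eqxx.
  rewrite lerD//; last by rewrite -e1.
  rewrite ler_pM2l// KE mulmxDl mul_scalar_mx -scalemxAl.
  apply: le_trans (psd_parallelogram _ _ pR) _.
  rewrite -!scalemxAr !(dotZl, dotZr) form_delta mxE /ndist subnn expr0 mulr1.
  rewrite -expr2 lerD2l ler_pM2l// mulrA -expr2.
  have h := refsm_corr rho01 e m0.
  have h0 : 0 <= dot (S *m e) (corr n rho *m (S *m e)) := pR.2 _.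
  rewrite e1 mulr1 in h; apply: le_trans h.
  by rewrite ler_piMl// expr_le1// ltW.
have detA : \det A <= expR (\tr B - N) * expR (2 * g * N / m%:R) ^+ 2.
  have dK0 : 0 < \det K.
    have := lt_le_trans ltr01 detK; rewrite pmulr_lgt0// expR_gt0//.
  have dB : \det B = \det K ^+ 2 * \det A by rewrite /B !det_mulmx; ring.
  have dA : 0 <= \det A.
    rewrite detZ; apply: mulr_ge0; first by rewrite exprn_ge0// invr_ge0 ltW.
    by apply: le_trans sig_det_ge; rewrite exprn_ge0 ?ltW.
  set E := expR _ in detK *; set F := expR _ in detB *.
  apply: (@le_trans _ _ (\det B * E ^+ 2)); last first.
    by rewrite ler_wpM2r// exprn_ge0// expR_ge0.
  rewrite dB; have -> : \det K ^+ 2 * \det A * E ^+ 2 = (\det K * E) ^+ 2 * \det A by ring.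
  by rewrite ler_peMl// exprn_ege1.
have -> : \det Sg = v2 ^+ n.+1 * \det A.
  by rewrite /A detZ mulrA -exprMn divff ?gt_eqF// expr1n mul1r.
rewrite ler_pM2l ?exprn_gt0//; apply: (le_trans detA).
rewrite -expRM_natl -expRD ler_expR; move: trB; rewrite /g; lra.
Qed.

End determinants.

(** * Orders of the coefficients, and a grid with small relative error *)

Section ar_coefficients.
Context (R : realType).

Lemma coef_bounds (lo hi : R) : 0 < lo -> lo <= hi -> exists2 K : R, 1 <= K &
  forall k D, lo <= k <= hi -> 0 < D <= 1 ->
  let rho := expR (- k * D) in
  [/\ 0 < rho < 1,
      D / K <= ca rho /\ ca rho <= K * D,
      D^-1 / K <= cb rho /\ cb rho <= K * D^-1 &
      K^-1 <= cc rho /\ cc rho <= K].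
Proof.
move=> lo0 lohi.
set E0 := expR (- hi).
have E0_gt0 : 0 < E0 by exact: expR_gt0.
have hi0 : 0 < hi by exact: lt_le_trans lohi.
(* Each summand settles one of the inequalities below; [E0] bounds [rho] from below because
   [D <= 1]. *)
pose K := 1 + hi + lo^-1 / E0 ^+ 2 + 2 * hi / E0 + 2 / E0 + 2 / (lo * E0).
have i0 : 0 < lo^-1 / E0 ^+ 2 by rewrite divr_gt0 ?invr_gt0 ?exprn_gt0.
have i1 : 0 < 2 * hi / E0 by rewrite divr_gt0 ?mulr_gt0.
have i2 : 0 < 2 / E0 by rewrite divr_gt0.
have i3 : 0 < 2 / (lo * E0) by rewrite divr_gt0 ?mulr_gt0.
have K1 : 1 <= K by rewrite /K; lra.
have K0 : 0 < K by lra.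
exists K => // k D /andP[k1 k2] /andP[D0 D1] rho.
have k0 : 0 < k by exact: lt_le_trans k1.
pose t := k * D; have t0 : 0 < t by rewrite mulr_gt0.
have rE : rho = expR (- t) by rewrite /rho mulNr.
have thi : t <= hi by rewrite /t (le_trans (ler_piMr (ltW k0) D1)).
have r0 : 0 < rho by exact: expR_gt0.
have r1 : rho < 1 by rewrite rE expR_lt1 oppr_lt0.
have rE0 : E0 <= rho by rewrite rE ler_expR lerN2.
have h1 : 1 - rho <= t by have := expR_ge1Dx (- t); rewrite -rE; lra.
have h2 : t * E0 <= 1 - rho.
  have : rho * expR t = 1 by rewrite rE -expRD addNr expR0.
  have := expR_ge1Dx t => h3 h4.
  have : rho * (1 + t) <= 1 by rewrite -[leRHS]h4 ler_pM2l.
  have : t * E0 <= t * rho by rewrite ler_pM2l.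
  lra.
have tlo : lo * D <= t by rewrite /t ler_pM2r.
have tlE : lo * D * E0 <= t * E0 by rewrite ler_pM2r.
have thD : t <= hi * D by rewrite /t ler_pM2r.
have e1 : E0 < 1 by exact: le_lt_trans r1.
have r2 : 0 < 1 - rho ^+ 2 by rewrite subr_gt0 expr_lt1// ltW.
have r2E : 1 - rho ^+ 2 = (1 - rho) * (1 + rho) by ring.
split; first by rewrite r0.
- split; rewrite /ca.
    rewrite ler_pdivlMr; last lra.
    rewrite mulrAC ler_pdivrMr//.
    have hK : 2 / (lo * E0) <= K by rewrite /K; lra.
    rewrite ler_pdivrMr ?mulr_gt0// in hK.
    have h3 : D * 2 <= D * (K * (lo * E0)) by rewrite ler_pM2l.
    have h4 : K * (lo * D * E0) <= K * (1 - rho) by rewrite ler_pM2l//; lra.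
    have h5 : D * (1 + rho) <= D * 2 by rewrite ler_pM2l//; lra.
    lra.
  rewrite ler_pdivrMr; last lra.
  have hK : hi * D <= K * D by rewrite ler_pM2r// /K; lra.
  have h3 : K * D <= K * D * (1 + rho) by rewrite ler_peMr ?mulr_ge0//; lra.
  lra.
- split; rewrite /cb.
    rewrite ler_pdivlMr// -invfM -ler_pdivlMl ?invr_gt0 ?mulr_gt0// invrK.
    rewrite r2E.
    have hK : 2 * hi / E0 <= K by rewrite /K; lra.
    rewrite ler_pdivrMr// in hK.
    have h3 : D * (2 * hi) <= D * (K * E0) by rewrite ler_pM2l.
    have h4 : D * K * E0 <= D * K * rho by rewrite ler_pM2l ?mulr_gt0.
    have h5 : (1 - rho) * (1 + rho) <= (hi * D) * 2.
      by apply: ler_pM; lra.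
    lra.
  rewrite ler_pdivrMr// mulrAC ler_pdivlMr// r2E.
  have hK : lo^-1 / E0 ^+ 2 <= K by rewrite /K; lra.
  rewrite -invfM -div1r ler_pdivrMr ?mulr_gt0 ?exprn_gt0// in hK.
  have hK' : 1 <= K * (lo * E0).
    apply: (le_trans hK); rewrite ler_pM2l// ler_pM2l// expr2 ler_piMl// ltW//.
  have h3 : K * (lo * D * E0) <= K * (1 - rho) by rewrite ler_pM2l//; lra.
  have h4 : K * (1 - rho) <= K * (1 - rho) * (1 + rho).
    by rewrite ler_peMr ?mulr_ge0//; lra.
  have h5 : D <= D * (K * (lo * E0)) by rewrite ler_peMr// ltW.
  have h6 : rho * D <= D by rewrite ler_piMl// ltW.
  lra.
- split; rewrite /cc.
    rewrite ler_pdivlMr; last lra.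
    rewrite -ler_pdivlMl ?invr_gt0// invrK.
    have hK : 2 / E0 <= K by rewrite /K; lra.
    rewrite ler_pdivrMr// in hK.
    have h3 : K * E0 <= K * rho by rewrite ler_pM2l.
    lra.
  by rewrite ler_pdivrMr; [have : K * 1 <= K * (1 + rho) by rewrite ler_pM2l//; lra|]; lra.
Qed.

(** The grid consists of multiples of [h = (7 K)^-1]. Then [u >= 7 h], and rounding [u] down changes
    it by a factor of at most [7/6]; this is the tolerance allowed in the resolvent expansion. *)
Lemma grid (K : R) : 1 <= K -> exists (h : R) (M : nat), 0 < h /\
  forall u, K^-1 <= u <= K -> exists (k : 'I_M) (c : R),
    `|c| <= 6^-1 /\ u = (1 + c) * (h * k%:R).
Proof.
move=> K1; have K0 : 0 < K by lra.
pose h : R := (7 * K)^-1.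
have h0 : 0 < h by rewrite invr_gt0 mulr_gt0.
exists h, (Num.truncn (K / h)).+2; split=> // u /andP[u1 u2].
have u0 : 0 < u by apply: lt_le_trans u1; rewrite invr_gt0.
pose k := Num.truncn (u / h).
have uh0 : 0 <= u / h by rewrite divr_ge0// ltW.
have /andP[k1 k2] := truncn_itv uh0; rewrite -/k in k1 k2.
have kM : (k < (Num.truncn (K / h)).+2)%N.
  by rewrite ltnS leqW// le_truncn// ler_pM2r// invr_gt0.
have u7 : 7 <= u / h.
  rewrite /h invrK; have : K^-1 * (7 * K) <= u * (7 * K) by rewrite ler_pM2r// mulr_gt0.
  by rewrite mulrCA mulVf ?mulr1// gt_eqF.
rewrite -natr1 in k2.
have k6 : 6 <= k%:R :> R by lra.
have kR : 0 < k%:R :> R by lra.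
exists (Ordinal kM), (u / h / k%:R - 1); split=> /=; last first.
  by field; rewrite !gt_eqF.
have h1 : u / h / k%:R <= 7 / 6 by rewrite ler_pdivrMr//; lra.
have h2 : 1 <= u / h / k%:R by rewrite ler_pdivlMr//; lra.
by rewrite ler_norml; lra.
Qed.

End ar_coefficients.

(** * Moments *)

Section expected_value.
Context (R : realType) (d : measure_display) (T : measurableType d)
  (P : probability T R).

(** Integrability is bundled with the value, so that one derivation computes a moment and proves
    that it exists. *)
Definition hasE (f : T -> R) (c : R) : Prop :=
  P.-integrable [set: T] (EFin \o f) /\ (\int[P]_w (f w)%:E = c%:E)%E.

Lemma hasE_ext f g c : f =1 g -> hasE f c -> hasE g c.
Proof. by move=> /funext ->. Qed.

Lemma hasE_eq f c c' : c = c' -> hasE f c -> hasE f c'.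
Proof. by move=> ->. Qed.

Lemma hasE_meas f c : hasE f c -> measurable_fun [set: T] f.
Proof. by move=> [/integrableP[/measurable_EFinP]]. Qed.

Lemma hasE_cst c : hasE (fun=> c) c.
Proof.
split; last first.
  rewrite -[LHS]/(\int[P]_w (cst c%:E w))%E integral_cst//. by rewrite -[RHS]mule1; congr (_ * _)%E; exact: probability_setT.
exact: finite_measure_integrable_cst.
Qed.

Lemma hasED f g a b : hasE f a -> hasE g b -> hasE (fun w => f w + g w) (a + b).
Proof.
move=> [f1 f2] [g1 g2]; split.
  rewrite [X in _.-integrable _ X](_ : _ = (EFin \o f) \+ (EFin \o g))%E//.
  exact: integrableD.
under eq_integral do rewrite EFinD.
by rewrite integralD// f2 g2.
Qed.

Lemma hasEZ k f a : hasE f a -> hasE (fun w => k * f w) (k * a).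
Proof.
move=> [f1 f2]; split.
  rewrite [X in _.-integrable _ X](_ : _ = (fun w => k%:E * (EFin \o f) w))%E//.
  exact: integrableZl.
under eq_integral do rewrite EFinM.
by rewrite integralZl// f2.
Qed.

Lemma hasEN f a : hasE f a -> hasE (fun w => - f w) (- a).
Proof.
move=> fa; have := hasEZ (-1) fa; rewrite mulN1r; apply: hasE_ext => w.
by rewrite mulN1r.
Qed.

Lemma hasEB f g a b : hasE f a -> hasE g b -> hasE (fun w => f w - g w) (a - b).
Proof. by move=> fa gb; apply: hasED => //; exact: hasEN. Qed.

Lemma hasE_sum (I : Type) (s : seq I) (Q : pred I) (f : I -> T -> R) (c : I -> R) :
  (forall i, hasE (f i) (c i)) ->
  hasE (fun w => \sum_(i <- s | Q i) f i w) (\sum_(i <- s | Q i) c i).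
Proof.
move=> H; elim: s => [|i s IHs].
  by rewrite big_nil; apply: hasE_ext (hasE_cst 0) => w; rewrite big_nil.
rewrite big_cons; case: ifPn => Qi.
  by apply: hasE_ext (hasED (H i) IHs) => w; rewrite big_cons Qi.
by apply: hasE_ext IHs => w; rewrite big_cons (negbTE Qi).
Qed.

Lemma hasE_le f g a b : hasE f a -> hasE g b -> (forall w, f w <= g w) -> a <= b.
Proof.
move=> [f1 f2] [g1 g2] fg; rewrite -lee_fin -f2 -g2; apply: le_integral => //.
by move=> w _; rewrite lee_fin fg.
Qed.

Lemma hasE_nneg (f : T -> R) c : measurable_fun [set: T] f -> (forall w, 0 <= f w) ->
  (\int[P]_w (f w)%:E = c%:E)%E -> hasE f c.
Proof.
move=> mf f0 fc; split=> //; apply/integrableP; split; first exact/measurable_EFinP.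
under eq_integral do rewrite /= ger0_norm//.
by rewrite fc ltry.
Qed.

Lemma hasE_dom (f g : T -> R) c : measurable_fun [set: T] f -> hasE g c ->
  (forall w, `|f w| <= g w) -> exists b, hasE f b.
Proof.
move=> mf [g1 g2] fg.
have If : P.-integrable [set: T] (EFin \o f).
  apply: (le_integrable _ _ _ g1) => //; first exact/measurable_EFinP.
  by move=> w _; rewrite /= lee_fin (le_trans (fg w))// ler_norm.
exists (fine (\int[P]_w (f w)%:E)); split=> //.
by rewrite fineK//; exact: integrable_fin_num.
Qed.

Lemma hasE_markov (f : T -> R) (c t : R) : hasE f c -> (forall w, 0 <= f w) -> 0 < t ->
  (P [set w | (t <= f w)%R] <= (c / t)%:E)%E.
Proof.
move=> [f1 f2] f0 t0.
have mf := hasE_meas (conj f1 f2).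
have := le_integral_abse P measurableT ((measurable_EFinP _ _).2 mf) t0.
have -> : [set: T] `&` [set w | (t%:E <= `|(f w)%:E|)%E] = [set w | t <= f w].
  by apply/seteqP; split=> w /=; rewrite lee_fin ger0_norm// => -[].
have -> : (\int[P]_w `|(f w)%:E| = \int[P]_w (f w)%:E)%E.
  by apply: eq_integral => w _; rewrite /= ger0_norm.
by rewrite f2 mulrC EFinM lee_pdivlMl.
Qed.

(** Differentiation of a Laplace transform at [0]. The difference quotients stay below [p y] and
    converge to it: Fatou's lemma gives at most [L], and comparison with the quotients, whose means
    are at least [L - C u], gives at least [L]. *)
Lemma hasE_conv (L : R) (p y : T -> R) (v : R -> R) (C : R) :
  measurable_fun [set: T] y -> measurable_fun [set: T] p ->
  (forall w, 0 <= p w) -> (forall w, 0 <= y w) ->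
  (forall u, 0 < u <= 1 ->
     hasE (fun w => p w * ((1 - expR (- u * y w)) / u)) (v u)) ->
  (forall u, 0 < u <= 1 -> v u <= L) ->
  (forall u, 0 < u <= 1 -> L - C * u <= v u) ->
  hasE (fun w => p w * y w) L.
Proof.
move=> my mp p0 y0 H vL vL'.
have g_le u w : 0 < u -> p w * ((1 - expR (- u * y w)) / u) <= p w * y w.
  move=> u0; rewrite ler_wpM2l// ler_pdivrMr//.
  by have := expR_ge1Dx (- u * y w); lra.
have g_ge0 u w : 0 < u -> 0 <= p w * ((1 - expR (- u * y w)) / u).
  move=> u0; rewrite mulr_ge0// divr_ge0 ?(ltW u0)// subr_ge0 -expR0 ler_expR.
  by rewrite mulNr oppr_le0 mulr_ge0// ltW.
have g_ge u w : 0 < u -> p w * (y w - u * y w ^+ 2) <=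
    p w * ((1 - expR (- u * y w)) / u).
  move=> u0; rewrite ler_wpM2l// ler_pdivlMr//.
  have e0 : 0 < expR (- u * y w) by exact: expR_gt0.
  have : expR (- u * y w) * expR (u * y w) = 1 by rewrite -expRD mulNr addNr expR0.
  have := expR_ge1Dx (u * y w); set e := expR _ in e0 *; set f := expR _ => h1 h2.
  have z0 : 0 <= u * y w by rewrite mulr_ge0// ltW.
  have h3 : e * (1 + u * y w) <= 1 by rewrite -[leRHS]h2 ler_pM2l.
  have h4 : 0 <= (u * y w) * (u * y w) by rewrite mulr_ge0.
  nra.
have mpy : measurable_fun [set: T] (fun w => p w * y w) by exact: measurable_funM.
pose u_ (n : nat) : R := n.+1%:R^-1.
have u0 n : 0 < u_ n <= 1.
  by rewrite invr_gt0 ltr0n/= invf_le1 ?ltr0n// ler1n.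
have u0' n : 0 < u_ n by case/andP: (u0 n).
have ucvg : u_ @ \oo --> (0 : R).
  by have := @cvg_harmonic R.
suff intL : (\int[P]_w (p w * y w)%:E <= L%:E)%E.
  have h0 : (0 <= \int[P]_w (p w * y w)%:E)%E.
    by apply: integral_ge0 => w _; rewrite lee_fin mulr_ge0.
  have [I IE] : exists I, (\int[P]_w (p w * y w)%:E = I%:E)%E.
    move: h0 intL; case: integral => [r _ _|//|//]; by exists r.
  have HI : hasE (fun w => p w * y w) I.
    by apply: hasE_nneg => // w; rewrite mulr_ge0.
  rewrite IE lee_fin in intL.
  suff -> : L = I by [].
  apply/eqP; rewrite eq_le intL andbT.
  apply/ler_addgt0Pl => e e0.
  have D0 : 0 < e + `|C| by rewrite ltr_pwDl.
  have u1 : 0 < e / (e + `|C|) <= 1.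
    by rewrite divr_gt0//= ler_pdivrMr// mul1r lerDl.
  have hv := vL' _ u1.
  have hI : v (e / (e + `|C|)) <= I.
    by apply: hasE_le (H _ u1) HI _ => w; apply: g_le; case/andP: u1.
  have hC : C * (e / (e + `|C|)) <= e.
    rewrite mulrA ler_pdivrMr// mulrC ler_pM2l//.
    by apply: le_trans (ler_norm C) _; rewrite lerDr ltW.
  by rewrite addrC; lra.
pose f n w := ((p w * ((1 - expR (- u_ n * y w)) / u_ n))%:E : \bar R).
have fc w : f ^~ w @ \oo --> (p w * y w)%:E.
  apply: cvg_EFin; first exact: nearW.
  apply: (@squeeze_cvgr _ _ _ _ (fun n => p w * (y w - u_ n * y w ^+ 2))
    (fun=> p w * y w)).
  - by apply: nearW => n /=; rewrite g_ge// g_le.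
  - rewrite -[X in _ --> X](_ : p w * (y w - 0 * y w ^+ 2) = _); last first.
      by rewrite mul0r subr0.
    by apply: cvgMl_tmp; apply: cvgB; [exact: cvg_cst|exact: cvgMr_tmp].
  - exact: cvg_cst.
rewrite (eq_integral (fun w => limn_einf (f ^~ w))); last first.
  by move=> w _; rewrite (cvg_limn_einf_sup (fc w)).1.
apply: le_trans (fatou P measurableT _ _) _.
- by move=> n; apply/measurable_EFinP; exact: (hasE_meas (H _ (u0 n))).
- by move=> n w _; rewrite lee_fin g_ge0.
under [X in limn_einf X]eq_fun do rewrite (H _ (u0 _)).2.
rewrite limn_einf_lim; apply: lime_le.
  exact: is_cvg_einfs.
apply: nearW => n; rewrite /einfs /=.
apply: le_trans (ereal_inf_lbound _) (_ : (v (u_ n))%:E <= _)%E.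
  by exists n => /=.
by rewrite lee_fin vL.
Qed.

End expected_value.

(** * Moments of the normal law *)

Section normal_moments.
Context (R : realType).
Local Notation mu := (@lebesgue_measure R).

(** The Radon-Nikodym derivative of [normal_prob] is identified almost everywhere with the
    density. *)
Lemma integral_normal (m s : R) (f : R -> R) : measurable_fun [set: R] f ->
  (forall x, 0 <= f x) ->
  (\int[normal_prob m s]_x (f x)%:E =
   \int[mu]_x (f x * normal_pdf m s x)%:E)%E.
Proof.
move=> mf f0; have dom := normal_prob_dominates m s.
have f0' x : (0 <= (f x)%:E)%E by rewrite lee_fin.
have mf' : measurable_fun [set: R] (fun x => (f x)%:E) by exact/measurable_EFinP.
rewrite -(Radon_Nikodym_SigmaFinite.change_of_variables dom f0' measurableT mf').
have mpdf : measurable_fun [set: R] (fun x => (normal_pdf m s x)%:E).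
  by apply/measurable_EFinP; exact: measurable_normal_pdf.
have IRN := Radon_Nikodym_SigmaFinite.f_integrable dom.
apply: ae_eq_integral => //.
- apply: emeasurable_funM; first exact/measurable_EFinP.
  exact: (measurable_int _ IRN).
- by under eq_fun do rewrite EFinM; apply: emeasurable_funM => //; exact/measurable_EFinP.
- under [X in ae_eq _ _ _ X]eq_fun do rewrite EFinM.
  apply: ae_eqe_mul2l => /=.
  apply: integral_ae_eq => //=.
  move=> E _ mE; rewrite -(Radon_Nikodym_SigmaFinite.f_integral dom)//.
Qed.

(** Weighting a centred normal density by [exp (- l x^2 / (2 s^2))] gives a multiple of another one.
    Writing [l = (1 + u)^2 - 1] keeps the Laplace transforms below rational in [u]. *)
Lemma normal_pdf_tilt (s u x : R) : 0 < s -> 0 < u ->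
  normal_pdf 0 (s / (1 + u)) x =
  (1 + u) * expR (- (u ^+ 2 + 2 * u) * (x ^+ 2 / (2 * s ^+ 2))) * normal_pdf 0 s x.
Proof.
move=> s0 u0; have u1 : 0 < 1 + u by lra.
have su : 0 < s / (1 + u) by rewrite divr_gt0.
rewrite !normal_pdfE ?gt_eqF// /normal_peak /normal_fun.
have -> : Num.sqrt ((s / (1 + u)) ^+ 2 * pi *+ 2) =
   Num.sqrt (s ^+ 2 * pi *+ 2) / (1 + u).
  have -> : (s / (1 + u)) ^+ 2 * pi *+ 2 = (s ^+ 2 * pi *+ 2) * (1 + u)^-1 ^+ 2.
    by rewrite -[LHS]mulr_natl -[in RHS]mulr_natl; ring.
  rewrite sqrtrM; last by rewrite mulrn_wge0// mulr_ge0 ?sqr_ge0// pi_ge0.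
  by rewrite sqrtr_sqr ger0_norm// invr_ge0 ltW.
have -> : - (x - 0) ^+ 2 / ((s / (1 + u)) ^+ 2 *+ 2) =
    - (u ^+ 2 + 2 * u) * (x ^+ 2 / (2 * s ^+ 2)) + - (x - 0) ^+ 2 / (s ^+ 2 *+ 2).
  rewrite -!(mulr_natl (_ ^+ 2) 2) subr0; field; rewrite !gt_eqF//.
rewrite expRD invfM invrK; ring.
Qed.


Local Notation N s := (normal_prob 0 s).

Lemma normal_tilt (s u c : R) (f : R -> R) : 0 < s -> 0 < u ->
  measurable_fun [set: R] f -> (forall x, 0 <= f x) ->
  hasE (N (s / (1 + u))) f c ->
  hasE (N s) (fun x => f x * expR (- (u ^+ 2 + 2 * u) * (x ^+ 2 / (2 * s ^+ 2))))
    (c / (1 + u)).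
Proof.
move=> s0 u0 mf f0 [_ fc].
have u1 : 0 < 1 + u by lra.
have me : measurable_fun [set: R]
    (fun x : R => expR (- (u ^+ 2 + 2 * u) * (x ^+ 2 / (2 * s ^+ 2)))).
  apply: measurableT_comp => //; apply: measurable_funM => //.
  by apply: measurable_funM => //; exact: measurable_funX.
apply: hasE_nneg.
- exact: measurable_funM.
- by move=> x; rewrite mulr_ge0// expR_ge0.
rewrite integral_normal//; last 2 first.
- exact: measurable_funM.
- by move=> x; rewrite mulr_ge0// expR_ge0.
rewrite integral_normal// in fc.
have fE x : (f x * expR (- (u ^+ 2 + 2 * u) * (x ^+ 2 / (2 * s ^+ 2))) *
      normal_pdf 0 s x)%:E =
   ((1 + u)^-1%:E * (f x * normal_pdf 0 (s / (1 + u)) x)%:E)%E.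
  rewrite normal_pdf_tilt// -EFinM; congr EFin; field; rewrite gt_eqF//.
under eq_integral do rewrite fE.
rewrite ge0_integralZl//.
- by rewrite fc -EFinM mulrC.
- apply/measurable_EFinP; apply: measurable_funM => //; exact: measurable_normal_pdf.
- by move=> x _; rewrite lee_fin mulr_ge0// normal_pdf_ge0.
- by rewrite lee_fin invr_ge0 ltW.
Qed.

Let y (s x : R) := x ^+ 2 / (2 * s ^+ 2).

Let my s : measurable_fun [set: R] (y s).
Proof. by apply: measurable_funM => //; exact: measurable_funX. Qed.

Let y0 s x : 0 <= y s x.
Proof. exact: divr_ge0 (sqr_ge0 _) (mulr_ge0 (ler0n _ 2) (sqr_ge0 _)). Qed.

Let reparam (l : R) : 0 < l <= 1 ->
  exists2 u, 0 < u <= l & l = u ^+ 2 + 2 * u.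
Proof.
move=> /andP[l0 l1]; exists (Num.sqrt (1 + l) - 1); last first.
  have : Num.sqrt (1 + l) ^+ 2 = 1 + l by rewrite sqr_sqrtr//; lra.
  by rewrite !expr2; lra.
have h : Num.sqrt (1 + l) ^+ 2 = 1 + l by rewrite sqr_sqrtr//; lra.
have h1 : 1 < Num.sqrt (1 + l).
  by rewrite -[ltLHS]sqrtr1 ltr_sqrt; lra.
move: h; rewrite expr2; set z := Num.sqrt _ in h1 * => h.
by apply/andP; split; nra.
Qed.

Let moment1 s : 0 < s -> hasE (N s) (y s) 2^-1.
Proof.
move=> s0; suff : hasE (N s) (fun x => 1 * y s x) 2^-1.
  by apply: hasE_ext => x; rewrite mul1r.
have H l : 0 < l <= 1 -> exists u, [/\ 0 < u <= l, l = u ^+ 2 + 2 * u &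
   hasE (N s) (fun x => 1 * ((1 - expR (- l * y s x)) / l)) ((1 - (1 + u)^-1) / l)].
  move=> l01; have [u u0 lE] := reparam l01; exists u; split=> //.
  have /andP[u0' _] := u0.
  have m1 : measurable_fun [set: R] (fun=> 1 : R) by exact: measurable_cst.
  have := normal_tilt s0 u0' m1 (fun=> ler01) (hasE_cst _ 1).
  move=> /(hasEB (hasE_cst _ 1))/(hasEZ l^-1) h.
  apply: hasE_eq (hasE_ext _ h); first by rewrite div1r mulrC.
  by move=> x; rewrite !mul1r mulrC -lE.
(* [hasE_conv] takes the transform as a function of [l], whereas the formula is in terms of [u];
   choice provides the function. *)
have [vf vfP] : exists vf : R -> R, forall l, 0 < l <= 1 -> exists u,
   [/\ 0 < u <= l, l = u ^+ 2 + 2 * u, vf l = (1 - (1 + u)^-1) / l &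
   hasE (N s) (fun x => 1 * ((1 - expR (- l * y s x)) / l)) (vf l)].
  have K l : exists c, 0 < l <= 1 -> exists u, [/\ 0 < u <= l, l = u ^+ 2 + 2 * u,
     c = (1 - (1 + u)^-1) / l &
     hasE (N s) (fun x => 1 * ((1 - expR (- l * y s x)) / l)) c].
    have [/H[u [h1 h2 h3]]|_] := boolP (0 < l <= 1); last by exists 0.
    by exists ((1 - (1 + u)^-1) / l) => _; exists u.
  by exists (fun l => projT1 (cid (K l))) => l; exact: (projT2 (cid (K l))).
have m1 : measurable_fun [set: R] (fun=> 1 : R) by exact: measurable_cst.
apply: (@hasE_conv R _ _ (N s) 2^-1 (fun=> 1) (y s) vf 1 (my s) m1 (fun=> ler01) (y0 s)).
- by move=> l /vfP[u []].
- move=> l /vfP[u [/andP[u0 ul] lE -> _]].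
  have -> : (1 - (1 + u)^-1) / l = ((1 + u) * (2 + u))^-1.
    by rewrite lE; field; rewrite !gt_eqF//; nra.
  by rewrite lef_pV2 ?posrE//; nra.
- move=> l /vfP[u [/andP[u0 ul] lE -> _]].
  have -> : (1 - (1 + u)^-1) / l = ((1 + u) * (2 + u))^-1.
    by rewrite lE; field; rewrite !gt_eqF//; nra.
  have h : 2^-1 - u <= ((1 + u) * (2 + u))^-1.
    rewrite -[leRHS]div1r ler_pdivlMr; last by nra.
    have := mulr_ge0 (ltW u0) (ltW u0); have := mulr_ge0 (mulr_ge0 (ltW u0) (ltW u0)) (ltW u0).
    nra.
  lra.
Qed.

(** Tilting turns the mean of [y exp (- l y)] into a first moment under a smaller standard
    deviation. The cube has one factor from the density and two from rescaling [y]. *)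
Let moment2 s : 0 < s -> hasE (N s) (fun x => y s x * y s x) (3 / 4).
Proof.
move=> s0.
have H l : 0 < l <= 1 -> exists u, [/\ 0 < u <= l, l = u ^+ 2 + 2 * u &
   hasE (N s) (fun x => y s x * ((1 - expR (- l * y s x)) / l))
     ((1 - (1 + u)^-1 ^+ 3) / (2 * l))].
  move=> l01; have [u u0 lE] := reparam l01; exists u; split=> //.
  have /andP[u0' _] := u0.
  have u1 : 0 < 1 + u by lra.
  have /(moment1)/(hasEZ ((1 + u)^-1 ^+ 2)) : 0 < s / (1 + u) by rewrite divr_gt0.
  have -> : (fun w => (1 + u)^-1 ^+ 2 * y (s / (1 + u)) w) = y s.
    by apply/funext => x; rewrite /y; field; rewrite !gt_eqF.
  move=> /(normal_tilt s0 u0' (my s) (y0 s))/(hasEB (moment1 s0))/(hasEZ l^-1).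
  have l0 : 0 < l by case/andP: l01.
  move=> h; apply: hasE_eq (hasE_ext _ h); first by field; rewrite !gt_eqF.
  by move=> x /=; rewrite -lE -/(y s x); field; rewrite gt_eqF.
have [vf vfP] : exists vf : R -> R, forall l, 0 < l <= 1 -> exists u,
   [/\ 0 < u <= l, l = u ^+ 2 + 2 * u, vf l = (1 - (1 + u)^-1 ^+ 3) / (2 * l) &
   hasE (N s) (fun x => y s x * ((1 - expR (- l * y s x)) / l)) (vf l)].
  have K l : exists c, 0 < l <= 1 -> exists u, [/\ 0 < u <= l, l = u ^+ 2 + 2 * u,
     c = (1 - (1 + u)^-1 ^+ 3) / (2 * l) &
     hasE (N s) (fun x => y s x * ((1 - expR (- l * y s x)) / l)) c].
    have [/H[u [h1 h2 h3]]|_] := boolP (0 < l <= 1); last by exists 0.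
    by exists ((1 - (1 + u)^-1 ^+ 3) / (2 * l)) => _; exists u.
  by exists (fun l => projT1 (cid (K l))) => l; exact: (projT2 (cid (K l))).
have vE (u l : R) : 0 < u -> l = u ^+ 2 + 2 * u -> (1 - (1 + u)^-1 ^+ 3) / (2 * l) =
    (u * (u * 1) + 3 * u + 3) / (2 * (2 + 7 * u + 9 * (u * u) + 5 * (u * (u * u)) + u * (u * (u * u)))).
  move=> u0 ->; have u2 := mulr_gt0 u0 u0; have u3 := mulr_gt0 u0 u2.
  have u4 := mulr_gt0 u0 u3.
  by field; rewrite !gt_eqF//; rewrite ?expr2; lra.
apply: (@hasE_conv R _ _ (N s) (3 / 4) (y s) (y s) vf 15 (my s) (my s) (y0 s) (y0 s)).
- by move=> l /vfP[u []].
- move=> l /vfP[u [/andP[u0 ul] lE -> _]]; rewrite (vE u)//.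
  have := mulr_gt0 u0 u0 => u2; have := mulr_gt0 u0 u2 => u3.
  have := mulr_gt0 u0 u3 => u4.
  by rewrite ler_pdivrMr; lra.
- move=> l /vfP[u [/andP[u0 ul] lE -> _]]; rewrite (vE u)//.
  have := mulr_gt0 u0 u0 => u2; have := mulr_gt0 u0 u2 => u3.
  have := mulr_gt0 u0 u3 => u4; have := mulr_gt0 u0 u4 => u5.
  have : 3 / 4 - 15 * l <= 3 / 4 - 15 * u by lra.
  by move=> /le_trans; apply; rewrite ler_pdivlMr; lra.
Qed.

Lemma normal_moment2 (s : R) : 0 < s -> hasE (N s) (fun x => x ^+ 2) (s ^+ 2).
Proof.
move=> s0; have := hasEZ (2 * s ^+ 2) (moment1 s0).
rewrite (_ : 2 * s ^+ 2 * 2^-1 = s ^+ 2); last by field.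
by apply: hasE_ext => x; rewrite /y; field; rewrite gt_eqF.
Qed.

Lemma normal_moment4 (s : R) : 0 < s -> hasE (N s) (fun x => x ^+ 4) (3 * s ^+ 4).
Proof.
move=> s0; have := hasEZ (4 * s ^+ 4) (moment2 s0).
rewrite (_ : 4 * s ^+ 4 * (3 / 4) = 3 * s ^+ 4); last by field.
by apply: hasE_ext => x; rewrite /y; field; rewrite gt_eqF.
Qed.

Lemma normal_mgf (s t : R) : 0 < s ->
  hasE (N s) (fun x => expR (t * x)) (expR (t ^+ 2 * s ^+ 2 / 2)).
Proof.
move=> s0; have me : measurable_fun [set: R] (fun x : R => expR (t * x)).
  by apply: measurableT_comp => //; exact: measurable_funM.
apply: hasE_nneg => //.
have e0 x : 0 <= expR (t * x) by exact: expR_ge0.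
rewrite (integral_normal _ _ me e0).
have fE x : (expR (t * x) * normal_pdf 0 s x)%:E =
   ((expR (t ^+ 2 * s ^+ 2 / 2))%:E * (normal_pdf (t * s ^+ 2) s x)%:E)%E.
  rewrite -EFinM; congr EFin; rewrite !normal_pdfE ?gt_eqF//.
  rewrite mulrCA [RHS]mulrCA; congr (_ * _); rewrite /normal_fun -!expRD; congr expR.
  rewrite -!(mulr_natl (_ ^+ 2) 2); field; rewrite gt_eqF//.
under eq_integral do rewrite fE.
rewrite ge0_integralZl//.
- by rewrite integral_normal_pdf mule1.
- by apply/measurable_EFinP; exact: measurable_normal_pdf.
- by move=> x _; rewrite lee_fin normal_pdf_ge0.
Qed.

(* [1 + t x <= exp (t x)] for small [t] of both signs. *)
Lemma normal_mean (s : R) : 0 < s -> hasE (N s) (fun x => x) 0.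
Proof.
move=> s0.
have [a aE] : exists a, hasE (N s) (fun x : R => x) a.
  apply: (hasE_dom _ (hasED (hasE_cst _ 1) (normal_moment2 s0))) => // x.
  by rewrite ler_norml; have := sqr_ge0 (x - 1); have := sqr_ge0 (x + 1);
    have := sqr_ge0 x; rewrite !expr2; lra.
suff a0 : a = 0 by rewrite a0 in aE.
have key z : `|z| * s <= 1 -> z * a <= z ^+ 2 * s ^+ 2.
  move=> zs; have := hasE_le (hasED (hasE_cst _ 1) (hasEZ z aE)) (normal_mgf z s0)
    (fun x => expR_ge1Dx (z * x)).
  set w := z ^+ 2 * s ^+ 2 / 2 => h.
  have zs2 : z ^+ 2 * s ^+ 2 <= 1.
    have : -1 <= z * s <= 1 by rewrite -ler_norml normrM (gtr0_norm s0).
    by rewrite -exprMn expr2 => /andP[? ?]; nra.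
  have w0 : 0 <= w by rewrite divr_ge0// mulr_ge0 ?sqr_ge0.
  have : expR w * expR (- w) = 1 by rewrite -expRD subrr expR0.
  have := expR_ge1Dx (- w); have := expR_gt0 w; set e := expR w in h *.
  set f := expR _ => e0 h1 h2.
  have h3 : e * (1 - w) <= 1 by rewrite -[leRHS]h2 ler_pM2l.
  have wE : z ^+ 2 * s ^+ 2 = 2 * w by rewrite /w; field.
  rewrite wE in zs2 *; nra.
apply/eqP; rewrite -normr_eq0 eq_le normr_ge0 andbT.
apply/ler_addgt0Pl => e e0; rewrite addr0.
pose z := Num.min s^-1 (e / s ^+ 2).
have z0 : 0 < z by rewrite lt_min invr_gt0 s0 divr_gt0// exprn_gt0.
have zs1 : z * s <= 1 by rewrite -ler_pdivlMr// div1r ge_min lexx.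
have zs2 : z * s ^+ 2 <= e by rewrite -ler_pdivlMr ?exprn_gt0// ge_min lexx orbT.
have h1 := key z; have h2 := key (- z).
rewrite normrN (gtr0_norm z0) sqrrN mulNr in h1 h2.
have {}h1 := h1 zs1; have {}h2 := h2 zs1.
rewrite ler_norml; apply/andP; split.
  rewrite -(ler_pM2l z0); have : z * (z * s ^+ 2) <= z * e by rewrite ler_pM2l.
  by rewrite expr2 in h2; lra.
rewrite -(ler_pM2l z0); have : z * (z * s ^+ 2) <= z * e by rewrite ler_pM2l.
by rewrite expr2 in h1; lra.
Qed.

Definition shift (m x : R) : R := x - m.

Lemma measurable_shift m :
  measurable_fun [set: measurableTypeR R] (shift m : measurableTypeR R -> measurableTypeR R).
Proof.
have h : measurable_fun [set: R] (shift m) by exact: measurable_funB.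
exact: h.
Qed.

Lemma lebesgue_shift (m : R) (B : set R) : measurable B ->
  mu [set y | B (shift m y)] = mu B.
Proof.
move=> mB.
pose nu0 : {measure set (measurableTypeR R) -> \bar R} :=
  pushforward mu (shift m : measurableTypeR R -> measurableTypeR R).
pose nu := nu0 (measurable_shift m).
have H X : ocitv X -> mu X = nu X.
  rewrite ocitvP => -[->|[[a b] /= ab ->]]; first by rewrite !measure0.
  have -> : nu `]a, b]%classic = mu `]a + m, b + m]%classic.
    rewrite /nu /nu0 /pushforward; congr (mu _).
    by apply/seteqP; split=> z; rewrite /= !in_itv/= /shift; lra.
  rewrite !lebesgue_measure_itv/= !lte_fin ltrD2r; case: ifP => // _.
  by rewrite -!EFinB; congr EFin; lra.
by rewrite (lebesgue_measure_unique H mB).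
Qed.

(** Used to centre a conditional law whose mean varies with the design; it covers the point mass as
    well. *)
Lemma normal_law_shift (m v : R) (B : set R) : 0 <= v -> measurable B ->
  normal_law m v [set y | B (y - m)] = normal_law 0 v B.
Proof.
move=> v0 mB; rewrite /normal_law; case: eqVneq => [_|vn0].
  by rewrite !diracE; congr (_%:R%:E); congr nat_of_bool;
    apply/idP/idP; rewrite !inE /= subrr.
have s0 : Num.sqrt v != 0 by rewrite gt_eqF// sqrtr_gt0 lt0r vn0.
set s := Num.sqrt v in s0 *; rewrite /normal_prob.
transitivity (\int[mu]_(x in (shift m : measurableTypeR R -> measurableTypeR R) @^-1` B)
   ((fun z => (normal_pdf 0 s z)%:E) \o shift m) x)%E.
  apply: eq_integral => x _; congr EFin.
  by rewrite !normal_pdfE//= normal_fun_center.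
pose nu0 : {measure set (measurableTypeR R) -> \bar R} :=
  pushforward mu (shift m : measurableTypeR R -> measurableTypeR R).
transitivity (\int[nu0 (measurable_shift m)]_(z in B) (normal_pdf 0 s z)%:E)%E.
  rewrite (ge0_integral_pushforward (measurable_shift m))//.
  - apply: measurable_funTS; apply/measurable_EFinP; exact: measurable_normal_pdf.
  - by move=> z _; rewrite lee_fin normal_pdf_ge0.
by apply: eq_measure_integral => A mA _; exact: lebesgue_shift.
Qed.

End normal_moments.

(** * Independence *)

Section independence.
Context (R : realType) (d : measure_display) (T : measurableType d)
  (P : probability T R).

Lemma hasE_law d' (U : measurableType d') (mu : probability U R) (X : T -> U)
    (f : U -> R) c : measurable_fun [set: T] X ->
  (forall B, measurable B -> P (X @^-1` B) = mu B) ->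
  hasE mu f c -> hasE P (f \o X) c.
Proof.
move=> mX XE fc; have mf := hasE_meas fc; case: fc => fI fc.
have key (g : U -> \bar R) : measurable_fun [set: U] g -> (forall y, (0 <= g y)%E) ->
    (\int[P]_w g (X w) = \int[mu]_y g y)%E.
  move=> mg g0; rewrite -[LHS]/(\int[P]_(x in X @^-1` [set: U]) (g \o X) x)%E.
  rewrite -(ge0_integral_pushforward mX)//.
  by apply: eq_measure_integral => B mB _; rewrite /= /pushforward XE.
have PI : P.-integrable [set: T] (EFin \o (f \o X)).
  apply/integrableP; split; first by apply/measurable_EFinP; exact: measurableT_comp.
  rewrite (key (fun y => `|(f y)%:E|)%E)//; first by case/integrableP : fI.
  by apply: measurableT_comp => //; exact/measurable_EFinP.
split=> //; rewrite -fc.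
rewrite -[LHS]/(\int[P]_(x in X @^-1` [set: U]) ((EFin \o f) \o X) x)%E.
rewrite -(integral_pushforward mX)//; last exact/measurable_EFinP.
by apply: eq_measure_integral => B mB _; rewrite /= /pushforward XE.
Qed.

Definition indep_of d' (U : measurableType d') (E : set T) (X : T -> U) : Prop :=
  forall B, measurable B -> P (E `&` X @^-1` B) = (P E * P (X @^-1` B))%E.

(** Independence makes the joint law the product of the marginals; Fubini's theorem then factors the
    integral. *)
Lemma hasE_indep d1 d2 (U1 : measurableType d1) (U2 : measurableType d2)
    (X : T -> U1) (Y : T -> U2) (f : U1 -> R) (g : U2 -> R) a b :
  measurable_fun [set: T] X -> measurable_fun [set: T] Y ->
  measurable_fun [set: U1] f -> measurable_fun [set: U2] g ->
  (forall A, measurable A -> indep_of (X @^-1` A) Y) ->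
  hasE P (f \o X) a -> hasE P (g \o Y) b ->
  hasE P (fun w => f (X w) * g (Y w)) (a * b).
Proof.
move=> mX mY mf mg ind [fI fE] [gI gE].
pose X' : {mfun T >-> U1} := HB.pack_for {mfun T >-> U1} X (isMeasurableFun.Build _ _ _ _ X mX).
pose Y' : {mfun T >-> U2} := HB.pack_for {mfun T >-> U2} Y (isMeasurableFun.Build _ _ _ _ Y mY).
have mXY : measurable_fun [set: T] (fun w => (X w, Y w)) by exact: measurable_fun_pair.
pose XY : {mfun T >-> (U1 * U2)%type} := HB.pack_for {mfun T >-> (U1 * U2)%type}
  (fun w => (X w, Y w)) (isMeasurableFun.Build _ _ _ _ (fun w => (X w, Y w)) mXY).
pose PX : probability U1 R := distribution P X'.
pose PY : probability U2 R := distribution P Y'.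
pose PXY : probability (U1 * U2)%type R := distribution P XY.
have law B : measurable B -> (PX \x PY)%E B = PXY B.
  apply: product_measure_unique => A C mA mC.
  rewrite /PXY /PX /PY /distribution /= /pushforward.
  exact: (ind A mA C mC).
pose F := fun z : U1 * U2 => f z.1 * g z.2.
have mF : measurable_fun [set: U1 * U2] F.
  by apply: measurable_funM; apply: measurableT_comp.
have fI' : PX.-integrable [set: U1] (EFin \o f).
  by apply: (integrable_pushforward mX) => //; exact/measurable_EFinP.
have gI' : PY.-integrable [set: U2] (EFin \o g).
  by apply: (integrable_pushforward mY) => //; exact/measurable_EFinP.
have fE' : (\int[PX]_x (f x)%:E = a%:E)%E.
  rewrite -fE -[RHS]/(\int[P]_(x in X @^-1` [set: U1]) ((EFin \o f) \o X) x)%E.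
  by rewrite -(integral_pushforward mX)//; exact/measurable_EFinP.
have gE' : (\int[PY]_x (g x)%:E = b%:E)%E.
  rewrite -gE -[RHS]/(\int[P]_(x in Y @^-1` [set: U2]) ((EFin \o g) \o Y) x)%E.
  by rewrite -(integral_pushforward mY)//; exact/measurable_EFinP.
have mag : measurable_fun [set: U2] (fun y => `|(g y)%:E|)%E.
  by apply: measurableT_comp => //; exact/measurable_EFinP.
have maf : measurable_fun [set: U1] (fun y => `|(f y)%:E|)%E.
  by apply: measurableT_comp => //; exact/measurable_EFinP.
have FI : (PX \x PY)%E.-integrable [set: U1 * U2] (EFin \o F).
  apply/integrable12ltyP; first exact/measurable_EFinP.
  have E1 x : (\int[PY]_y `|(F (x, y))%:E| = `|(f x)%:E| * \int[PY]_y `|(g y)%:E|)%E.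
    under eq_integral do rewrite /F /= normrM EFinM.
    by rewrite ge0_integralZl.
  rewrite (eq_integral (fun x => `|(f x)%:E| * \int[PY]_y `|(g y)%:E|)%E); last first.
    by move=> x _; exact: E1.
  have /integrableP[_ g1] := gI'; have /integrableP[_ f1] := fI'.
  have g0 : (0 <= \int[PY]_y `|(g y)%:E|)%E by exact: integral_ge0.
  rewrite ge0_integralZr//.
  apply: lte_mul_pinfty => //; first exact: integral_ge0.
  by rewrite ge0_fin_numE//; exact: integral_ge0.
have FE : (\int[PX \x PY]_z (F z)%:E = (a * b)%:E)%E.
  rewrite -integral12_prod_meas1//.
  rewrite (eq_integral (fun x => (f x)%:E * b%:E)%E); last first.
    move=> x _; rewrite /fubini_F -gE' -integralZl//.
  rewrite EFinM -fE' -integralZr//.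
have H : hasE PXY F (a * b).
  split; last first.
    rewrite -FE; apply: eq_measure_integral => B mB _; exact/esym/law.
  apply/integrableP; split; first exact/measurable_EFinP.
  case/integrableP : FI => _; congr (_ < _)%E.
  by apply: eq_measure_integral => B mB _; exact: (law _ mB).
exact: (@hasE_law _ _ PXY (fun w => (X w, Y w)) F _ mXY _ H).
Qed.

(** Passage from rectangles to the product sigma-algebra: the law of the pair restricted to [E], and
    [P E] times the law of the pair, both coincide with one product measure. *)
Lemma indep_pair d1 d2 (U1 : measurableType d1) (U2 : measurableType d2)
    (E : set T) (X : T -> U1) (Y : T -> U2) : measurable E ->
  measurable_fun [set: T] X -> measurable_fun [set: T] Y ->
  (forall A B, measurable A -> measurable B ->
    P (X @^-1` A `&` Y @^-1` B) = P (X @^-1` A) * P (Y @^-1` B))%E ->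
  (forall A B, measurable A -> measurable B ->
    P (E `&` (X @^-1` A `&` Y @^-1` B)) = P E * (P (X @^-1` A) * P (Y @^-1` B)))%E ->
  indep_of E (fun w => (X w, Y w)).
Proof.
move=> mE mX mY indXY indE.
pose X' : {mfun T >-> U1} := HB.pack_for {mfun T >-> U1} X (isMeasurableFun.Build _ _ _ _ X mX).
pose Y' : {mfun T >-> U2} := HB.pack_for {mfun T >-> U2} Y (isMeasurableFun.Build _ _ _ _ Y mY).
have mXY : measurable_fun [set: T] (fun w => (X w, Y w)) by exact: measurable_fun_pair.
pose XY : {mfun T >-> (U1 * U2)%type} := HB.pack_for {mfun T >-> (U1 * U2)%type}
  (fun w => (X w, Y w)) (isMeasurableFun.Build _ _ _ _ (fun w => (X w, Y w)) mXY).
have PEfin : P E \is a fin_num by exact: fin_num_measure.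
pose k : {nonneg R} := NngNum (fine_ge0 (measure_ge0 P E)).
have kE : k%:num%:E = P E by rewrite /= fineK.
pose m1 : {finite_measure set U1 -> \bar R} := mscale k (distribution P X').
pose m2 : {finite_measure set U2 -> \bar R} := distribution P Y'.
pose mE0 : {measure set (U1 * U2) -> \bar R} := pushforward (mrestr P mE) XY.
pose mE' := mE0 mXY.
pose mS : {measure set (U1 * U2) -> \bar R} := mscale k (distribution P XY).
move=> B mB.
have h1 : (m1 \x m2)%E B = mE' B.
  apply: product_measure_unique => // A C mA mC.
  have -> : mE' (A `*` C) = P ((X @^-1` A `&` Y @^-1` C) `&` E) by [].
  rewrite setIC indE// muleA; congr (_ * _)%E.
  by rewrite -kE.
have h2 : (m1 \x m2)%E B = mS B.
  apply: product_measure_unique => // A C mA mC.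
  have -> : mS (A `*` C) = (k%:num%:E * P (X @^-1` A `&` Y @^-1` C))%E by [].
  by rewrite indXY// muleA.
have -> : P (E `&` (fun w => (X w, Y w)) @^-1` B) = mE' B.
  by rewrite setIC.
by rewrite -h1 h2 -kE.
Qed.

End independence.

(** * Conditional laws *)

Section disintegration.
Context (R : realType) (d : measure_display) (T : measurableType d)
  (P : probability T R) (G : set (set T)) (d' : measure_display)
  (T' : measurableType d') (Y : {RV P >-> T'}) (K : T -> probability T' R).
Hypothesis mG : G `<=` measurable.
Hypothesis HK : is_conditional_law G Y K.

Local Notation TG := (g_sigma_algebraType G).

Lemma sG_measurable E : <<s G >> E -> measurable E.
Proof. exact: (smallest_sub (@sigma_algebra_measurable _ T) mG). Qed.

(** The dummy [unit] argument lets the conditional law be composed with the law of the conditioning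
    variable, itself viewed as a kernel from [unit]. *)
Definition cond_kernel (x : unit * TG) : {measure set T' -> \bar R} := K x.2.

Lemma measurable_cond_kernel (U : set T') : measurable U ->
  measurable_fun [set: unit * TG] (cond_kernel ^~ U).
Proof.
move=> mU; exact: (measurableT_comp (HK.1 U mU) measurable_snd).
Qed.

HB.instance Definition _ := isKernel.Build _ _ (unit * TG)%type T' R
  cond_kernel measurable_cond_kernel.

Lemma cond_kernel_prob x : cond_kernel x [set: T'] = 1%E.
Proof. exact: probability_setT. Qed.

HB.instance Definition _ := Kernel_isProbability.Build _ _ (unit * TG)%type T' R
  cond_kernel cond_kernel_prob.

Definition to_sub (w : T) : TG := w.

Lemma measurable_to_sub : measurable_fun [set: T] to_sub.
Proof. by move=> _ A mA; rewrite setTI; exact: sG_measurable. Qed.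

HB.instance Definition _ := isMeasurableFun.Build _ _ _ _ to_sub measurable_to_sub.

Definition subP : probability TG R := distribution P to_sub.

Definition sub_kernel (x : unit) : {measure set TG -> \bar R} := subP.

Lemma measurable_sub_kernel (U : set TG) : measurable U ->
  measurable_fun [set: unit] (sub_kernel ^~ U).
Proof. by move=> _; exact: measurable_cst. Qed.

HB.instance Definition _ := isKernel.Build _ _ unit TG R
  sub_kernel measurable_sub_kernel.

Lemma sub_kernel_prob x : sub_kernel x [set: TG] = 1%E.
Proof. exact: probability_setT. Qed.

HB.instance Definition _ := Kernel_isProbability.Build _ _ unit TG R
  sub_kernel sub_kernel_prob.

Definition pairY (w : T) : TG * T' := (to_sub w, Y w).

Lemma measurable_pairY : measurable_fun [set: T] pairY.
Proof. by apply: measurable_fun_pair => //; exact: measurable_to_sub. Qed.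

HB.instance Definition _ := isMeasurableFun.Build _ _ _ _ pairY measurable_pairY.

(** On rectangles this is the definition of a conditional law, and rectangles form a generating
    class stable under intersection. *)
Lemma disintegration (D : set (TG * T')) : measurable D ->
  P [set w | D (to_sub w, Y w)] = (\int[subP]_w K w (xsection D w))%E.
Proof.
move=> mD.
pose m1 : {measure set (TG * T') -> \bar R} := distribution P pairY.
pose m2 : {measure set (TG * T') -> \bar R} := mkproduct sub_kernel cond_kernel tt.
have m2E A : measurable A -> m2 A = (\int[subP]_w K w (xsection A w))%E.
  move=> mA; apply: eq_integral => w _.
  by rewrite kernel.intker_indicE.
rewrite -m2E//; suff : m1 D = m2 D by [].
pose GG : set (set (TG * T')) := [set A `*` B | A in measurable & B in measurable].
apply: (measure_unique GG (fun=> setT)) => //.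
- exact: measurable_prod_measurableType.
- move=> _ _ [A mA [B mB <-]] [A' mA' [B' mB' <-]].
  exists (A `&` A'); first exact: measurableI.
  by exists (B `&` B'); [exact: measurableI|rewrite setXI].
- by move=> _; exists setT => //; exists setT => //; rewrite setXTT.
- by rewrite bigcup_const.
- move=> _ [A mA [B mB <-]]; rewrite m2E; last exact: measurableX.
  rewrite (eq_integral ((fun w => K w B) \_ A)); last first.
    move=> w _; rewrite patchE; case: ifPn => wA.
      by rewrite in_xsectionX.
    by rewrite notin_xsectionX// measure0.
  rewrite -integral_mkcond /subP /distribution.
  rewrite (ge0_integral_pushforward measurable_to_sub)//; last first.
    by apply: measurable_funTS; exact: (HK.1 B mB).
  have := HK.2 A B mA mB; rewrite -[X in X = _ -> _]/(m1 (A `*` B)) => ->.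
  by [].
- by move=> _; apply: le_lt_trans (probability_le1 _ _) _ => //; exact: ltry.
Qed.

(** A conditional law that is the same for all outcomes makes [h Y - c] independent of the
    conditioning sigma-algebra. Disintegration is needed because [c] varies with the outcome. *)
Lemma cond_indep (h : T' -> R) (c : TG -> R) (N : set R -> \bar R) :
  measurable_fun [set: T'] h -> measurable_fun [set: TG] c ->
  (forall w B, measurable B -> K w [set z | B (h z - c w)] = N B) ->
  forall E B, <<s G >> E -> measurable B ->
    P (E `&` [set w | B (h (Y w) - c w)]) = (P E * N B)%E.
Proof.
move=> mh mc KN E B mE mB.
have mF : measurable_fun [set: TG * T'] (fun z => h z.2 - c z.1).
  by apply: measurable_funB; apply: measurableT_comp.
pose D : set (TG * T') := (E `*` setT) `&` [set z | B (h z.2 - c z.1)].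
have mD : measurable D.
  apply: measurableI; first exact: measurableX.
  by rewrite -[X in measurable X]setTI; exact: mF.
have := disintegration mD.
have -> : [set w | D (to_sub w, Y w)] = E `&` [set w | B (h (Y w) - c w)].
  by apply/seteqP; split=> w /= => [[[] ? _ ?]|[? ?]].
move=> ->.
have mE' : measurable (E : set TG) by exact: mE.
transitivity (\int[subP]_w ((fun=> N B) \_ (E : set TG)) w)%E.
  apply: eq_integral => w _; rewrite patchE; case: ifPn => wE.
    rewrite -(KN w B mB); congr (K w _).
    apply/seteqP; split=> z; rewrite /xsection/= inE => H.
      by case: H.
    by split=> //; split=> //; exact: set_mem.
  rewrite -[RHS](measure0 (K w)); congr (K w _).
  apply/seteqP; split=> z; rewrite /xsection/= ?inE// => -[[wE' _] _].
  by rewrite notin_setE in wE.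
rewrite -integral_mkcond.
have NB : exists r : R, N B = r%:E.
  exists (fine (N B)); rewrite fineK// -(KN point B mB).
  apply: fin_num_measure; rewrite -[X in measurable X]setTI.
  by apply: (measurable_funB mh (measurable_cst (c point))).
have [r rE] := NB; rewrite rE.
by rewrite integral_cst// muleC.
Qed.

End disintegration.

Section normal_law_moments.
Context (R : realType) (d : measure_display) (T : measurableType d)
  (P : probability T R).

Lemma law_moments (f : T -> R) v : measurable_fun [set: T] f -> 0 <= v ->
  (forall B, measurable B -> P (f @^-1` B) = normal_law 0 v B) ->
  [/\ hasE P f 0, hasE P (fun w => f w ^+ 2) v &
      hasE P (fun w => f w ^+ 4) (3 * v ^+ 2)].
Proof.
move=> mf v0; rewrite /normal_law; case: eqVneq => [->|vn0] H.
  have D (g : R -> R) : measurable_fun [set: R] g -> g 0 = 0 ->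
      hasE P (g \o f) 0.
    move=> mg g0; pose dl : probability R R := dirac (0 : R).
    suff : hasE dl g 0 by exact: (@hasE_law _ _ _ _ _ _ dl f g 0 mf H).
    have gI : (\int[dl]_x (g x)%:E = 0)%E.
      by rewrite integral_dirac//= ?diracT ?mul1e ?g0//; exact/measurable_EFinP.
    split=> //; apply/integrableP; split; first exact/measurable_EFinP.
    have mag : measurable_fun [set: R] (fun x => `|(g x)%:E|)%E.
      by apply: measurableT_comp => //; exact/measurable_EFinP.
    by rewrite integral_dirac// diracT mul1e /= g0 normr0 ltry.
  split.
  - exact: (D id).
  - by apply: (D (fun x => x ^+ 2)); rewrite ?expr0n//; exact: measurable_funX.
  - rewrite expr0n mulr0.
    by apply: (D (fun x => x ^+ 4)); rewrite ?expr0n//; exact: measurable_funX.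
have {vn0} {}v0 : 0 < v by rewrite lt0r vn0.
have s0 : 0 < Num.sqrt v by rewrite sqrtr_gt0.
have sE : Num.sqrt v ^+ 2 = v by rewrite sqr_sqrtr// ltW.
pose mu : probability (measurableTypeR R) R := normal_prob 0 (Num.sqrt v).
have hasE_law' (g : R -> R) c : hasE mu g c -> hasE P (g \o f) c.
  exact: (@hasE_law R d T P _ (measurableTypeR R) mu f g c mf H).
split.
- exact: (hasE_law' _ _ (normal_mean s0)).
- by have := hasE_law' _ _ (normal_moment2 s0); rewrite sE.
- by have := hasE_law' _ _ (normal_moment4 s0); rewrite -[4%N]/(2 * 2)%N !exprM sE.
Qed.

End normal_law_moments.

(** * Mixed moments of the white noise *)

Section white_noise.
Context (R : realType) (p n : nat) (delta : R) (d : measure_display)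
  (T : measurableType d) (P : probability T R)
  (x : 'I_p -> R -> {RV P >-> R}) (vx2 : 'I_p -> R).
Hypothesis vx2_gt0 : forall j, 0 < vx2 j.
Hypothesis hx : white_noise_regressors n delta x vx2.

Lemma wn_moments j s : domain delta n s ->
  [/\ hasE P (x j s) 0, hasE P (fun w => x j s w ^+ 2) (vx2 j) &
      hasE P (fun w => x j s w ^+ 4) (3 * vx2 j ^+ 2)].
Proof.
move=> ds; apply: law_moments; [exact: measurable_funP|exact: ltW|].
by move=> B mB; exact: (hx.2 j s ds B mB).
Qed.

Definition pt (u : 'I_p * R) : T -> R := x u.1 u.2.

Lemma pt_meas u : measurable_fun [set: T] (pt u).
Proof. exact: measurable_funP. Qed.

Lemma wn_indep4 (u v s t : 'I_p * R) (A B C D : set R) : uniq [:: u; v; s; t] ->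
  domain delta n u.2 -> domain delta n v.2 -> domain delta n s.2 -> domain delta n t.2 ->
  measurable A -> measurable B -> measurable C -> measurable D ->
  P ((pt u @^-1` A `&` pt v @^-1` B) `&` (pt s @^-1` C `&` pt t @^-1` D)) =
  (P (pt u @^-1` A) * P (pt v @^-1` B) * (P (pt s @^-1` C) * P (pt t @^-1` D)))%E.
Proof.
move=> uq du dv ds dt mA mB mC mD.
pose F i := if i == u then A else if i == v then B else if i == s then C else D.
have /and4P[] := uq; rewrite !inE !negb_or => /and3P[uv us ut] /andP[vs vt] st _.
pose J : {fset 'I_p * R} := [fset i in [:: u; v; s; t]]%fset.
have memJ i : (i \in J) = [|| i == u, i == v, i == s | i == t].
  by rewrite !inE /= ?orbF.
have H i : i \in J ->
    [set js : 'I_p * R | domain delta n js.2] i /\ measurable (F i).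
  rewrite memJ /F => h; split.
    by case/or4P : h => /eqP ->.
  by case: ifP => // _; case: ifP => // _; case: ifP.
have := hx.1 J F H.
have pe : perm_eq J [:: u; v; s; t].
  apply: (uniq_perm (fset_uniq _) uq).
  by move=> i; rewrite memJ !inE.
rewrite (perm_big _ pe)/= !big_cons big_nil mule1 -!muleA.
rewrite /F eqxx (eq_sym v u) (negbTE uv) eqxx (eq_sym s u) (negbTE us).
rewrite (eq_sym s v) (negbTE vs) eqxx (eq_sym t u) (negbTE ut) (eq_sym t v).
rewrite (negbTE vt) (eq_sym t s) (negbTE st) => <-.
congr (P _); apply/seteqP; split=> w /=.
  move=> [[wA wB] [wC wD]] i; rewrite /= memJ => /or4P[]/eqP ->.
  - by rewrite eqxx.
  - by rewrite (eq_sym v u) (negbTE uv) eqxx.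
  - by rewrite (eq_sym s u) (negbTE us) (eq_sym s v) (negbTE vs) eqxx.
  - by rewrite (eq_sym t u) (negbTE ut) (eq_sym t v) (negbTE vt) (eq_sym t s) (negbTE st).
move=> h; split; split.
- by have := h u; rewrite /= memJ eqxx; apply.
- by have := h v; rewrite /= memJ eqxx (eq_sym v u) (negbTE uv); apply.
- by have := h s; rewrite /= memJ eqxx (eq_sym s u) (negbTE us) (eq_sym s v) (negbTE vs); apply.
- have := h t; rewrite /= memJ eqxx (eq_sym t u) (negbTE ut) (eq_sym t v) (negbTE vt).
  by rewrite (eq_sym t s) (negbTE st); apply.
Qed.

Lemma wn_indep2 (u v : 'I_p * R) (A B : set R) : u != v ->
  domain delta n u.2 -> domain delta n v.2 -> measurable A -> measurable B ->
  P (pt u @^-1` A `&` pt v @^-1` B) = (P (pt u @^-1` A) * P (pt v @^-1` B))%E.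
Proof.
move=> uv du dv mA mB.
pose F i := if i == u then A else B.
pose J : {fset 'I_p * R} := [fset i in [:: u; v]]%fset.
have memJ i : (i \in J) = (i == u) || (i == v) by rewrite !inE /= ?orbF.
have H i : i \in J ->
    [set js : 'I_p * R | domain delta n js.2] i /\ measurable (F i).
  rewrite memJ /F => h; split; last by case: ifP.
  by case/orP : h => /eqP ->.
have := hx.1 J F H.
have pe : perm_eq J [:: u; v].
  apply: (uniq_perm (fset_uniq _)); first by rewrite /= inE uv.
  by move=> i; rewrite memJ !inE.
rewrite (perm_big _ pe)/= !big_cons big_nil mule1.
rewrite /F eqxx (eq_sym v u) (negbTE uv) => <-.
congr (P _); apply/seteqP; split=> w /=.
  move=> [wA wB] i; rewrite /= memJ => /orP[]/eqP ->; first by rewrite eqxx.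
  by rewrite (eq_sym v u) (negbTE uv).
move=> h; split.
- by have := h u; rewrite /= memJ eqxx; apply.
- by have := h v; rewrite /= memJ eqxx (eq_sym v u) (negbTE uv); apply.
Qed.

Lemma wn_prod2 (u v : 'I_p * R) (f g : R -> R) a b : u != v ->
  domain delta n u.2 -> domain delta n v.2 ->
  measurable_fun [set: R] f -> measurable_fun [set: R] g ->
  hasE P (f \o pt u) a -> hasE P (g \o pt v) b ->
  hasE P (fun w => f (pt u w) * g (pt v w)) (a * b).
Proof.
move=> uv du dv mf mg; apply: (hasE_indep (pt_meas u) (pt_meas v) mf mg).
by move=> A mA B mB; exact: wn_indep2.
Qed.

Lemma wn_mul (u v : 'I_p * R) : domain delta n u.2 -> domain delta n v.2 ->
  hasE P (fun w => pt u w * pt v w) (if u == v then vx2 u.1 else 0).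
Proof.
move=> du dv; case: eqVneq => [->|uv].
  by have [_ + _] := wn_moments v.1 dv; apply: hasE_ext => w; rewrite expr2.
have [hu _ _] := wn_moments u.1 du; have [hv _ _] := wn_moments v.1 dv.
by have := wn_prod2 (f := id) (g := id) uv du dv (@measurable_id _ _ _)
  (@measurable_id _ _ _) hu hv; rewrite mulr0.
Qed.

(** The pairs at [u], [v] and at [s], [t] are independent, by one use of [indep_pair] for each pair;
    each product has mean zero. *)
Lemma wn_mul4 (u v s t : 'I_p * R) : uniq [:: u; v; s; t] ->
  domain delta n u.2 -> domain delta n v.2 -> domain delta n s.2 -> domain delta n t.2 ->
  hasE P (fun w => (pt u w * pt v w) * (pt s w * pt t w)) 0.
Proof.
move=> uq du dv ds dt.
have /and4P[] := uq; rewrite !inE !negb_or => /and3P[uv us ut] /andP[vs vt] st _.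
have hm (y z : 'I_p * R) : y != z -> domain delta n y.2 -> domain delta n z.2 ->
    hasE P (fun w => pt y w * pt z w) 0.
  by move=> yz dy dz; have := wn_mul dy dz; rewrite (negbTE yz).
pose f (z : R * R) := z.1 * z.2.
have mf : measurable_fun [set: R * R] f by apply: measurable_funM.
have mp (y z : 'I_p * R) : measurable_fun [set: T] (fun w => (pt y w, pt z w)).
  by apply: measurable_fun_pair; exact: pt_meas.
rewrite -[X in hasE _ _ X](mulr0 0).
apply: (hasE_indep (f := f) (g := f) (mp u v) (mp s t) mf mf _ (hm u v uv du dv)
  (hm s t st ds dt)).
have m1 y A : measurable A -> measurable (pt y @^-1` A).
  by move=> mA; rewrite -[X in measurable X]setTI; exact: (pt_meas y).
move=> A mA; apply: (indep_pair _ (pt_meas s) (pt_meas t)).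
- by rewrite -[X in measurable X]setTI; exact: mp.
- by move=> C D mC mD; exact: wn_indep2.
- move=> C D mC mD; rewrite setIC.
  have := @indep_pair _ _ _ P _ _ _ _ (pt s @^-1` C `&` pt t @^-1` D) (pt u) (pt v)
     (measurableI _ _ (m1 s C mC) (m1 t D mD)) (pt_meas u) (pt_meas v) _ _ A mA.
  rewrite wn_indep2// => ->; first by rewrite muleC.
  + by move=> A' B' mA' mB'; exact: wn_indep2.
  + move=> A' B' mA' mB'; rewrite setIC (wn_indep4 uq du dv ds dt mA' mB' mC mD).
    by rewrite muleC.
Qed.

End white_noise.

(** * Moments of the design *)

Section sites.
Context (R : realType) (delta : R) (n : nat).
Hypothesis n_gt0 : (0 < n)%N.

Lemma site_domain (i : 'I_n) : domain delta n (site delta i).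
Proof.
have nR : 0 < n%:R :> R by rewrite ltr0n.
rewrite /domain /site /= in_itv/= mulr_ge0 ?powR_ge0//=.
have -> : n%:R `^ delta = n%:R * n%:R `^ (- (1 - delta)).
  rewrite -{2}[n%:R]powRr1 ?ltW// -powRD; last by apply/implyP => _; rewrite gt_eqF.
  by congr (_ `^ _); lra.
by rewrite ler_wpM2r ?powR_ge0// ler_nat.
Qed.

Lemma site_inj : injective (@site R delta n).
Proof.
move=> i j; rewrite /site => /mulIf.
rewrite gt_eqF ?powR_gt0 ?ltr0n// => /(_ isT)/eqP; rewrite eqr_nat => /eqP[] ?.
exact: val_inj.
Qed.

Lemma site_dist (i j : 'I_n) :
  `|site delta i - site delta j| = ((i - j) + (j - i))%N%:R * n%:R `^ (- (1 - delta)).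
Proof.
rewrite /site -mulrBl normrM [X in _ * X]ger0_norm ?powR_ge0//; congr (_ * _).
rewrite -[i.+1%:R]natr1 -[j.+1%:R]natr1 opprD addrACA subrr addr0.
wlog ij : i j / (i <= j)%N => [H|].
  have [/H//|/ltnW/H h] := leqP i j.
  by rewrite distrC h addnC.
rewrite distrC ger0_norm ?subr_ge0 ?ler_nat// (eqP ij) add0n.
by rewrite natrB.
Qed.

End sites.

Section second_moments.
Context (R : realType) (d : measure_display) (T : measurableType d)
  (P : probability T R).

Lemma hasE_sqr_sum n (f : 'I_n -> T -> R) c :
  (forall i l, hasE P (fun w => f i w * f l w) (if i == l then c else 0)) ->
  hasE P (fun w => (\sum_i f i w) ^+ 2) (n%:R * c).
Proof.
move=> H.
have -> : n%:R * c = \sum_(i < n) \sum_(l < n) (if i == l then c else 0).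
  transitivity (\sum_(i < n) c); first by rewrite sumr_const card_ord mulr_natl.
  by apply: eq_bigr => i _; rewrite -big_mkcond (big_pred1 i)// => l; rewrite eq_sym.
have := hasE_sum (index_enum 'I_n) predT (fun i =>
  hasE_sum (index_enum 'I_n) predT (H i)).
apply: hasE_ext => w; rewrite expr2 mulr_suml; apply: eq_bigr => i _.
by rewrite mulr_sumr.
Qed.

Lemma formE n m (u : 'cV[R]_n) (A : 'M[R]_(n, m)) (v : 'cV[R]_m) :
  dot u (A *m v) = \sum_i \sum_j A i j * (u i ord0 * v j ord0).
Proof.
apply: eq_bigr => i _; rewrite mxE mulr_sumr; apply: eq_bigr => j _; ring.
Qed.

Lemma hasE_form n m (X : T -> 'cV[R]_n) (Y : T -> 'cV[R]_m) (A : 'M[R]_(n, m)) c :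
  (forall i j, hasE P (fun w => X w i ord0 * Y w j ord0) (c i j)) ->
  hasE P (fun w => dot (X w) (A *m Y w)) (\sum_i \sum_j A i j * c i j).
Proof.
move=> H; have := hasE_sum (index_enum 'I_n) predT (fun i =>
  hasE_sum (index_enum 'I_m) predT (fun j => hasEZ (A i j) (H i j))).
by apply: hasE_ext => w; rewrite formE.
Qed.

End second_moments.

Section design_moments.
Context (R : realType) (p n : nat) (delta : R) (d : measure_display)
  (T : measurableType d) (P : probability T R)
  (x : 'I_p -> R -> {RV P >-> R}) (vx2 : 'I_p -> R).
Hypothesis n_gt0 : (0 < n)%N.
Hypothesis vx2_gt0 : forall j, 0 < vx2 j.
Hypothesis hx : white_noise_regressors n delta x vx2.

Definition xv (j : 'I_p) (w : T) : 'cV[R]_n := \col_i x j (site delta i) w.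

Lemma xv_mul j k i l : hasE P (fun w => xv j w i ord0 * xv k w l ord0)
  (if (j == k) && (i == l) then vx2 j else 0).
Proof.
have := wn_mul vx2_gt0 hx (u := (j, site delta i)) (v := (k, site delta l))
  (site_domain delta n_gt0 i) (site_domain delta n_gt0 l).
rewrite xpair_eqE (inj_eq (@site_inj R delta n n_gt0)).
by apply: hasE_ext => w; rewrite !mxE.
Qed.

Lemma xv_mul4 j k i l : i != l ->
  hasE P (fun w => (xv j w i ord0 * xv k w i ord0) * (xv j w l ord0 * xv k w l ord0))
   (if j == k then vx2 j ^+ 2 else 0).
Proof.
move=> il; have sil := il; rewrite -(inj_eq (@site_inj R delta n n_gt0)) in sil.
have di := site_domain delta n_gt0 i; have dl := site_domain delta n_gt0 l.
case: eqVneq => [<-|jk].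
  have [_ h1 _] := wn_moments vx2_gt0 hx j di.
  have [_ h2 _] := wn_moments vx2_gt0 hx j dl.
  have uv : (j, site delta i) != (j, site delta l) by rewrite xpair_eqE eqxx.
  have := wn_prod2 (f := fun y => y ^+ 2) (g := fun y => y ^+ 2) hx uv di dl
    (measurable_funX _ (@measurable_id _ _ _)) (measurable_funX _ (@measurable_id _ _ _)) h1 h2.
  by apply: hasE_ext => w; rewrite !mxE /pt/= !expr2.
have uq : uniq [:: (j, site delta i); (k, site delta i); (j, site delta l); (k, site delta l)].
  by rewrite /= !inE !xpair_eqE !eqxx (negbTE jk) (negbTE sil) (eq_sym k j) (negbTE jk).
have := wn_mul4 vx2_gt0 hx uq di di dl dl.
by apply: hasE_ext => w; rewrite !mxE.
Qed.

Lemma xv_sqr2 j k i : j != k ->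
  hasE P (fun w => (xv j w i ord0 * xv k w i ord0) * (xv j w i ord0 * xv k w i ord0))
   (vx2 j * vx2 k).
Proof.
move=> jk; have di := site_domain delta n_gt0 i.
have [_ h1 _] := wn_moments vx2_gt0 hx j di.
have [_ h2 _] := wn_moments vx2_gt0 hx k di.
have uv : (j, site delta i) != (k, site delta i) by rewrite xpair_eqE (negbTE jk).
have := wn_prod2 (f := fun y => y ^+ 2) (g := fun y => y ^+ 2) hx uv di di
    (measurable_funX _ (@measurable_id _ _ _)) (measurable_funX _ (@measurable_id _ _ _)) h1 h2.
by apply: hasE_ext => w; rewrite !mxE /pt/=; ring.
Qed.

Lemma xv_quart j i : hasE P (fun w => (xv j w i ord0 * xv j w i ord0 - vx2 j) ^+ 2)
  (2 * vx2 j ^+ 2).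
Proof.
have [_ h1 h2] := wn_moments vx2_gt0 hx j (site_domain delta n_gt0 i).
have := hasED (hasEB h2 (hasEZ (2 * vx2 j) h1)) (hasE_cst P (vx2 j ^+ 2)).
move=> h; apply: hasE_eq (hasE_ext _ h); first by ring.
by move=> w; rewrite !mxE; ring.
Qed.

(** The centred summands at different sites are uncorrelated. The factor [1 + (j == k)]
    distinguishes the variance [2 v^2] of a square from that of a product of two independent
    variables. *)
Lemma xv_dot_var j k : hasE P
  (fun w => (dot (xv j w) (xv k w) - (j == k)%:R * (n%:R * vx2 j)) ^+ 2)
  (n%:R * ((1 + (j == k)%:R) * (vx2 j * vx2 k))).
Proof.
case: eqVneq => [<-|jk].
  pose f i w := xv j w i ord0 * xv j w i ord0 - vx2 j.
  have H i l : hasE P (fun w => f i w * f l w)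
      (if i == l then 2 * vx2 j ^+ 2 else 0).
    case: eqVneq => [<-|il].
      by apply: hasE_ext (xv_quart j i) => w; rewrite expr2.
    have h4 := xv_mul4 j j il; rewrite eqxx in h4.
    have h1 := xv_mul j j i i; have h2 := xv_mul j j l l; rewrite !eqxx in h1 h2.
    have h := hasED (hasEB (hasEB h4 (hasEZ (vx2 j) h1)) (hasEZ (vx2 j) h2))
      (hasE_cst P (vx2 j ^+ 2)).
    apply: hasE_eq (hasE_ext _ h); first by rewrite /=; ring.
    by move=> w; rewrite /f; ring.
  have := hasE_sqr_sum H; rewrite (_ : 2 * vx2 j ^+ 2 = (1 + 1) * (vx2 j * vx2 j)); last by ring.
  apply: hasE_ext => w; rewrite /f sumrB sumr_const card_ord /dot/=.
  by rewrite mul1r mulr_natl.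
pose f i w := xv j w i ord0 * xv k w i ord0.
have H i l : hasE P (fun w => f i w * f l w)
    (if i == l then vx2 j * vx2 k else 0).
  case: eqVneq => [<-|il]; first exact: xv_sqr2.
  by have := xv_mul4 j k il; rewrite (negbTE jk).
have := hasE_sqr_sum H; rewrite addr0 mul1r.
by apply: hasE_ext => w; rewrite mul0r subr0.
Qed.

Lemma xv_form j (A : 'M[R]_n) :
  hasE P (fun w => dot (xv j w) (A *m xv j w)) (vx2 j * \tr A).
Proof.
have := hasE_form (X := xv j) (Y := xv j) A (fun i l => xv_mul j j i l).
apply: hasE_eq; rewrite /mxtrace mulr_sumr; apply: eq_bigr => i _.
rewrite (bigD1 i)//= !eqxx/= big1 ?addr0 1?mulrC// => l li.
by rewrite eq_sym (negbTE li) mulr0.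
Qed.

(* Only the second moments of [Y] matter, because [xv j] is uncorrelated with
   everything else; [C] is a square root of the covariance of [Y]. *)
Lemma xv_lin m (Y : T -> 'cV[R]_n) (C : 'M[R]_(n, m)) j (A : 'M[R]_n) :
  (forall i l a b, hasE P (fun w => (xv j w i ord0 * xv j w l ord0) *
       (Y w a ord0 * Y w b ord0)) ((if i == l then vx2 j else 0) * (C *m C^T) a b)) ->
  hasE P (fun w => dot (xv j w) (A *m Y w) ^+ 2)
    (vx2 j * \sum_(c < m) dot (A *m col c C) (A *m col c C)).
Proof.
move=> H.
have K i l : hasE P (fun w => (xv j w i ord0 * (A *m Y w) i ord0) *
       (xv j w l ord0 * (A *m Y w) l ord0))
    (if i == l then vx2 j * \sum_(c < m) ((A *m C) i c) ^+ 2 else 0).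
  have h := hasE_sum (index_enum 'I_n) predT (fun a =>
    hasE_sum (index_enum 'I_n) predT (fun b => hasEZ (A i a * A l b) (H i l a b))).
  apply: hasE_eq (hasE_ext _ h).
    case: eqVneq => [<-|il]; last first.
      by rewrite big1// => a _; rewrite big1// => b _; rewrite mul0r mulr0.
    transitivity (vx2 j * \sum_a \sum_b (A i a * A i b) * (C *m C^T) a b).
      rewrite mulr_sumr; apply: eq_bigr => a _; rewrite mulr_sumr; apply: eq_bigr => b _.
      ring.
    congr (_ * _).
    transitivity ((A *m C *m (A *m C)^T) i i).
      rewrite trmx_mul mulmxA -(mulmxA A) mxE exchange_big/=; apply: eq_bigr => b _.
      rewrite [in RHS]mxE mulr_suml; apply: eq_bigr => a _.
      by rewrite [A^T _ _]mxE; ring.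
    by rewrite mxE; apply: eq_bigr => c _; rewrite [(A *m C)^T _ _]mxE expr2.
  move=> w /=; rewrite !mxE.
  rewrite mulrACA big_distrlr/= mulr_sumr; apply: eq_bigr => a _.
  rewrite mulr_sumr; apply: eq_bigr => b _; ring.
have h := hasE_sum (index_enum 'I_n) predT (fun i =>
   hasE_sum (index_enum 'I_n) predT (K i)).
apply: hasE_eq (hasE_ext _ h).
  transitivity (\sum_i vx2 j * \sum_(c < m) ((A *m C) i c) ^+ 2).
    by apply: eq_bigr => i _; rewrite -big_mkcond (big_pred1 i)// => l; rewrite eq_sym.
  rewrite -mulr_sumr exchange_big/=; congr (_ * _); apply: eq_bigr => c _.
  apply: eq_bigr => i _; rewrite -expr2; congr (_ ^+ 2); rewrite !mxE.
  by apply: eq_bigr => l _; rewrite mxE.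
move=> w /=; rewrite /dot expr2 mulr_suml; apply: eq_bigr => i _.
by rewrite mulr_sumr.
Qed.

(** A fixed vector has second moment [y y'], so the square root [C] is the single column [y]. *)
Lemma xv_lin_cst (y : 'cV[R]_n) j (A : 'M[R]_n) :
  hasE P (fun w => dot (xv j w) (A *m y) ^+ 2) (vx2 j * dot (A *m y) (A *m y)).
Proof.
have := @xv_lin 1 (fun=> y) y j A; rewrite big_ord1.
have -> : col ord0 y = y by apply/colP => i; rewrite mxE.
apply => i l a b; have := hasEZ (y a ord0 * y b ord0) (xv_mul j j i l).
rewrite eqxx/= => h; apply: hasE_eq (hasE_ext _ h).
  by rewrite mxE big_ord1 [y^T _ _]mxE mulrC.
by move=> w; rewrite mulrC.
Qed.

End design_moments.

(** * Moments of the errors *)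

Section error_moments.
Context (R : realType) (p n : nat) (delta : R) (d : measure_display)
  (T : measurableType d) (P : probability T R)
  (x : 'I_p -> R -> {RV P >-> R}) (vx2 : 'I_p -> R)
  (Z : {RV P >-> n.-tuple R}) (beta0 : 'cV[R]_(1 + p)) (S : 'M[R]_n).
Local Notation X := (fun w => design delta n (realization x w)).
Hypothesis n_gt0 : (0 < n)%N.
Hypothesis vx2_gt0 : forall j, 0 < vx2 j.
Hypothesis hx : white_noise_regressors n delta x vx2.
Hypothesis hZ : conditionally_multinormal X Z (fun w => X w *m beta0) S.
Hypothesis S_psd : psd S.

Definition eps (w : T) : 'cV[R]_n := tuple_col (Z w) - X w *m beta0.

Local Notation G := (mx_events X).

Lemma design_intercept w i (k : 'I_1) : X w i (lshift p k) = 1.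
Proof. by rewrite /design row_mxEl mxE. Qed.

Lemma design_regressor w i j : X w i (rshift 1 j) = x j (site delta i) w.
Proof. by rewrite /design row_mxEr mxE. Qed.

Lemma design_entry_meas i k : measurable_fun [set: T] (fun w => X w i k).
Proof.
case: (split_ordP k) => [k' ->|j ->].
  by under eq_fun do rewrite design_intercept; exact: measurable_cst.
under eq_fun do rewrite design_regressor; exact: measurable_funP.
Qed.

Lemma design_events_meas : G `<=` measurable.
Proof.
move=> _ [i [k [B [mB ->]]]]; rewrite -[X in measurable X]setTI.
exact: design_entry_meas.
Qed.

Lemma design_entry_sub i k :
  measurable_fun [set: g_sigma_algebraType G] (fun w : g_sigma_algebraType G => X w i k).
Proof.
by move=> _ B mB; rewrite setTI; apply: sub_sigma_algebra; exists i, k, B.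
Qed.

Lemma measurable_sum_ord (d' : measure_display) (U : measurableType d') m (f : 'I_m -> U -> R) :
  (forall i, measurable_fun [set: U] (f i)) ->
  measurable_fun [set: U] (fun u => \sum_i f i u).
Proof.
by move=> mf; apply: measurable_sum.
Qed.

Lemma measurable_dot_mulmx (d' : measure_display) (U : measurableType d') m
    (M : U -> 'M[R]_(n, m)) (a : 'cV[R]_n) (b : 'cV[R]_m) :
  (forall i k, measurable_fun [set: U] (fun u => M u i k)) ->
  measurable_fun [set: U] (fun u => dot a (M u *m b)).
Proof.
move=> mM.
have -> : (fun u => dot a (M u *m b)) =
    (fun u => \sum_i \sum_k M u i k * (a i ord0 * b k ord0)).
  by apply/funext => u; rewrite formE.
apply: measurable_sum_ord => i; apply: measurable_sum_ord => k.
by apply: measurable_funM; [exact: mM|exact: measurable_cst].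
Qed.

Lemma eps_form a w : dot a (eps w) =
  \sum_i a i ord0 * tnth (Z w) i - dot a (X w *m beta0).
Proof.
by rewrite /eps dotBr; congr (_ - _); apply: eq_bigr => i _; rewrite mxE.
Qed.

(** Given the design, [a' Z] is normal; subtracting its conditional mean leaves a law that no longer
    depends on the design. *)
Lemma eps_law (a : 'cV[R]_n) E B : <<s G >> E -> measurable B ->
  P (E `&` [set w | B (dot a (eps w))]) =
  (P E * normal_law 0 (dot a (S *m a)) B)%E.
Proof.
have [K [HK Kn]] := hZ.
pose h (z : n.-tuple R) := \sum_i a i ord0 * tnth z i.
pose c (w : g_sigma_algebraType G) := dot a (X w *m beta0).
have mh : measurable_fun [set: n.-tuple R] h.
  apply: measurable_sum_ord => i; apply: measurable_funM; first exact: measurable_cst.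
  exact: measurable_tnth.
have mc : measurable_fun [set: g_sigma_algebraType G] c.
  by apply: measurable_dot_mulmx; exact: design_entry_sub.
move=> GE mB.
have := cond_indep design_events_meas HK mh mc (N := normal_law 0 (dot a (S *m a))) _ GE mB.
under [X in P (_ `&` X)]eq_set do rewrite -eps_form.
apply => w B' mB'.
have mB'' : measurable [set y | B' (y - c w)].
  rewrite -[X in measurable X]setTI.
  by apply: (measurable_funB (@measurable_id _ _ _) (measurable_cst (c w))).
have := Kn w a^T _ mB''.
rewrite trmxK.
have -> : (a^T *m (X w *m beta0)) ord0 ord0 = c w by rewrite dotE.
have -> : (a^T *m S *m a) ord0 ord0 = dot a (S *m a) by rewrite -mulmxA dotE.
rewrite normal_law_shift ?(S_psd.2 a)// => <-.
congr (K w _); apply/seteqP; split=> z /=; rewrite /h;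
  by under [in X in X -> _]eq_bigr do rewrite ?mxE; under [in X in _ -> X]eq_bigr do rewrite ?mxE.
Qed.

Lemma eps_meas a : measurable_fun [set: T] (fun w => dot a (eps w)).
Proof.
under eq_fun do rewrite eps_form.
apply: measurable_funB; last by apply: measurable_dot_mulmx; exact: design_entry_meas.
apply: measurable_sum_ord => i; apply: measurable_funM; first exact: measurable_cst.
have mi : measurable_fun [set: n.-tuple R] (fun z : n.-tuple R => tnth z i).
  exact: measurable_tnth.
exact: (measurableT_comp mi (measurable_funP Z)).
Qed.

Lemma eps_law1 a B : measurable B ->
  P ((fun w => dot a (eps w)) @^-1` B) = normal_law 0 (dot a (S *m a)) B.
Proof.
move=> mB; have GT : <<s G >> [set: T].
  exact: (@measurableT _ (g_sigma_algebraType G)).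
have := eps_law a GT mB.
by rewrite setTI probability_setT mul1e.
Qed.

Lemma eps_lin a : [/\ hasE P (fun w => dot a (eps w)) 0,
  hasE P (fun w => dot a (eps w) ^+ 2) (dot a (S *m a)) &
  hasE P (fun w => dot a (eps w) ^+ 4) (3 * dot a (S *m a) ^+ 2)].
Proof.
apply: law_moments; [exact: eps_meas|exact: S_psd.2|exact: eps_law1].
Qed.

Lemma dot_symD (a b : 'cV[R]_n) : dot (a + b) (S *m (a + b)) =
  dot a (S *m a) + dot b (S *m b) + 2 * dot a (S *m b).
Proof.
by rewrite mulmxDr !dotDl !dotDr (psd_sym b a S_psd.1); ring.
Qed.

Lemma dot_symB (a b : 'cV[R]_n) : dot (a - b) (S *m (a - b)) =
  dot a (S *m a) + dot b (S *m b) - 2 * dot a (S *m b).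
Proof. by rewrite dot_symD !mulmxN !dotNr dotNl; ring. Qed.

(** Polarization, since the normal law is given for single linear forms. *)
Lemma eps_mul a b :
  hasE P (fun w => dot a (eps w) * dot b (eps w)) (dot a (S *m b)).
Proof.
have [_ h1 _] := eps_lin (a + b); have [_ h2 _] := eps_lin (a - b).
have h := hasEZ (4^-1) (hasEB h1 h2).
apply: hasE_eq (hasE_ext _ h); first by rewrite dot_symD dot_symB; field.
by move=> w; rewrite dotDl dotBl; field.
Qed.

(** From [(s + t)^4 + (s - t)^4 = 2 s^4 + 12 s^2 t^2 + 2 t^4]. *)
Lemma eps_mul4 a b :
  hasE P (fun w => dot a (eps w) ^+ 2 * dot b (eps w) ^+ 2)
    (dot a (S *m a) * dot b (S *m b) + 2 * dot a (S *m b) ^+ 2).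
Proof.
have [_ _ h1] := eps_lin (a + b); have [_ _ h2] := eps_lin (a - b).
have [_ _ h3] := eps_lin a; have [_ _ h4] := eps_lin b.
have h := hasEZ (12^-1) (hasEB (hasED h1 h2) (hasEZ 2 (hasED h3 h4))).
apply: hasE_eq (hasE_ext _ h); first by rewrite dot_symD dot_symB; field.
by move=> w; rewrite dotDl dotBl; field.
Qed.

Lemma eps_indep (f : g_sigma_algebraType G -> R) c a :
  measurable_fun [set: g_sigma_algebraType G] f -> hasE P (f : T -> R) c ->
  hasE P (fun w => f w * dot a (eps w) ^+ 2) (c * dot a (S *m a)).
Proof.
move=> mf fc; have [_ h _] := eps_lin a.
apply: (@hasE_indep R d T P _ _ (g_sigma_algebraType G) R (@to_sub _ _ G)
  (fun w => dot a (eps w)) f (fun y => y ^+ 2) c _ _ (eps_meas a) mf _ _ fc h).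
- exact: (measurable_to_sub design_events_meas).
- exact: measurable_funX (@measurable_id _ _ _).
- by move=> E mE B mB; rewrite eps_law1//; exact: eps_law.
Qed.

Lemma xv_eps_mul j i l a b :
  hasE P (fun w => (xv n delta x j w i ord0 * xv n delta x j w l ord0) *
     (dot a (eps w) * dot b (eps w)))
  ((if i == l then vx2 j else 0) * dot a (S *m b)).
Proof.
pose f (w : g_sigma_algebraType G) : R := xv n delta x j w i ord0 * xv n delta x j w l ord0.
have mf : measurable_fun [set: g_sigma_algebraType G] f.
  have -> : f = fun w => X w i (rshift 1 j) * X w l (rshift 1 j).
    by apply/funext => w; rewrite /f !design_regressor [xv _ _ _ _ _ i _]mxE
      [xv _ _ _ _ _ l _]mxE.
  by apply: measurable_funM; exact: design_entry_sub.
have hf : hasE P (f : T -> R) (if i == l then vx2 j else 0).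
  by have := xv_mul n_gt0 vx2_gt0 hx j j i l; rewrite eqxx.
have h := hasEZ (4^-1) (hasEB (eps_indep (a + b) mf hf) (eps_indep (a - b) mf hf)).
apply: hasE_eq (hasE_ext _ h); first by rewrite dot_symD dot_symB; field.
by move=> w; rewrite dotDl dotBl /f; field.
Qed.

Lemma xv_eps_lin m (C : 'M[R]_(n, m)) j (A : 'M[R]_n) : S = C *m C^T ->
  hasE P (fun w => dot (xv n delta x j w) (A *m eps w) ^+ 2)
    (vx2 j * \sum_(c < m) dot (A *m col c C) (A *m col c C)).
Proof.
move=> SC; apply: xv_lin => i l a b; rewrite -SC.
have := xv_eps_mul j i l (delta_mx a ord0) (delta_mx b ord0).
rewrite form_delta; apply: hasE_ext => w.
by rewrite !(dotC (delta_mx _ _)) !dot_delta.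
Qed.

Lemma mul_trmx_col m (H : 'M[R]_(n, m)) k (v : 'cV[R]_n) :
  (H^T *m v) k ord0 = dot (col k H) v.
Proof. by rewrite mxE; apply: eq_bigr => i _; rewrite !mxE. Qed.

Lemma dot_trmx m (H : 'M[R]_(n, m)) (v : 'cV[R]_n) :
  dot (H^T *m v) (H^T *m v) = \sum_k dot (col k H) v ^+ 2.
Proof. by apply: eq_bigr => k _; rewrite mul_trmx_col expr2. Qed.

Lemma congruence_entry m (H : 'M[R]_(n, m)) k l :
  dot (col k H) (S *m col l H) = (H^T *m S *m H) k l.
Proof.
by rewrite -(form_delta (H^T *m S *m H)) -!mulmxA dot_mulmx trmxK -!colE.
Qed.

Lemma eps_quad m (H : 'M[R]_(n, m)) :
  hasE P (fun w => dot (H^T *m eps w) (H^T *m eps w)) (\tr (H^T *m S *m H)).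
Proof.
have h := hasE_sum (index_enum 'I_m) predT (fun k => eps_mul (col k H) (col k H)).
apply: hasE_eq (hasE_ext _ h).
  by apply: eq_bigr => k _; rewrite congruence_entry.
by move=> w; rewrite dot_trmx.
Qed.

(** [eps_mul4] summed over pairs of columns: the products of variances add up to the squared mean,
    and twice the squared Frobenius norm of the covariance of [H' eps] remains. *)
Lemma eps_quad_var m (H : 'M[R]_(n, m)) :
  hasE P (fun w => (dot (H^T *m eps w) (H^T *m eps w) - \tr (H^T *m S *m H)) ^+ 2)
    (2 * \sum_k \sum_l (H^T *m S *m H) k l ^+ 2).
Proof.
set M := H^T *m S *m H.
have h2 := hasE_sum (index_enum 'I_m) predT (fun k =>
  hasE_sum (index_enum 'I_m) predT (fun l => eps_mul4 (col k H) (col l H))).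
have h := hasED (hasEB h2 (hasEZ (2 * \tr M) (eps_quad H))) (hasE_cst P (\tr M ^+ 2)).
apply: hasE_eq (hasE_ext _ h).
  rewrite -/M.
  have -> : \sum_k \sum_l (dot (col k H) (S *m col k H) * dot (col l H) (S *m col l H)
      + 2 * dot (col k H) (S *m col l H) ^+ 2) =
     \tr M ^+ 2 + 2 * \sum_k \sum_l M k l ^+ 2.
    rewrite expr2 {1 2}/mxtrace mulr_suml mulr_sumr -big_split; apply: eq_bigr => k _ /=.
    rewrite mulr_sumr mulr_sumr -big_split; apply: eq_bigr => l _ /=.
    by rewrite !congruence_entry.
  by ring.
move=> w; rewrite dot_trmx.
have -> : \sum_k \sum_l dot (col k H) (eps w) ^+ 2 * dot (col l H) (eps w) ^+ 2 =
   (\sum_k dot (col k H) (eps w) ^+ 2) ^+ 2.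
  rewrite expr2 mulr_suml; apply: eq_bigr => k _.
  by rewrite mulr_sumr.
by ring.
Qed.

Section chain_moments.
Variables (A : 'I_3 -> 'M[R]_n) (j : 'I_p) (m : nat).

(** A chain is built from squares of [x_j' F Y], so their means suffice. The columns of [C] carry
    the second moments of [Y]: a root of the covariance for the errors, one column for a fixed
    vector. *)
Lemma chain_hasE (Y : T -> 'cV[R]_n) (C : 'M[R]_(n, m)) k :
  (forall F : 'M[R]_n, hasE P (fun w => dot (xv n delta x j w) (F *m Y w) ^+ 2)
     (vx2 j * \sum_(c < m) dot (F *m col c C) (F *m col c C))) ->
  forall F : 'M[R]_n, hasE P (fun w => chain A k (xv n delta x j w) (F *m Y w))
    (\sum_(c < m) chain_mean A (vx2 j) k (F *m col c C)).
Proof.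
move=> H; elim: k => [|k IHk] F /=.
  by rewrite big1//; exact: hasE_cst.
set W := \sum_i A i.
have h := hasEZ (3 / 2) (hasED (H (invmx W *m F)) (hasEZ (6^-1)
  (hasE_sum (index_enum 'I_3) predT (fun i => IHk (A i *m (invmx W *m F)))))).
apply: hasE_eq (hasE_ext _ h).
  rewrite -mulr_sumr big_split -mulr_sumr -mulr_sumr; congr (_ * (_ + _ * _)).
    by congr (_ * _); apply: eq_bigr => c _; rewrite !mulmxA.
  by rewrite exchange_big; apply: eq_bigr => c _; apply: eq_bigr => i _; rewrite !mulmxA.
move=> w; congr (_ * (_ + _ * _)); first by rewrite !mulmxA.
by apply: eq_bigr => i _; rewrite !mulmxA.
Qed.

End chain_moments.

End error_moments.

(** * Realizations of the data *)

Section resolvent_grid.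
Context (R : realType).

(** Reference values for the three parts of [I + r Q] after division by the coefficient of the
    identity; the Laplacian is measured in units of [1 / D]. *)
Definition gridA (n M : nat) (D h : R) (g : 'I_M * 'I_M) (i : 'I_3) : 'M[R]_n.+1 :=
  nth 0 [:: 1%:M; (h * g.1%:R / D) *: lap R n; (h * g.2%:R) *: bdry R n] i.

Lemma gridA_psd n M (D h : R) (g : 'I_M * 'I_M) i : 0 < D -> 0 < h ->
  psd (gridA n D h g i).
Proof.
move=> D0 h0; case: i => -[|[|[|//]]] i3; rewrite /gridA/=.
- exact: psd1.
- by apply: psdZ; [rewrite divr_ge0// ?mulr_ge0// ltW|exact: lap_psd].
- by apply: psdZ; [rewrite mulr_ge0// ltW|exact: bdry_psd].
Qed.

Lemma mul_bounds (a b A B : R) : 1 <= A -> 1 <= B -> A^-1 <= a <= A -> B^-1 <= b <= B ->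
  (A * B)^-1 <= a * b <= A * B.
Proof.
move=> A1 B1 /andP[a1 a2] /andP[b1 b2].
have A0 : 0 < A^-1 by rewrite invr_gt0; lra.
have B0 : 0 < B^-1 by rewrite invr_gt0; lra.
by rewrite invfM !ler_pM//; lra.
Qed.

Lemma inv_bounds (a A : R) : 1 <= A -> 1 <= a <= A -> A^-1 <= a^-1 <= A.
Proof.
move=> A1 /andP[a1 a2]; rewrite lef_pV2 ?posrE; [|lra|lra]; rewrite a2/=.
by apply: le_trans A1; rewrite invf_le1; lra.
Qed.

Lemma ratio_bounds (lo hi a b : R) : 0 < lo -> lo <= a <= hi -> lo <= b <= hi ->
  (hi / lo)^-1 <= a / b <= hi / lo.
Proof.
move=> lo0 /andP[a1 a2] /andP[b1 b2].
have b0 : 0 < b by exact: lt_le_trans b1.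
have hi0 : 0 < hi by exact: lt_le_trans b2.
rewrite invf_div; apply/andP; split.
  rewrite ler_pdivlMr// mulrAC ler_pdivrMr//.
  by apply: ler_pM => //; exact: ltW.
rewrite ler_pdivrMr// mulrAC ler_pdivlMr//.
by apply: ler_pM => //; apply: ltW => //; exact: lt_le_trans a1.
Qed.

Lemma scale_grid (u c h g D b r : R) : D != 0 -> u != 0 ->
  r * (b * D) * u^-1 = c * (h * g) -> r * b = u * (c * (h * g / D)).
Proof.
move=> D0 u0 E; have -> : c * (h * g / D) = c * (h * g) / D by rewrite !mulrA.
by rewrite -E; field; rewrite D0.
Qed.

Lemma resolvent_grid (lo hi : R) : 0 < lo -> lo <= hi -> exists h M, 0 < h /\
  forall n (D v s k : R), 0 < D <= 1 -> lo <= v <= hi -> lo <= s <= hi -> lo <= k <= hi ->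
  let rho := expR (- k * D) in
  exists g : 'I_M * 'I_M, forall l (x y : 'cV[R]_n.+1),
    dot x (invmx (1%:M + (v / s) *: prec n (ca rho) (cb rho) (cc rho)) *m y) ^+ 2 <=
    chain (gridA n D h g) l x y + 4^-1 ^+ l * (2 * dot x x * dot y y).
Proof.
move=> lo0 lohi; have [K K1 Kc] := coef_bounds lo0 lohi.
pose L := hi / lo; have L1 : 1 <= L by rewrite /L ler_pdivlMr ?mul1r.
pose Q := 1 + L * K; have Q1 : 1 <= Q by rewrite /Q lerDl mulr_ge0; lra.
have LK1 : 1 <= L * K by rewrite -[1]mulr1 ler_pM.
have [h [M [h0 hM]]] : exists h (M : nat), 0 < h /\ _ := @grid R (L * K * Q) ltac:(rewrite -[1]mulr1 ler_pM//).
exists h, M; split=> // n D v s k D01 hv hs hk rho.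
have [rho01 [a1 a2] [b1 b2] [c1 c2]] := Kc k D hk D01; rewrite -/rho in rho01 a1 a2 b1 b2 c1 c2.
have /andP[D0 D1] := D01.
set r := v / s; have rb : L^-1 <= r <= L by exact: ratio_bounds.
have ca0 := ca_gt0 rho01; have r0 : 0 < r by rewrite divr_gt0//; lra.
(* Dividing by [u1] makes the identity part exact, as [c ord0 = 0] demands. The two other
   coefficients, freed from the scale [1 / D], then lie in a fixed compact interval that the grid
   covers. *)
set u1 := 1 + r * ca rho.
have u1b : Q^-1 <= u1^-1 <= Q.
  apply: inv_bounds => //; apply/andP; split.
    by rewrite /u1 lerDl; apply: mulr_ge0; exact: ltW.
  rewrite /u1 /Q lerD2l; apply: ler_pM; [exact: ltW|exact: ltW|by case/andP: rb|].
  by apply: le_trans a2 _; rewrite ler_piMr//; lra.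
have u10 : 0 < u1 by rewrite /u1 ltr_wpDr//; apply: mulr_ge0; exact: ltW.
have cbD : K^-1 <= cb rho * D <= K.
  apply/andP; split.
    have -> : K^-1 = D^-1 / K * D by field; rewrite !gt_eqF//; exact: lt_le_trans K1.
    by apply: ler_wpM2r => //; exact: ltW.
  by rewrite -ler_pdivlMr.
have ccK : K^-1 <= cc rho * 1 <= K by rewrite mulr1 c1 c2.
have [g1 [d1 [hd1 E1]]] := hM (r * (cb rho * D) * u1^-1)
  (mul_bounds LK1 Q1 (mul_bounds L1 K1 rb cbD) u1b).
have [g2 [d2 [hd2 E2]]] := hM (r * (cc rho * 1) * u1^-1)
  (mul_bounds LK1 Q1 (mul_bounds L1 K1 rb ccK) u1b).
exists (g1, g2) => l x y.
pose c (i : 'I_3) := nth 0 [:: 0; d1; d2] i.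
set A := gridA n D h (g1, g2).
have pA i : psd (A i) by exact: gridA_psd.
have A0 : A ord0 = 1%:M by [].
have c6 i : `|c i| <= 6^-1.
  by case: i => -[|[|[|//]]] i3; rewrite /c//= normr0 invr_ge0.
have c0 : c ord0 = 0 by [].
have WU := W_unit pA A0 c6 c0.
have -> : 1%:M + r *: prec n (ca rho) (cb rho) (cc rho) = u1 *: \sum_i (1 + c i) *: A i.
  rewrite !big_ord_recr big_ord0/= add0r /c/= /A /gridA/= addr0 scale1r.
  rewrite /prec; move: (lap R n) (bdry R n) => F B.
  rewrite !scalerDr !scalerA !addrA.
  congr (_ + _); last congr (_ *: _).
    congr (_ + _); last congr (_ *: _).
      by rewrite !scale_scalar_mx mulr1 [RHS]raddfD.
    by rewrite -mulrA; apply: scale_grid E1; rewrite gt_eqF.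
  have := scale_grid (oner_neq0 R) _ E2; rewrite divr1 -mulrA; apply.
  by rewrite gt_eqF.
have u1U : u1 \is a GRing.unit by rewrite unitfE gt_eqF.
rewrite invmxZ ?unitmxZ// -scalemxAl dotZr exprMn.
have h1 := chain_bound pA A0 c6 c0 l x y.
have u11 : u1^-1 ^+ 2 <= 1.
  rewrite exprn_ile1 ?invr_ge0//; first exact: ltW.
  by rewrite invf_le1// /u1 lerDl; apply: mulr_ge0; exact: ltW.
apply: le_trans (_ : dot x (invmx (\sum_i (1 + c i) *: A i) *m y) ^+ 2 <= _).
  by rewrite ler_piMl ?sqr_ge0.
apply: le_trans h1 _; rewrite lerD2l ler_wpM2l ?exprn_ge0 ?invr_ge0//.
rewrite ler_wpM2l ?mulr_ge0 ?dot_ge0// (WbE A0).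
by apply: inv_le1; exact: Wb_psd.
Qed.

End resolvent_grid.

(** * Deterministic conditions on a realization *)

Section good_realizations.
Context (R : realType) (p : nat) (vx : 'I_p -> R).

Definition lin N (X : 'I_p -> 'cV[R]_N) (b : 'I_p -> R) : 'cV[R]_N := \sum_j b j *: X j.

Lemma dot_lin N (X : 'I_p -> 'cV[R]_N) (b : 'I_p -> R) (f : 'cV[R]_N) :
  dot (lin X b) f = \sum_j b j * dot (X j) f.
Proof. by rewrite dot_suml; apply: eq_bigr => j _; rewrite dotZl. Qed.

(** All that the comparison of likelihoods requires of the data. Index pairs form one finite type,
    ready for a union bound. The chains have depth [N.+1] to make their remainders negligible; the
    last field is bounded without the factor [n] because the vector of the two ends has bounded
    norm. *)
Record good N (m M : nat) (eta K D h rho0 s0 v0 : R) (X : 'I_p -> 'cV[R]_N.+1)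
    (e : 'cV[R]_N.+1) : Prop := Good {
  good_gram : forall jk : 'I_p * 'I_p,
    `|dot (X jk.1) (X jk.2) - (jk.1 == jk.2)%:R * (N.+1%:R * vx jk.1)| <= eta * N.+1%:R;
  good_rough : forall j, dot (X j) ((1%:M - refsm R N m) *m X j) <= eta * N.+1%:R;
  good_cross : forall j, dot (X j) e ^+ 2 <= K * N.+1%:R;
  good_smooth_cross : forall j, dot (X j) (refsm R N m *m e) ^+ 2 <= K * N.+1%:R;
  good_smooth_err : N.+1%:R * (v0 - eta) <= dot e (refsm R N m *m e);
  good_err_form : qf rho0 s0 v0 e <= N.+1%:R * (1 + eta);
  good_err_norm : dot e e <= K * N.+1%:R;
  good_chain_err : forall jg : 'I_p * ('I_M * 'I_M),
    chain (gridA N D h jg.2) N.+1 (X jg.1) e <= K * N.+1%:R;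
  good_chain_ones : forall jg : 'I_p * ('I_M * 'I_M),
    chain (gridA N D h jg.2) N.+1 (X jg.1) (ones R N) <= K * N.+1%:R;
  good_chain_ends : forall jg : 'I_p * ('I_M * 'I_M),
    chain (gridA N D h jg.2) N.+1 (X jg.1) (ev R N 0 + ev R N N) <= K }.

Section consequences.
Variables (N m M : nat) (eta K D h rho0 s0 v0 : R) (X : 'I_p -> 'cV[R]_N.+1)
  (e : 'cV[R]_N.+1).
Hypothesis eta0 : 0 < eta.
Hypothesis K0 : 0 < K.
Hypothesis G : good m M eta K D h rho0 s0 v0 X e.
Local Notation n := (N.+1%:R : R).
Local Notation S := (refsm R N m).

Let n0 : 0 < n. Proof. by rewrite ltr0n. Qed.

Lemma rough_psd : psd (1%:M - S).
Proof.
split=> [|u]; first by rewrite linearB/= trmx1 (refsm_psd R N m).1.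
by rewrite mulmxBl mul1mx dotBr subr_ge0; exact: refsm_le1.
Qed.

(** [I - S] is nonnegative and small on every regressor; Cauchy-Schwarz extends this to pairs. *)
Lemma gram_smooth j k :
  `|dot (X j) (S *m X k) - (j == k)%:R * (n * vx j)| <= 2 * eta * n.
Proof.
have -> : S *m X k = X k - (1%:M - S) *m X k by rewrite mulmxBl mul1mx subKr.
rewrite dotBr addrAC; apply: le_trans (ler_normB _ _) _.
rewrite -mulrA mulr2n mulrDl mul1r lerD//; first exact: (good_gram G (j, k)).
rewrite -(@ler_pXn2r _ 2)// ?nnegrE//; last by apply: mulr_ge0; exact: ltW.
rewrite real_normK ?num_real//; apply: le_trans (psd_CS _ _ rough_psd) _.
by rewrite expr2 ler_pM//; [exact: rough_psd.2|exact: rough_psd.2|exact: good_rough G j|exact: good_rough G k].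
Qed.

Lemma gram_lower (b : 'I_p -> R) :
  n * \sum_j b j ^+ 2 * (vx j - 4 * p%:R * eta) <= dot (lin X b) (S *m lin X b).
Proof.
have -> : dot (lin X b) (S *m lin X b) =
    \sum_j \sum_k b j * b k * dot (X j) (S *m X k).
  rewrite dot_lin; apply: eq_bigr => j _.
  rewrite mulmx_sumr dot_sumr mulr_sumr; apply: eq_bigr => k _.
  by rewrite -scalemxAr dotZr; ring.
apply: (@le_trans _ _ (\sum_j \sum_k ((if j == k then n * (b j ^+ 2 * vx j) else 0)
   - eta * n * (b j ^+ 2 + b k ^+ 2) * 1))).
  have -> : \sum_j \sum_k ((if j == k then n * (b j ^+ 2 * vx j) else 0)
      - eta * n * (b j ^+ 2 + b k ^+ 2) * 1) =
    \sum_j n * (b j ^+ 2 * vx j) - eta * n * (2 * p%:R * \sum_j b j ^+ 2).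
    transitivity (\sum_j (n * (b j ^+ 2 * vx j) -
        eta * n * (p%:R * b j ^+ 2 + \sum_k b k ^+ 2))).
      apply: eq_bigr => j _; rewrite sumrB; congr (_ - _).
        by rewrite -big_mkcond (big_pred1 j)// => k; rewrite eq_sym.
      rewrite -mulr_suml mulr1 -mulr_sumr big_split/= sumr_const card_ord.
      by rewrite mulr_natl.
    rewrite sumrB; congr (_ - _); rewrite -mulr_sumr big_split/= -mulr_sumr sumr_const card_ord.
    by congr (_ * _); rewrite -[X in _ + X]mulr_natl; ring.
  rewrite -mulr_sumr; set A := \sum_j b j ^+ 2 * vx j; set B := \sum_j b j ^+ 2.
  have -> : \sum_j b j ^+ 2 * (vx j - 4 * p%:R * eta) = A - 4 * p%:R * eta * B.
    by rewrite mulr_sumr -sumrB; apply: eq_bigr => j _; ring.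
  have aux (a P E B' nn : R) : 0 <= P * E * B' * nn ->
     nn * (a - 4 * P * E * B') <= nn * a - E * nn * (2 * P * B') by lra.
  apply: aux; rewrite !mulr_ge0//; [exact: ltW|].
  by apply: sumr_ge0 => j _; exact: sqr_ge0.
apply: ler_sum => j _; apply: ler_sum => k _; rewrite mulr1.
have := gram_smooth j k; set g := dot _ _.
have aux (x y z E : R) : `|g - z| <= 2 * E -> x * y * z - E * (x ^+ 2 + y ^+ 2) <= x * y * g.
  rewrite ler_norml => /andP[h1 h2].
  have k1 := sqr_ge0 (x - y); have k2 := sqr_ge0 (x + y).
  have [xy|xy] := leP 0 (x * y).
    have : x * y * (- (2 * E)) <= x * y * (g - z) by rewrite ler_wpM2l.
    have E0 : 0 <= E by lra.
    have : 0 <= E * (x - y) ^+ 2 by rewrite mulr_ge0.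
    rewrite !expr2; lra.
  have : x * y * (2 * E) <= x * y * (g - z) by rewrite ler_wnM2l// ltW.
  have E0 : 0 <= E by lra.
  have : 0 <= E * (x + y) ^+ 2 by rewrite mulr_ge0.
  rewrite !expr2; lra.
rewrite -mulrA => /(aux (b j) (b k)); apply: le_trans; rewrite lerD2r.
by case: eqVneq => [->|_]; rewrite ?mul0r ?mulr0 ?mul1r// expr2; lra.
Qed.

Lemma smooth_shift (f : 'cV[R]_N.+1) c :
  dot (f + c *: ones R N) (S *m (f + c *: ones R N)) = dot f (S *m f).
Proof.
rewrite mulmxDr -scalemxAr refsm_ones scaler0 addr0 dotDl dotZl.
by rewrite (psd_sym _ _ (refsm_psd R N m).1) refsm_ones dot0r mulr0 addr0.
Qed.

(** The cross terms are absorbed through [2 b g >= - n eta b^2 - g^2 / (n eta)] with [g^2 <= K n],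
    at the price of a bounded term. *)
Lemma err_lower (b : 'I_p -> R) :
  n * (v0 - eta) + n * \sum_j b j ^+ 2 * (vx j - (4 * p%:R + 1) * eta) - p%:R * (K / eta)
  <= dot (e + lin X b) (S *m (e + lin X b)).
Proof.
have h1 := good_smooth_err G; have h2 := gram_lower b.
have -> : dot (e + lin X b) (S *m (e + lin X b)) =
    dot e (S *m e) + \sum_j 2 * (b j * dot (X j) (S *m e)) + dot (lin X b) (S *m lin X b).
  rewrite mulmxDr !dotDl !dotDr (psd_sym e (lin X b) (refsm_psd R N m).1).
  by rewrite dot_lin -mulr_sumr; ring.
have h3 : - (n * \sum_j b j ^+ 2 * eta) - p%:R * (K / eta) <=
    \sum_j 2 * (b j * dot (X j) (S *m e)).
  have -> : - (n * \sum_j b j ^+ 2 * eta) - p%:R * (K / eta) =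
     \sum_j (- (n * (b j ^+ 2 * eta)) - K / eta).
    by rewrite sumrB sumrN mulr_sumr sumr_const card_ord mulr_natl.
  apply: ler_sum => j _; have := good_smooth_cross G j.
  set g := dot _ _ => hg.
  have aux (x E k nn gg : R) : 0 < E -> 0 < nn -> gg ^+ 2 <= k * nn ->
      - (nn * (x ^+ 2 * E)) - k / E <= 2 * (x * gg).
    move=> E0 nn0 H.
    have : 0 <= (nn * E * x + gg) ^+ 2 / (nn * E).
      by rewrite divr_ge0 ?sqr_ge0//; apply: mulr_ge0; exact: ltW.
    have -> : (nn * E * x + gg) ^+ 2 / (nn * E) =
       nn * (x ^+ 2 * E) + 2 * (x * gg) + gg ^+ 2 / (nn * E).
      by field; rewrite !gt_eqF.
    have : gg ^+ 2 / (nn * E) <= k / E.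
      rewrite ler_pdivrMr ?mulr_gt0//.
      by have -> : k / E * (nn * E) = k * nn by field; rewrite gt_eqF.
    lra.
  exact: aux.
have -> : \sum_j b j ^+ 2 * (vx j - (4 * p%:R + 1) * eta) =
    \sum_j b j ^+ 2 * (vx j - 4 * p%:R * eta) - \sum_j b j ^+ 2 * eta.
  by rewrite -sumrB; apply: eq_bigr => j _; ring.
rewrite mulrBr; lra.
Qed.

(** The contributions of the other regressors are nonnegative and dropped; the smoother does not see
    the intercept. *)
Lemma err_lower_missing (b : 'I_p -> R) c j0 :
  (forall j, (4 * p%:R + 1) * eta <= vx j / 2) -> p%:R * (K / eta) <= eta * n ->
  n * (v0 - 2 * eta + b j0 ^+ 2 * vx j0 / 2) <=
  dot (e + lin X b + c *: ones R N) (S *m (e + lin X b + c *: ones R N)).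
Proof.
move=> he hn; rewrite smooth_shift; apply: le_trans (err_lower b).
have : b j0 ^+ 2 * vx j0 / 2 <= \sum_j b j ^+ 2 * (vx j - (4 * p%:R + 1) * eta).
  rewrite (bigD1 j0)//=; apply: ler_wpDr.
    apply: sumr_ge0 => j _; rewrite mulr_ge0 ?sqr_ge0//.
    by have := he j; have : 0 < (4 * p%:R + 1) * eta; [rewrite mulr_gt0// ltr_wpDl|lra].
  rewrite -mulrA ler_wpM2l ?sqr_ge0//; have := he j0; lra.
move/(ler_wpM2l (ltW n0)); lra.
Qed.

End consequences.
End good_realizations.

(** * Overfitted models *)

Section overfit.
Context (R : realType).

(* Projecting [e] off [o] for the form [W] leaves it almost orthogonal to the
   [X j], so adding the latter to the regression gains only a bounded amount. *)
Lemma projection_gain p N (W : 'M[R]_N) (X : 'I_p -> 'cV[R]_N) (o e : 'cV[R]_N)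
    (n A B C c1 : R) : psd W -> 0 < n -> 0 < c1 -> 0 < dot o (W *m o) -> 0 <= C ->
  (forall j, dot (X j) (W *m e) ^+ 2 <= A * n) ->
  dot o (W *m e) ^+ 2 <= B * n * dot o (W *m o) ->
  (forall j, dot (X j) (W *m o) ^+ 2 <= C * dot o (W *m o)) ->
  (forall c b, c1 * n * (\sum_j b j ^+ 2) <=
     dot (c *: o + lin X b) (W *m (c *: o + lin X b))) ->
  forall c0 b, exists c, dot (e - c *: o) (W *m (e - c *: o)) <=
    dot (e - c0 *: o - lin X b) (W *m (e - c0 *: o - lin X b)) +
    p%:R * ((2 * A + 2 * (B * C)) / c1).
Proof.
move=> pW n0 c10 q0 C0 hA hB hC hq c0 b.
(* The coefficient of [e] regressed on [o] alone: the residual [f] is orthogonal to [o], and the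
   intercept drops out of [dot g (W *m f)]. *)
pose k := dot o (W *m e) / dot o (W *m o); exists k.
have kE : k * dot o (W *m o) = dot o (W *m e) by rewrite /k divfK ?gt_eqF.
have := hB; rewrite -kE => {}hB; clearbody k.
set f := e - k *: o; set g := (c0 - k) *: o + lin X b.
have -> : e - c0 *: o - lin X b = f - g.
  by rewrite /f /g scalerBl opprD opprB !addrA subrK.
have of0 : dot o (W *m f) = 0.
  by rewrite /f mulmxBr -scalemxAr dotBr dotZr kE subrr.
have -> : dot (f - g) (W *m (f - g)) =
    dot f (W *m f) - 2 * dot g (W *m f) + dot g (W *m g).
  by rewrite mulmxBr dotBl 2!dotBr (psd_sym f g pW.1); ring.
have gf : dot g (W *m f) = \sum_j b j * dot (X j) (W *m f).
  by rewrite /g dotDl dotZl of0 mulr0 add0r dot_lin.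
have h1 := hq (c0 - k) b; rewrite -/g in h1.
(* By [2 x y <= c1 n x^2 + y^2 / (c1 n)], summed over the regressors; the quadratic part is paid for
   by [hq]. *)
have h2 : 2 * dot g (W *m f) <=
    c1 * n * (\sum_j b j ^+ 2) + p%:R * ((2 * A + 2 * (B * C)) / c1).
  rewrite gf mulr_sumr mulr_sumr.
  have -> : p%:R * ((2 * A + 2 * (B * C)) / c1) = \sum_(j < p) ((2 * A + 2 * (B * C)) / c1).
    by rewrite sumr_const card_ord mulr_natl.
  rewrite -big_split; apply: ler_sum => j _ /=.
  have E : dot (X j) (W *m f) = dot (X j) (W *m e) - k * dot (X j) (W *m o).
    by rewrite /f mulmxBr -scalemxAr dotBr dotZr.
  have {}hA := hA j; have {}hC := hC j.
  have H : dot (X j) (W *m f) ^+ 2 <= (2 * A + 2 * (B * C)) * n.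
    rewrite E; move: hA hB hC q0.
    set x := dot (X j) (W *m e); set y := dot (X j) (W *m o); set q := dot o (W *m o).
    have aux (x' y' q' k' : R) : x' ^+ 2 <= A * n -> (k' * q') ^+ 2 <= B * n * q' ->
        y' ^+ 2 <= C * q' -> 0 < q' ->
        (x' - k' * y') ^+ 2 <= (2 * A + 2 * (B * C)) * n.
      move=> a1 a2 a3 a4.
      have a5 : k' ^+ 2 * q' <= B * n.
        by rewrite -(ler_pM2r a4) -mulrA -[q' * q']expr2 -exprMn.
      have a6 : k' ^+ 2 * y' ^+ 2 <= C * (B * n).
        apply: (@le_trans _ _ (k' ^+ 2 * (C * q'))); first by rewrite ler_wpM2l ?sqr_ge0.
        by rewrite mulrCA ler_wpM2l.
      have := sqr_ge0 (x' + k' * y').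
      have -> : (x' + k' * y') ^+ 2 = 2 * x' ^+ 2 + 2 * (k' ^+ 2 * y' ^+ 2) - (x' - k' * y') ^+ 2.
        by ring.
      lra.
    exact: aux.
  move: H; set y := dot _ _; set C4 := 2 * A + _.
  have aux (x c y' C4' : R) : 0 < c -> y' ^+ 2 <= C4' * n ->
      2 * (x * y') <= c * n * x ^+ 2 + C4' / c.
    move=> c0' H.
    have : 0 <= (c * n * x - y') ^+ 2 / (c * n).
      by rewrite divr_ge0 ?sqr_ge0//; apply: mulr_ge0; exact: ltW.
    have -> : (c * n * x - y') ^+ 2 / (c * n) =
       c * n * x ^+ 2 - 2 * (x * y') + y' ^+ 2 / (c * n).
      by field; rewrite !gt_eqF.
    have : y' ^+ 2 / (c * n) <= C4' / c.
      rewrite ler_pdivrMr ?mulr_gt0//.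
      by have -> : C4' / c * (c * n) = C4' * n by field; rewrite gt_eqF.
    lra.
  exact: aux.
lra.
Qed.

Lemma pow4_le (n : nat) : 4^-1 ^+ n * n%:R <= 1 :> R.
Proof.
have h : (n%:R : R) <= 4 ^+ n.
  elim: n => [|n IHn]; first by rewrite expr0.
  by rewrite exprS -natr1; have : 1 <= 4 ^+ n :> R by [rewrite exprn_ege1//; lra]; lra.
by rewrite exprVn mulrC ler_pdivrMr ?mul1r// exprn_gt0.
Qed.

(** The conclusion of [resolvent_grid] for fixed [h] and [M], named so that it can serve as a
    hypothesis. *)
Definition resolvent_bounds (lo hi h : R) (M : nat) :=
  forall n (D v s k : R), 0 < D <= 1 -> lo <= v <= hi -> lo <= s <= hi -> lo <= k <= hi ->
  let rho := expR (- k * D) in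
  exists g : 'I_M * 'I_M, forall l (x y : 'cV[R]_n.+1),
    dot x (invmx (1%:M + (v / s) *: prec n (ca rho) (cb rho) (cc rho)) *m y) ^+ 2 <=
    chain (gridA n D h g) l x y + 4^-1 ^+ l * (2 * dot x x * dot y y).

Definition coefficient_bounds (lo hi K : R) :=
  forall k D : R, lo <= k <= hi -> 0 < D <= 1 ->
  let rho := expR (- k * D) in
  [/\ 0 < rho < 1, D / K <= ca rho /\ ca rho <= K * D,
      D^-1 / K <= cb rho /\ cb rho <= K / D & K^-1 <= cc rho /\ cc rho <= K].

Section uniform.
Variables (p : nat) (vx : 'I_p -> R) (lo hi Kc h vmin V eta K : R) (M : nat).
Hypothesis lo0 : 0 < lo.
Hypothesis Kc1 : 1 <= Kc.
Hypothesis HR : resolvent_bounds lo hi h M.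
Hypothesis HC : coefficient_bounds lo hi Kc.
Hypothesis vmin0 : 0 < vmin.
Hypothesis vxb : forall j, vmin <= vx j <= V.
Hypothesis eta0 : 0 < eta.
Hypothesis K0 : 0 < K.

Section fixed_size.
Variables (N m : nat) (D rho0 s0 v0 v s k : R) (X : 'I_p -> 'cV[R]_N.+1) (e : 'cV[R]_N.+1).
Hypothesis D01 : 0 < D <= 1.
Hypothesis hv : lo <= v <= hi.
Hypothesis hs : lo <= s <= hi.
Hypothesis hk : lo <= k <= hi.
Hypothesis G : good vx m M eta K D h rho0 s0 v0 X e.
Local Notation n := (N.+1%:R : R).
Local Notation rho := (expR (- k * D)).
Local Notation W := (invmx (sig N rho s v)).
Local Notation res := (invmx (1%:M + (v / s) *: prec N (ca rho) (cb rho) (cc rho))).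

Let v0' : 0 < v. Proof. by apply: lt_le_trans lo0 _; case/andP: hv. Qed.
Let s0' : 0 < s. Proof. by apply: lt_le_trans lo0 _; case/andP: hs. Qed.
Let rho01 : 0 < rho < 1. Proof. by case: (HC hk D01). Qed.
Let n0 : 0 < n. Proof. by rewrite ltr0n. Qed.
Let n1 : 1 <= n. Proof. by rewrite ler1n. Qed.

Lemma regressor_norm j : dot (X j) (X j) <= (V + eta) * n.
Proof.
have := good_gram G (j, j); rewrite /= eqxx mul1r ler_norml => /andP[_].
have /andP[_ hV] := vxb j; have := ler_wpM2l (ltW n0) hV; lra.
Qed.

(** The grid point depends on the parameter, but the chains are bounded at all of them. The
    remainder [4^-n] cancels the squared norm of the regressor, of order [n]. *)
Lemma res_bound j (y : 'cV[R]_N.+1) (B Y : R) :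
  (forall g : 'I_M * 'I_M, chain (gridA N D h g) N.+1 (X j) y <= B) -> dot y y <= Y ->
  dot (X j) (res *m y) ^+ 2 <= B + 2 * (V + eta) * Y.
Proof.
move=> hB hY; have [g hg] := HR N D01 hv hs hk.
apply: le_trans (hg N.+1 (X j) y) _; apply: lerD; first exact: hB.
have aux (q x y' V' : R) : 0 <= q -> q * n <= 1 -> 0 <= x -> 0 <= y' -> x <= V' * n ->
    y' <= Y -> q * (2 * x * y') <= 2 * V' * Y.
  move=> q0 qn x0 y0 xV yY.
  have V0 : 0 <= V' by rewrite -(pmulr_lge0 _ n0); exact: le_trans xV.
  have h1 : x * y' <= V' * n * Y by rewrite ler_pM.
  have h2 : q * (x * y') <= q * (V' * n * Y) by rewrite ler_wpM2l.
  have h3 : q * n * (V' * Y) <= 1 * (V' * Y).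
    by rewrite ler_wpM2r// mulr_ge0//; exact: le_trans yY.
  have -> : q * (2 * x * y') = 2 * (q * (x * y')) by ring.
  have : q * (V' * n * Y) = q * n * (V' * Y) by ring.
  lra.
apply: aux => //.
- exact: pow4_le.
- exact: dot_ge0.
- exact: dot_ge0.
- exact: regressor_norm.
Qed.

(** [v Sigma^-1] is the identity minus the resolvent: the first part is [good_cross], the second is
    bounded by chains. *)
Lemma cross_err j :
  dot (X j) (W *m e) ^+ 2 <= lo^-1 ^+ 2 * (2 * K + 2 * (K + 2 * (V + eta) * K)) * n.
Proof.
rewrite sig_inv// -scalemxAl dotZr exprMn /smooth mulmxBl mul1mx dotBr.
have h1 := good_cross G j.
have h2 := @res_bound j e _ _ (fun g => good_chain_err G (j, g)) (good_err_norm G).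
rewrite -mulrA; apply: ler_pM; rewrite ?sqr_ge0//.
  rewrite ler_pXn2r ?nnegrE ?invr_ge0 ?(ltW v0')// ?(ltW lo0)//.
  by rewrite lef_pV2 ?posrE//; case/andP: hv.
move: h1 h2; set x := dot _ _; set y := dot _ _ => h1 h2.
have := sqr_ge0 (x + y).
have -> : (x + y) ^+ 2 = 2 * x ^+ 2 + 2 * y ^+ 2 - (x - y) ^+ 2 by ring.
have : K * n + 2 * (V + eta) * (K * n) = (K + 2 * (V + eta) * K) * n by ring.
lra.
Qed.

Lemma ca_le1 : ca rho <= 1.
Proof.
have /andP[r0 r1] := rho01; rewrite /ca ler_pdivrMr; [|lra]; lra.
Qed.

(** By [sig_inv_ones] the two contributions have squares of orders [ca^2 n] and [1], exactly the two
    lower bounds available for [1' Sigma^-1 1]. *)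
Lemma cross_ones j : dot (X j) (W *m ones R N) ^+ 2 <=
  lo^-1 ^+ 2 * (4 * hi * (K + 2 * (V + eta) + Kc ^+ 2 * (K + 8 * (V + eta)))) *
  qf rho s v (ones R N).
Proof.
rewrite sig_inv_ones// dotZr exprMn -[X in _ <= X]mulrA.
apply: ler_pM; rewrite ?sqr_ge0//.
  rewrite ler_pXn2r ?nnegrE ?invr_ge0 ?(ltW s0')// ?(ltW lo0)//.
  by rewrite lef_pV2 ?posrE//; case/andP: hs.
rewrite mulmxDr -!scalemxAr dotDr !dotZr.
have o1 : dot (ones R N) (ones R N) <= n by rewrite dot_ones.
have h1 := @res_bound j _ _ _ (fun g => good_chain_ones G (j, g)) o1.
have o2 : dot (ev R N 0 + ev R N N) (ev R N 0 + ev R N N) <= 4.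
  have ev1 (i : 'I_N.+1) : dot (ev R N i) (ev R N i) = 1.
    by rewrite dot_ev mxE eqxx.
  have := psd_parallelogram (ev R N 0) (ev R N N) (psd1 R N.+1).
  by rewrite !mul1mx (ev1 ord0) (ev1 ord_max); lra.
have h2 := @res_bound j _ _ _ (fun g => good_chain_ends G (j, g)) o2.
have q1 := qf_ones_ge1 N rho01 s0' v0'; have q2 := @qf_ones_ge2 R N rho s v rho01 s0' v0' ca_le1.
have sv0 : 0 < s + v by rewrite addr_gt0.
have sv : s + v <= 2 * hi by case/andP: hv; case/andP: hs; lra.
have cK : cc rho <= Kc by case: (HC hk D01) => _ _ _ [].
have c0 := cc_gt0 rho01; have a0 := ca_gt0 rho01.
move: h1 h2 q1 q2 c0 cK a0.
set x := dot _ _; set y := dot _ _; set q := qf _ _ _ _; set a := ca _; set c := cc _.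
have V0 : 0 <= V + eta.
  by rewrite -(pmulr_lge0 _ n0); apply: le_trans (regressor_norm j); exact: dot_ge0.
move: sv0 sv V0; move: (V + eta) (s + v) => V' sv sv0 hsv V0 h1 h2 q1 q2 c0 cK a0.
move: (lt_le_trans lo0 (le_trans (andP hv).1 (andP hv).2)) => hi0.
have q0 : 0 < q by rewrite -(pmulr_lgt0 _ sv0); exact: lt_le_trans q1.
have {q1 q2} [q1 q2] : 1 <= q * (2 * hi) /\ n * a ^+ 2 <= q * (2 * hi).
  by split; [apply: le_trans q1 _|apply: le_trans q2 _]; rewrite ler_pM2l.
have a2 : a ^+ 2 * x ^+ 2 <= (K + 2 * V') * (q * (2 * hi)).
  apply: (@le_trans _ _ (a ^+ 2 * ((K + 2 * V') * n))).
    by rewrite ler_wpM2l ?sqr_ge0// [(K + _) * _]mulrDl.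
  have -> : a ^+ 2 * ((K + 2 * V') * n) = (K + 2 * V') * (n * a ^+ 2) by ring.
  by rewrite ler_wpM2l// addr_ge0 ?mulr_ge0// ltW.
have c2 : c ^+ 2 * y ^+ 2 <= Kc ^+ 2 * (K + 8 * V') * (q * (2 * hi)).
  have KV : 0 <= K + 8 * V' by rewrite addr_ge0 ?mulr_ge0// ltW.
  apply: (@le_trans _ _ (Kc ^+ 2 * (K + 8 * V'))).
    apply: ler_pM; rewrite ?sqr_ge0//; last by apply: le_trans h2 _; rewrite lerD2l mulrAC -natrM.
    by rewrite ler_pXn2r// nnegrE ltW//; exact: lt_le_trans cK.
  by rewrite ler_peMr// mulr_ge0// sqr_ge0.
have aux (a' x' c' y' P Q q' : R) : a' ^+ 2 * x' ^+ 2 <= P * q' ->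
    c' ^+ 2 * y' ^+ 2 <= Q * q' -> (a' * x' + c' * y') ^+ 2 <= 2 * ((P + Q) * q').
  move=> i1 i2; have := sqr_ge0 (a' * x' - c' * y').
  have -> : (a' * x' - c' * y') ^+ 2 =
     2 * (a' ^+ 2 * x' ^+ 2) + 2 * (c' ^+ 2 * y' ^+ 2) - (a' * x' + c' * y') ^+ 2 by ring.
  lra.
apply: le_trans (aux _ _ _ _ _ _ _ a2 c2) _.
rewrite le_eqVlt; apply/orP; left; apply/eqP; ring.
Qed.

Hypothesis m0 : (0 < m)%N.
Hypothesis hm : (v / s * cb rho / m%:R ^+ 2)^-1 <= 1.
Hypothesis heta : 4 * p%:R * eta <= vmin / 2.

Lemma hi_gt0 : 0 < hi.
Proof. by apply: lt_le_trans v0' _; case/andP: hv. Qed.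

(** After [qf_lower] the smoother removes the intercept, leaving the Gram form of the regressors. *)
Lemma qf_regression_ge c b : vmin / (4 * hi) * n * (\sum_j b j ^+ 2) <=
  dot (c *: ones R N + lin X b) (W *m (c *: ones R N + lin X b)).
Proof.
rewrite addrC -/(qf rho s v _).
have h1 := @qf_lower R N rho s v rho01 s0' v0' m (lin X b + c *: ones R N) m0.
rewrite smooth_shift in h1.
have h2 := gram_lower eta0 G b.
have h3 : vmin / 2 * (\sum_j b j ^+ 2) <= \sum_j b j ^+ 2 * (vx j - 4 * p%:R * eta).
  rewrite mulr_sumr; apply: ler_sum => j _; rewrite mulrC ler_wpM2l ?sqr_ge0//.
  have /andP[a _] := vxb j.
  have aux (x y z : R) : x <= y -> z <= x / 2 -> x / 2 <= y - z by lra.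
  exact: aux a heta.
have := ler_wpM2l (ltW n0) h3; move: h1 h2 hm.
set B := \sum_j b j ^+ 2; set q := qf _ _ _ _; set u := _^-1.
set B' := \sum_j _ => h1 h2 h4 h5.
have q0 : 0 <= q by exact: (qf_psd N rho01 s0' v0').2.
have h6 : (1 + u) * (v * q) <= 2 * (hi * q).
  apply: ler_pM; [|by rewrite mulr_ge0// ltW| |by rewrite ler_wpM2r//; case/andP: hv].
    rewrite addr_ge0// invr_ge0; apply: divr_ge0; last by rewrite exprn_ge0.
    apply: mulr_ge0; last exact: ltW (cb_gt0 rho01).
    by apply: divr_ge0; exact: ltW.
  by rewrite -[2]/(1 + 1) lerD2l.
have h7 : n * (vmin / 2 * B) <= 2 * (hi * q).
  by apply: le_trans h5 _; apply: le_trans h2 _; apply: le_trans h1 h6.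
have hi0 := hi_gt0.
have -> : vmin / (4 * hi) * n * B = n * (vmin / 2 * B) / (2 * hi) by field; rewrite gt_eqF.
by rewrite ler_pdivrMr ?mulr_gt0// [q * _]mulrC -[2 * hi * q]mulrA.
Qed.

Variable k0 : R.
Hypothesis hv0 : lo <= v0 <= hi.
Hypothesis hs0 : lo <= s0 <= hi.
Hypothesis hk0 : lo <= k0 <= hi.
Hypothesis rho0E : rho0 = expR (- k0 * D).

Lemma qf_true_compare (f : 'cV[R]_N.+1) : qf rho s v f <= (Kc ^+ 2 * (hi / lo)) ^+ 2 * qf rho0 s0 v0 f.
Proof.
have [r0 [a1 a2] [b1 b2] [c1 c2]] := HC hk0 D01; rewrite -rho0E in r0 a1 a2 b1 b2 c1 c2.
have [r1 [a1' a2'] [b1' b2'] [c1' c2']] := HC hk D01.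
have lohi : lo <= hi by case/andP: hv => ?; exact: le_trans.
have L1 : 1 <= hi / lo by rewrite ler_pdivlMr ?mul1r.
have /andP[D0 _] := D01.
have v00 : 0 < v0 by apply: lt_le_trans lo0 _; case/andP: hv0.
have s00 : 0 < s0 by apply: lt_le_trans lo0 _; case/andP: hs0.
have Kc0 : 0 < Kc by exact: lt_le_trans Kc1.
have K1 : 1 <= Kc ^+ 2 by rewrite exprn_ege1.
have key (z y w : R) : 0 <= z -> z <= Kc * w -> w / Kc <= y ->
    z <= Kc ^+ 2 * (hi / lo) * y.
  move=> z0 h1 h2.
  have h3 : z <= Kc ^+ 2 * y.
    apply: le_trans h1 _; rewrite expr2 -mulrA ler_pM2l// mulrC.
    by rewrite -ler_pdivrMr.
  have h4 := le_trans z0 h3.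
  by rewrite mulrAC; apply: (le_trans h3); rewrite ler_peMr.
have inv (z y : R) : lo <= z <= hi -> lo <= y <= hi -> z^-1 <= Kc ^+ 2 * (hi / lo) / y.
  move=> hz hy; have y0 : 0 < y by apply: lt_le_trans lo0 _; case/andP: hy.
  rewrite ler_pdivlMr// mulrC.
  have /andP[_ b3] := ratio_bounds lo0 hy hz; apply: (le_trans b3).
  by rewrite ler_peMl// (le_trans _ L1).
apply: qf_compare => //.
- by rewrite -[1]mulr1 ler_pM.
- by apply: key a2' a1; exact: ltW (ca_gt0 _).
- by apply: key b2' b1; exact: ltW (cb_gt0 _).
- by apply: (key _ _ 1); rewrite ?mulr1 ?mul1r//; exact: ltW (cc_gt0 _).
- exact: inv.
- exact: inv.
Qed.

(** Cauchy-Schwarz for [Sigma^-1]. The form of the error at any parameter is within a constant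
    factor of that at the true one, which is about [n]. *)
Lemma ones_err : dot (ones R N) (W *m e) ^+ 2 <=
  (Kc ^+ 2 * (hi / lo)) ^+ 2 * (1 + eta) * n * dot (ones R N) (W *m ones R N).
Proof.
apply: le_trans (psd_CS _ _ (qf_psd N rho01 s0' v0')) _.
rewrite mulrC; apply: ler_wpM2r; first exact: (qf_psd N rho01 s0' v0').2.
apply: le_trans (qf_true_compare e) _.
rewrite -[X in _ <= X]mulrA ler_wpM2l ?sqr_ge0// [(1 + eta) * n]mulrC.
exact: good_err_form G.
Qed.

Definition overfit_cst : R :=
  p%:R * ((2 * (lo^-1 ^+ 2 * (2 * K + 2 * (K + 2 * (V + eta) * K))) +
     2 * ((Kc ^+ 2 * (hi / lo)) ^+ 2 * (1 + eta) * (lo^-1 ^+ 2 *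
       (4 * hi * (K + 2 * (V + eta) + Kc ^+ 2 * (K + 8 * (V + eta)))))))
    / (vmin / (4 * hi))).

Lemma overfit_bound c0 b : exists c, qf rho s v (e - c *: ones R N) <=
  qf rho s v (e - c0 *: ones R N - lin X b) + overfit_cst.
Proof.
have hi0 := hi_gt0.
have q1 := qf_ones_ge1 N rho01 s0' v0'.
(* Nonnegativity of [V + eta] is obtained from some regressor; if there is none, the claim is
   immediate. *)
case: (pickP (fun _ : 'I_p => true)) => [j _|p0]; last first.
  have p00 : p = 0%N by rewrite -(card_ord p); apply: eq_card0 => j; have := p0 j.
  exists c0; rewrite /overfit_cst /lin big1 ?subr0; last by move=> j; have := p0 j.
  have -> : p%:R = 0 :> R by rewrite p00.
  by rewrite mul0r addr0.
apply: (@projection_gain p N.+1 W X (ones R N) e n) => //.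
- exact: qf_psd.
- by rewrite divr_gt0// mulr_gt0.
- rewrite -/(qf rho s v _) -(pmulr_lgt0 _ (_ : 0 < s + v)) ?addr_gt0//.
  exact: lt_le_trans q1.
- have V0 : 0 <= V + eta.
    by rewrite -(pmulr_lge0 _ n0); apply: le_trans (regressor_norm j); exact: dot_ge0.
  apply: mulr_ge0; first exact: sqr_ge0.
  apply: mulr_ge0; first by rewrite mulr_ge0// ltW.
  move: V0; move: (V + eta) => V' V0.
  have KV a : 0 <= a -> 0 <= K + a * V'.
    by move=> a0; rewrite addr_ge0 ?mulr_ge0//; exact: ltW.
  rewrite addr_ge0//; first exact: KV.
  by rewrite mulr_ge0 ?sqr_ge0//; exact: KV.
- exact: cross_err.
- exact: ones_err.
- exact: cross_ones.
- exact: qf_regression_ge.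
Qed.

End fixed_size.
End uniform.
End overfit.

(** * Underfitted models *)

Section underfit.
Context (R : realType).

Lemma ln_le_sub1 (y : R) : 0 < y -> ln y <= y - 1.
Proof.
by move=> y0; have := expR_ge1Dx (ln y); rewrite lnK ?posrE//; lra.
Qed.

Lemma ln_ge_1sub (y : R) : 0 < y -> 1 - y^-1 <= ln y.
Proof.
move=> y0; have := @ln_le_sub1 y^-1; rewrite invr_gt0 lnV ?posrE// => /(_ y0); lra.
Qed.

Lemma log_tradeoff (A v : R) : 0 < A -> 0 < v -> 1 + ln A <= ln v + A / v.
Proof.
move=> A0 v0; have := @ln_le_sub1 (A / v); rewrite divr_gt0// => /(_ isT).
by rewrite ln_div ?posrE//; lra.
Qed.

(** From [ln (A / v0) >= 1 - v0 / A]. Clearing denominators in [v0 / A <= 1 - 3 eta] and discarding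
    [6 eta^2] gives the condition on [eta]. *)
Lemma log_gap (v0 B eta : R) : 0 < v0 -> 0 < B -> 0 < eta ->
  eta * (4 * v0 + 3 * B + 2) <= B ->
  0 < (v0 - 2 * eta + B) / (1 + eta) /\
  3 * eta + ln v0 <= ln ((v0 - 2 * eta + B) / (1 + eta)).
Proof.
move=> v00 B0 e0 h.
have ev : 0 < eta * v0 by rewrite mulr_gt0.
have eB : 0 < eta * B by rewrite mulr_gt0.
have A0 : 0 < v0 - 2 * eta + B by lra.
have e1 : 0 < 1 + eta by lra.
have A'0 : 0 < (v0 - 2 * eta + B) / (1 + eta) by rewrite divr_gt0.
split=> //; set A := _ / _ in A'0 *.
have := @ln_ge_1sub (A / v0); rewrite divr_gt0// => /(_ isT).
rewrite ln_div ?posrE// invf_div.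
have : v0 / A <= 1 - 3 * eta.
  rewrite /A invf_div mulrA ler_pdivrMr//.
  have -> : (1 - 3 * eta) * (v0 - 2 * eta + B) =
     v0 - 2 * eta + B - 3 * (eta * v0) + 6 * eta ^+ 2 - 3 * (eta * B) by ring.
  have := sqr_ge0 eta; lra.
lra.
Qed.

Lemma log_det_ge N (rho s v : R) : 0 < rho < 1 -> 0 < s -> 0 < v ->
  N.+1%:R * ln v <= ln (\det (sig N rho s v)).
Proof.
move=> r0 s0 v0; have h := sig_det_ge N r0 s0 v0.
have vN : 0 < v ^+ N.+1 by rewrite exprn_gt0.
rewrite mulr_natl -lnXn// ler_ln ?posrE//; exact: lt_le_trans h.
Qed.

Lemma underfit_bound p (vx : 'I_p -> R) N m M (eta K D h rho0 s0 v0 rho s v B : R) X e b c j0 :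
  good vx (N := N) m M eta K D h rho0 s0 v0 X e ->
  0 < eta -> 0 < K -> 0 < rho < 1 -> 0 < s -> 0 < v -> 0 < v0 -> 0 < B -> (0 < m)%N ->
  (forall j, (4 * p%:R + 1) * eta <= vx j / 2) -> p%:R * (K / eta) <= eta * N.+1%:R ->
  (v / s * cb rho / m%:R ^+ 2)^-1 <= eta ->
  eta * (4 * v0 + 3 * B + 2) <= B -> B <= b j0 ^+ 2 * vx j0 / 2 ->
  N.+1%:R * (1 + ln v0 + 3 * eta) <=
  ln (\det (sig N rho s v)) + qf rho s v (e + lin X b + c *: ones R N).
Proof.
move=> G e0 K0 r01 s00 v00 v0' B0 m0 hj hn hm hB hb.
have n0 : 0 < N.+1%:R :> R by rewrite ltr0n.
have h1 := err_lower_missing e0 G b c j0 hj hn.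
have h2 := qf_lower r01 s00 v00 (e + lin X b + c *: ones R N) m0.
have h3 := log_det_ge N r01 s00 v00.
have [A0 hA] := log_gap v0' B0 e0 hB.
move: h1 h2 h3 hA; set q := qf _ _ _ _; set Sf := dot _ _; set L := ln (\det _).
have q0 : 0 <= q by exact: (qf_psd N r01 s00 v00).2.
set u := _^-1 in hm *; move: hm q0 => hm q0 h1 h2 h3 hA.
have A0' := log_tradeoff A0 v00; set A := _ / (1 + eta) in A0 hA A0'.
have e1 : 0 < 1 + eta by lra.
have h4 : (1 + u) * (v * q) <= (1 + eta) * (v * q).
  by rewrite ler_wpM2r ?lerD2l// mulr_ge0// ltW.
have h5 : N.+1%:R * (v0 - 2 * eta + B) <= (1 + eta) * (v * q).
  apply: le_trans h4; apply: le_trans h2; apply: le_trans h1.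
  by rewrite ler_wpM2l ?(ltW n0)// lerD2l.
have h6 : N.+1%:R * (A / v) <= q.
  rewrite /A -(ler_pM2l e1) -(ler_pM2l v00).
  have -> : v * ((1 + eta) * (N.+1%:R * ((v0 - 2 * eta + B) / (1 + eta) / v))) =
    N.+1%:R * (v0 - 2 * eta + B) by field; rewrite !gt_eqF.
  by rewrite mulrCA.
have h7 : 1 + ln v0 + 3 * eta <= ln v + A / v by lra.
have := ler_wpM2l (ltW n0) h7; rewrite [N.+1%:R * (ln v + _)]mulrDr; lra.
Qed.

(** The three terms of the exponent in [sig_det_le] are made small in turn: first by the filter
    weight [w = 1 - t], then by the block length [m] for this [w], finally by the spacing for this
    [m]. *)
Lemma log_det_true (lo hi Kc s0 v0 k0 eta : R) : coefficient_bounds lo hi Kc ->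
  1 <= Kc -> 0 < s0 -> 0 < v0 -> lo <= k0 <= hi -> 0 < eta ->
  exists m (dl : R), 0 < dl /\ forall N (D : R), (m <= N.+1)%N -> 0 < D <= 1 -> D <= dl ->
    ln (\det (sig N (expR (- k0 * D)) s0 v0)) <= N.+1%:R * (ln v0 + eta).
Proof.
move=> HC Kc1 s00 v00 hk e0.
have r0 : 0 < s0 / v0 by rewrite divr_gt0.
set r := s0 / v0 in r0.
pose w := Num.min (1 / 2) (eta / (6 * r)).
have w0 : 0 < w by rewrite lt_min divr_gt0//= divr_gt0// mulr_gt0.
have w1 : w <= 1 / 2 by rewrite ge_min lexx.
have wr : w * (6 * r) <= eta.
  have : w <= eta / (6 * r) by rewrite ge_min lexx orbT.
  by rewrite ler_pdivlMr// mulr_gt0.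
clearbody w.
pose m := (Num.trunc (12 / (w * eta))).+1.
have mE : 12 / (w * eta) <= m%:R.
  by rewrite ltW// Num.Theory.truncnS_gt.
have m0 : 0 < m%:R :> R by rewrite ltr0n.
pose dl := eta / (6 * r * m%:R ^+ 2 * Kc).
have Kc0 : 0 < Kc by exact: lt_le_trans Kc1.
have m20 : 0 < m%:R ^+ 2 :> R by rewrite exprn_gt0.
have dl0 : 0 < dl.
  by apply: divr_gt0 => //; apply: mulr_gt0 => //; apply: mulr_gt0 => //; apply: mulr_gt0.
exists m, dl; split=> // N D mN D01 Dd.
have [rho01 _ [b1 _] _] := HC k0 D hk D01.
set rho := expR _ in rho01 b1 *.
have cb0 := cb_gt0 rho01; have /andP[D0 _] := D01.
have t01 : 0 < 1 - w < 1 by apply/andP; split; lra.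
have := @sig_det_le R N rho s0 v0 rho01 s00 v00 m (1 - w) (introT andP (conj isT mN)) t01.
set E := s0 / v0 * _ + _ => h.
have EE : E <= eta.
  have a1 : r * (2 * (1 - (1 - w)) ^+ 2) <= eta / 6.
    have -> : 1 - (1 - w) = w by ring.
    have : w * (w * (6 * r)) <= 1 / 2 * eta.
      apply: ler_pM => //; first exact: ltW.
      by apply: mulr_ge0; [exact: ltW|apply: mulr_ge0 => //; exact: ltW].
    have -> : w * (w * (6 * r)) = 3 * (r * (2 * w ^+ 2)) by ring.
    lra.
  have a2 : r * (2 * (m%:R ^+ 2 / cb rho)) <= eta / 3.
    have cbi : (cb rho)^-1 <= Kc * D.
      rewrite -[Kc * D]invrK lef_pV2 ?posrE// ?invr_gt0 ?mulr_gt0//.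
      by rewrite invfM mulrC.
    have : (cb rho)^-1 <= Kc * dl by apply: (le_trans cbi); rewrite ler_pM2l.
    have rm : 0 < r * 2 * m%:R ^+ 2 by apply: mulr_gt0 => //; apply: mulr_gt0.
    move/(ler_wpM2l (ltW rm)).
    have -> : r * 2 * m%:R ^+ 2 * (Kc * dl) = eta / 3.
      by rewrite /dl; field; rewrite !gt_eqF.
    by rewrite !mulrA.
  have a3 : 4 * ((1 - w) / (1 - (1 - w))) / m%:R <= eta / 3.
    have -> : 1 - (1 - w) = w by ring.
    rewrite ler_pdivrMr//.
    have : eta / 3 * (12 / (w * eta)) <= eta / 3 * m%:R by rewrite ler_pM2l// divr_gt0.
    apply: le_trans.
    have -> : eta / 3 * (12 / (w * eta)) = 4 * (1 / w) by field; rewrite !gt_eqF.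
    by rewrite ler_pM2l// ler_pM2r ?invr_gt0//; lra.
  rewrite /E -/r mulrDr; lra.
have dp : 0 < \det (sig N rho s0 v0).
  by apply: lt_le_trans (sig_det_ge N rho01 s00 v00); rewrite exprn_gt0.
have vN : 0 < v0 ^+ N.+1 by rewrite exprn_gt0.
apply: (@le_trans _ _ (ln (v0 ^+ N.+1 * expR (N.+1%:R * E)))).
  by rewrite ler_ln ?posrE// mulr_gt0// expR_gt0.
rewrite lnM ?posrE// ?expR_gt0// expRK lnXn//.
have -> : ln v0 *+ N.+1 = N.+1%:R * ln v0 by rewrite mulr_natl.
rewrite -mulrDr.
by rewrite ler_wpM2l// lerD2l.
Qed.

End underfit.

(** * Generalized least squares *)

Section spacing.
Context (R : realType) (delta : R).
Hypothesis hdelta : 0 <= delta < 1.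

Definition spacing (n : nat) : R := n%:R `^ (- (1 - delta)).

Lemma spacing_bounds n : (0 < n)%N -> 0 < spacing n <= 1.
Proof.
move=> n0; have n1 : 1 <= n%:R :> R by rewrite ler1n.
rewrite /spacing powR_gt0 ?(lt_le_trans _ n1)//= powRN invf_le1 ?powR_gt0 ?(lt_le_trans _ n1)//.
rewrite -[X in X <= _](powRr0 n%:R) ler_powR//.
by case/andP: hdelta => _; lra.
Qed.

Lemma spacing_small dl : 0 < dl -> \forall n \near \oo, spacing n <= dl.
Proof.
move=> dl0; have c0 : 0 < 1 - delta by case/andP: hdelta => _; lra.
near=> n.
have n0 : 0 < n%:R :> R by rewrite ltr0n; near: n; exact: nbhs_infty_gt.
rewrite /spacing /powR gt_eqF// -[dl in X in _ <= X]lnK ?posrE// ler_expR.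
have : expR (- ln dl / (1 - delta)) <= n%:R by near: n; exact: nbhs_infty_ger.
rewrite -ler_ln ?posrE ?expR_gt0// expRK ler_pdivrMr// [ln n%:R * _]mulrC mulNr; lra.
Unshelve. all: by end_near. Qed.

Lemma cov_sig N (t : R * R * R) :
  cov delta N.+1 t = sig N (expR (- kappa t * spacing N.+1)) (sigma2 t) (v2 t).
Proof.
apply/matrixP => i j; rewrite !mxE; congr (_ * _ + _).
rewrite site_dist -expRM_natl; congr expR; rewrite /ndist /spacing; ring.
Qed.

End spacing.

(** * Uniform bounds from compactness *)

Section parameter_bounds.
Context (R : realType) (Theta : set (R * R * R)) (theta0 : R * R * R).
Hypothesis hTheta_pos : forall t, Theta t -> [/\ 0 < v2 t, 0 < sigma2 t & 0 < kappa t].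
Hypothesis hTheta_compact : compact Theta.
Hypothesis htheta0 : Theta theta0.

Lemma coordinate_bounds (f : R * R * R -> R) : continuous f ->
  (forall t, Theta t -> 0 < f t) ->
  exists lo hi, 0 < lo /\ forall t, Theta t -> lo <= f t <= hi.
Proof.
move=> cf f0; have T0 : Theta !=set0 by exists theta0.
have cw : {within Theta, continuous f} by apply: continuous_subspaceT.
have [s + hs] := compact_EVT_max T0 hTheta_compact cw.
have [u + hu] := compact_EVT_min T0 hTheta_compact cw.
rewrite !inE => Tu Ts; exists (f u), (f s); split; first exact: f0.
by move=> t Tt; rewrite hu ?hs ?inE.
Qed.

Lemma parameter_bounds : exists lo hi, 0 < lo /\ lo <= hi /\ forall t, Theta t ->
  [/\ lo <= v2 t <= hi, lo <= sigma2 t <= hi & lo <= kappa t <= hi].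
Proof.
have c1 : continuous (@v2 R).
  by move=> t; apply: continuous_comp; [exact: cvg_fst|exact: cvg_fst].
have c2 : continuous (@sigma2 R).
  by move=> t; apply: continuous_comp; [exact: cvg_fst|exact: cvg_snd].
have c3 : continuous (@kappa R) by move=> t; exact: cvg_snd.
have [l1 [h1 [l10 b1]]] := coordinate_bounds c1 (fun t Tt => let: And3 a _ _ := hTheta_pos Tt in a).
have [l2 [h2 [l20 b2]]] := coordinate_bounds c2 (fun t Tt => let: And3 _ a _ := hTheta_pos Tt in a).
have [l3 [h3 [l30 b3]]] := coordinate_bounds c3 (fun t Tt => let: And3 _ _ a := hTheta_pos Tt in a).
pose lo := Num.min l1 (Num.min l2 l3); pose hi := Num.max h1 (Num.max h2 h3).
have B t : Theta t -> [/\ lo <= v2 t <= hi, lo <= sigma2 t <= hi & lo <= kappa t <= hi].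
  move=> Tt; have /andP[a1 a2] := b1 t Tt; have /andP[a3 a4] := b2 t Tt.
  have /andP[a5 a6] := b3 t Tt.
  by split; rewrite /lo /hi !ge_min !le_max ?a1 ?a2 ?a3 ?a4 ?a5 ?a6 ?orbT.
exists lo, hi; split; first by rewrite !lt_min l10 l20.
split=> //; have [/andP[a b] _ _] := B _ htheta0; exact: le_trans b.
Qed.

End parameter_bounds.

(** * Fitted means for a fixed covariance parameter *)

Section generalized_least_squares.
Context (R : realType) (p N : nat) (delta : R) (a : {set 'I_p}) (t : R * R * R)
  (x : 'I_p -> R -> R).
Local Notation n := N.+1.
Local Notation M := (sub_design delta n a x).
Local Notation X := (fun j : 'I_p => \col_i x j (site delta i) : 'cV[R]_n).
Local Notation W := (invmx (cov delta n t)).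

(** Coefficients are taken as functions on all regressors that vanish outside [a], so that different
    models are compared in one space. *)
Definition coef_vec (c0 : R) (b : 'I_p -> R) : 'cV[R]_(1 + #|a|) :=
  col_mx (const_mx c0) (\col_k b (enum_val k)).

Lemma sub_design_mul c0 b : (forall j, j \notin a -> b j = 0) ->
  M *m coef_vec c0 b = c0 *: ones R N + lin X b.
Proof.
move=> hb; rewrite /sub_design /coef_vec mul_row_col; congr (_ + _).
  by apply/colP => i; rewrite !mxE big_ord1 !mxE mulrC.
apply/colP => i; rewrite !mxE summxE (bigID (mem a))/= [X in _ = _ + X]big1 ?addr0; last first.
  by move=> j ja; rewrite hb// scale0r mxE.
rewrite [RHS]big_enum_val/=; apply: eq_bigr => k _; rewrite !mxE mulrC.
by [].
Qed.

Lemma coef_vec_surj (c : 'cV[R]_(1 + #|a|)) : exists c0 b,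
  (forall j, j \notin a -> b j = 0) /\ c = coef_vec c0 b.
Proof.
exists (c (lshift _ ord0) ord0).
exists (fun j => if pick (fun k : 'I_#|a| => enum_val k == j) is Some k
                 then c (rshift 1 k) ord0 else 0).
split.
  move=> j ja; case: pickP => // k /eqP kj; move: ja.
  by rewrite -kj enum_valP.
rewrite -[c in LHS]vsubmxK; congr col_mx; apply/colP => k; rewrite !mxE.
  by rewrite (ord1 k).
case: pickP => [l /eqP/enum_val_inj -> //|/(_ k)]; by rewrite eqxx.
Qed.

Hypothesis inv_ok : inverses_exist delta n a t x.
Hypothesis W_psd : psd W.

Variable z : 'cV[R]_n.
Local Notation mu := (mu_hat delta a t x z).
Local Notation q f := (dot f (W *m f)).

Lemma gls_residual : M^T *m (W *m (z - mu)) = 0.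
Proof.
rewrite /mu_hat !mulmxBr !mulmxA -/(gram delta n a t x).
by rewrite -[_ *m invmx _ *m _ *m _ *m _]mulmxA mulmxV ?inv_ok.2// mul1mx !mulmxA subrr.
Qed.

Lemma gls_attained : exists c0 b, (forall j, j \notin a -> b j = 0) /\
  mu = c0 *: ones R N + lin X b.
Proof.
have [c0 [b [hb E]]] := coef_vec_surj (invmx (gram delta n a t x) *m M^T *m W *m z).
exists c0, b; split=> //; rewrite -sub_design_mul// -E /mu_hat !mulmxA.
by [].
Qed.

(** Pythagoras: by the normal equations the residual is orthogonal to the range of the design. *)
Lemma gls_min c0 b : (forall j, j \notin a -> b j = 0) ->
  q (z - mu) <= q (z - c0 *: ones R N - lin X b).
Proof.
move=> hb; have [c1 [b1 [hb1 E]]] := gls_attained.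
set r := z - mu.
have -> : z - c0 *: ones R N - lin X b = r + (M *m (coef_vec c1 b1 - coef_vec c0 b)).
  by rewrite mulmxBr !sub_design_mul// -E /r addrA subrK opprD addrA.
have hr := gls_residual; rewrite -/r in hr; clearbody r.
set c := coef_vec c1 b1 - _; clearbody c.
rewrite mulmxDr dotDl 2!dotDr (psd_sym r (M *m c) W_psd.1).
have -> : dot (M *m c) (W *m r) = 0.
  by rewrite dotC dot_mulmx hr dot0l.
by rewrite add0r addr0 lerDl; exact: W_psd.2.
Qed.

Lemma loglikE : - 2 * loglik delta a t x z =
  n%:R * ln (2 * pi) + ln (\det (cov delta n t)) + q (z - mu).
Proof.
by rewrite /loglik -mulmxA dotE; field.
Qed.

End generalized_least_squares.

(** * Probability estimates *)

Section likely.
Context (R : realType) (d : measure_display) (T : measurableType d)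
  (P : probability T R).

(* [Q] itself need not be measurable. *)
Definition likely (e : R) (Q : T -> Prop) : Prop :=
  exists E, [/\ measurable E, forall w, E w -> Q w & (P (~` E) <= e%:E)%E].

Lemma likely_imp e e' (Q Q' : T -> Prop) : e <= e' -> (forall w, Q w -> Q' w) ->
  likely e Q -> likely e' Q'.
Proof.
move=> ee QQ [E [mE EQ PE]]; exists E; split=> //; first by move=> w /EQ /QQ.
by apply: le_trans PE _; rewrite lee_fin.
Qed.

Lemma likely_and e e' (Q Q' : T -> Prop) : likely e Q -> likely e' Q' ->
  likely (e + e') (fun w => Q w /\ Q' w).
Proof.
move=> [E [mE EQ PE]] [E' [mE' EQ' PE']]; exists (E `&` E'); split.
- exact: measurableI.
- by move=> w [/EQ ? /EQ' ?].
- rewrite setCI EFinD; apply: le_trans (_ : _ <= P (~` E) + P (~` E'))%E _.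
    by apply: measureU2; exact: measurableC.
  exact: leeD.
Qed.

Lemma likely_forall (I : finType) e (Q : I -> T -> Prop) : (forall i, likely e (Q i)) ->
  likely (#|I|%:R * e) (fun w => forall i, Q i w).
Proof.
move=> H.
have : likely ((size (enum I))%:R * e) (fun w => forall i, i \in enum I -> Q i w).
  elim: (enum I) => [|i s IHs].
    exists setT; split=> //; rewrite setCT measure0 mul0r; exact: lexx.
  have := likely_and (H i) IHs; apply: likely_imp.
    by rewrite /= -natr1 mulrDl mul1r addrC.
  move=> w [Qi Qs] k; rewrite inE => /orP[/eqP ->//|]; exact: Qs.
rewrite -cardE; apply: likely_imp => // w h i.
by apply: h; rewrite mem_enum.
Qed.

Lemma likely_markov f c t e : hasE P f c -> (forall w, 0 <= f w) -> 0 < t ->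
  c <= e * t -> likely e (fun w => f w <= t).
Proof.
move=> fc f0 t0 cet; have mf := hasE_meas fc.
have h := hasE_markov fc f0 t0.
have E : ~` [set w | f w < t] = [set w | t <= f w].
  by apply/seteqP; split=> w /=; [move/negP; rewrite -leNgt|move=> h1; apply/negP; rewrite -leNgt].
exists [set w | f w < t]; split.
- have -> : [set w | f w < t] = f @^-1` `]-oo, t[%classic.
    by apply/seteqP; split=> w /=; rewrite in_itv.
  by rewrite -[X in measurable X]setTI; apply: mf.
- by move=> w /ltW.
- rewrite E; apply: le_trans h _; rewrite lee_fin ler_pdivrMr//.
Qed.

Lemma likely_chebyshev f m c t e : hasE P (fun w => (f w - m) ^+ 2) c -> 0 < t ->
  c <= e * t ^+ 2 -> likely e (fun w => `|f w - m| <= t).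
Proof.
move=> fc t0 ce.
have := likely_markov fc (fun w => sqr_ge0 _) (exprn_gt0 2 t0) ce.
apply: likely_imp => // w; rewrite -[X in X <= _]real_normK ?num_real//.
by rewrite ler_pXn2r// ?nnegrE// ltW.
Qed.

End likely.

(** * Traces and Frobenius norms *)

Section matrix_facts.
Context (R : realType).

Lemma sum_col_norm n (S C : 'M[R]_n) : S = C *m C^T ->
  \sum_c dot (col c C) (col c C) = \tr S.
Proof.
move=> ->; rewrite mxtrace_mulC; apply: eq_bigr => c _.
by rewrite mxE; apply: eq_bigr => i _; rewrite !mxE.
Qed.

(** For a basis vector [u], [|u - S u|^2 >= 0] gives [|S u|^2 >= 2 u' S u - 1]; the sum is bounded
    by [refsm_trace]. *)
Lemma smooth_trace_sqr N m : (0 < m <= N.+1)%N ->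
  N.+1%:R * (1 - 4 / m%:R) <=
  \sum_(k < N.+1) dot (refsm R N m *m delta_mx k ord0) (refsm R N m *m delta_mx k ord0).
Proof.
move=> mN; have h := refsm_trace R mN.
set S := refsm R N m in h *.
have -> : N.+1%:R * (1 - 4 / m%:R) = N.+1%:R - 2 * (2 * N.+1%:R / m%:R) :> R by ring.
apply: (@le_trans _ _ (N.+1%:R - 2 * (N.+1%:R - \tr S))).
  by rewrite lerD2l lerN2 ler_pM2l.
have -> : N.+1%:R - 2 * (N.+1%:R - \tr S) = \sum_(k < N.+1) (2 * S k k - 1).
  rewrite sumrB -mulr_sumr sumr_const card_ord -/(\tr S).
  by rewrite -[1 *+ _]/(N.+1%:R); ring.
apply: ler_sum => k _; set u := delta_mx k ord0.
have SE : dot u (S *m u) = S k k by rewrite form_delta.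
have uu : dot u u = 1 by rewrite dot_delta mxE !eqxx.
have := dot_ge0 (u - S *m u); rewrite dotBl 2!dotBr uu SE.
by rewrite (dotC (S *m u) u) SE; lra.
Qed.

(** The smoothed covariance has operator norm at most [C1], so each of its columns has squared norm
    at most [C1^2]. *)
Lemma smoothed_cov_sqr N m (rho s v C1 : R) : 0 < rho < 1 -> 0 < s -> 0 < v -> (0 < m)%N ->
  v + s * (m%:R ^+ 2 / cb rho) <= C1 ->
  \sum_k \sum_l ((refsm R N m)^T *m sig N rho s v *m refsm R N m) k l ^+ 2 <=
  N.+1%:R * C1 ^+ 2.
Proof.
move=> r01 s0 v0 m0 hC; set S := refsm R N m.
have ST : S^T = S by exact: (refsm_psd R N m).1.
rewrite ST; set M := S *m _ *m S.
have ME u w : dot u (M *m w) = dot (S *m u) (sig N rho s v *m (S *m w)).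
  by rewrite /M -!mulmxA dot_mulmx ST.
have pM : psd M.
  split; last by move=> u; rewrite ME; exact: (sig_psd N r01 s0 v0).2.
  by rewrite /M !trmx_mul ST sig_sym mulmxA.
have M1 u : dot u (M *m u) <= C1 * dot u u.
  rewrite ME; apply: le_trans (refsm_sig r01 s0 v0 u m0) _.
  by rewrite ler_wpM2r ?dot_ge0.
have C0 : 0 <= C1.
  have := M1 (delta_mx ord0 ord0); rewrite dot_delta mxE !eqxx mulr1.
  by apply: le_trans; exact: pM.2.
have M2 u : dot (M *m u) (M *m u) <= C1 ^+ 2 * dot u u.
  have h := psd_CS (M *m u) u pM.
  have h1 := M1 (M *m u); have h2 := M1 u.
  set y := dot (M *m u) (M *m u) in h h1 *.
  have [y0|y0] := leP y 0.
    by apply: le_trans y0 _; rewrite mulr_ge0 ?sqr_ge0 ?dot_ge0.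
  rewrite -(ler_pM2l y0).
  apply: (@le_trans _ _ (C1 * y * (C1 * dot u u))); last by rewrite le_eqVlt; apply/orP; left; apply/eqP; ring.
  rewrite -expr2; apply: le_trans h _.
  by apply: ler_pM => //; exact: pM.2.
have -> : N.+1%:R * C1 ^+ 2 = \sum_(k < N.+1) C1 ^+ 2.
  by rewrite sumr_const card_ord mulr_natl.
apply: ler_sum => k _; have := M2 (delta_mx k ord0).
rewrite dot_delta mxE !eqxx mulr1; apply: le_trans; rewrite le_eqVlt; apply/orP; left; apply/eqP.
apply: eq_bigr => l _; rewrite -colE mxE expr2.
by rewrite -{1}pM.1 -{2}pM.1 !mxE.
Qed.

Lemma chain_ge0 n (A : 'I_3 -> 'M[R]_n) k x y : 0 <= chain A k x y.
Proof.
elim: k y => [|k IHk] y //=; apply: mulr_ge0; first by rewrite divr_ge0.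
by apply: addr_ge0; rewrite ?sqr_ge0//; apply: mulr_ge0; rewrite ?invr_ge0// sumr_ge0.
Qed.

(** [H] is the inverse transpose of a Cholesky factor. *)
Lemma whitening N (rho s v : R) : 0 < rho < 1 -> 0 < s -> 0 < v ->
  exists H : 'M[R]_N.+1, H^T *m sig N rho s v *m H = 1%:M /\
    invmx (sig N rho s v) = H *m H^T.
Proof.
move=> r01 s0 v0; set S := sig N rho s v.
have SU : S \in unitmx by exact: sig_unit.
have [C [SC _ _]] := pd_chol v0 (sig_sym N rho s v) (fun u => sig_pd v r01 s0 u).
rewrite -/S in SC.
have CU : C \in unitmx.
  have : C *m (C^T *m invmx S) = 1%:M by rewrite mulmxA -SC mulmxV.
  by case/mulmx1_unit.
exists (invmx C)^T; rewrite trmxK; split.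
  by rewrite SC mulmxA mulVmx// mul1mx -trmx_mul mulVmx// trmx1.
apply: (can_inj (mulKmx SU)); rewrite mulmxV// SC.
by rewrite -mulmxA [C^T *m _]mulmxA -trmx_mul mulVmx// trmx1 mul1mx mulmxV.
Qed.

End matrix_facts.

(** * Probability of a good realization *)

Section good_event.
Context (R : realType) (p N : nat) (delta : R) (d : measure_display)
  (T : measurableType d) (P : probability T R)
  (x : 'I_p -> R -> {RV P >-> R}) (vx : 'I_p -> R)
  (Z : {RV P >-> N.+1.-tuple R}) (beta0 : 'cV[R]_(1 + p)).
Variables (m M : nat) (eta K D h rho0 s0 v0 V hi C1 e : R).
Local Notation n := (N.+1%:R : R).
Local Notation S := (sig N rho0 s0 v0).
Local Notation Sm := (refsm R N m).
Local Notation X := (fun w => design delta N.+1 (realization x w)).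
Local Notation Xj := (xv N.+1 delta x).
Local Notation E := (eps delta x Z beta0).
Hypothesis vx_gt0 : forall j, 0 < vx j.
Hypothesis hx : white_noise_regressors N.+1 delta x vx.
Hypothesis hZ : conditionally_multinormal X Z (fun w => X w *m beta0) S.
Hypothesis rho01 : 0 < rho0 < 1.
Hypothesis s0_gt0 : 0 < s0.
Hypothesis v0_gt0 : 0 < v0.
Hypothesis s0_hi : s0 <= hi.
Hypothesis v0_hi : v0 <= hi.
Hypothesis vxV : forall j, vx j <= V.
Hypothesis V0 : 0 <= V.
Hypothesis eta0 : 0 < eta.
Hypothesis K0 : 0 < K.
Hypothesis e0 : 0 < e.
Hypothesis D0 : 0 < D.
Hypothesis h0 : 0 < h.
Hypothesis mN : (0 < m <= N.+1)%N.
Hypothesis hC1 : v0 + s0 * (m%:R ^+ 2 / cb rho0) <= C1.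
Hypothesis hK1 : 4 * V * hi <= e * K.
Hypothesis hK2 : 2 * hi <= e * K.
Hypothesis hK3 : 8 * V <= e * K.
Hypothesis hm1 : 2 * V <= e * (m%:R * eta).
Hypothesis hm2 : 8 * v0 <= eta * m%:R.
Hypothesis hn1 : 2 * V ^+ 2 <= e * (eta ^+ 2 * n).
Hypothesis hn2 : 8 * C1 ^+ 2 <= e * (eta ^+ 2 * n).
Hypothesis hn3 : 2 <= e * (eta ^+ 2 * n).

Let n0 : 0 < n. Proof. by rewrite ltr0n. Qed.
Let N0 : (0 < N.+1)%N. Proof. by []. Qed.
Let m0 : (0 < m)%N. Proof. by case/andP: mN. Qed.
Let mR : 0 < m%:R :> R. Proof. by rewrite ltr0n. Qed.
Let en : 0 < eta * n. Proof. exact: mulr_gt0. Qed.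
Let Kn : 0 < K * n. Proof. exact: mulr_gt0. Qed.
Let hi0 : 0 < hi. Proof. exact: lt_le_trans v0_hi. Qed.
Let pS : psd S. Proof. exact: sig_psd. Qed.
Let scale_n (a b : R) : a <= e * b -> a * n <= e * (b * n).
Proof. by move=> ab; rewrite mulrA ler_wpM2r// ltW. Qed.
Let scale_sq (a : R) : a <= e * (eta ^+ 2 * n) -> a * n <= e * (eta * n) ^+ 2.
Proof.
move=> h1; have -> : e * (eta * n) ^+ 2 = e * (eta ^+ 2 * n) * n by ring.
by rewrite ler_wpM2r// ltW.
Qed.

Lemma likely_gram (jk : 'I_p * 'I_p) : likely P e (fun w =>
  `|dot (Xj jk.1 w) (Xj jk.2 w) - (jk.1 == jk.2)%:R * (n * vx jk.1)| <= eta * n).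
Proof.
apply: (likely_chebyshev (xv_dot_var N0 vx_gt0 hx jk.1 jk.2) en).
rewrite mulrC; apply: scale_sq; apply: le_trans hn1.
apply: ler_pM; [by rewrite addr_ge0// ler0n| |by case: (_ == _); rewrite /=; lra|].
  by apply: mulr_ge0; exact: ltW.
by rewrite expr2; apply: ler_pM => //; exact: ltW.
Qed.

Lemma likely_rough j : likely P e (fun w => dot (Xj j w) ((1%:M - Sm) *m Xj j w) <= eta * n).
Proof.
have := xv_form N0 vx_gt0 hx j (1%:M - Sm).
move=> H; apply: (likely_markov H) => //; first by move=> w; exact: (rough_psd R N m).2.
have t : \tr (1%:M - Sm) <= 2 * n / m%:R.
  by rewrite linearB/= mxtrace1; exact: refsm_trace.
apply: (@le_trans _ _ (V * (2 * n / m%:R))).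
  apply: (@le_trans _ _ (vx j * (2 * n / m%:R))); first by rewrite ler_pM2l.
  by rewrite ler_wpM2r// divr_ge0// ?mulr_ge0// ltW.
have -> : V * (2 * n / m%:R) = 2 * V * n / m%:R by ring.
rewrite ler_pdivrMr//; have := scale_n hm1.
by have -> : e * (m%:R * eta * n) = e * (eta * n) * m%:R by ring.
Qed.

Lemma chol_true : exists C : 'M[R]_N.+1, S = C *m C^T.
Proof.
by have [C [SC _ _]] := pd_chol v0_gt0 (sig_sym N rho0 s0 v0)
  (fun u => sig_pd v0 rho01 s0_gt0 u); exists C.
Qed.

Lemma trace_true : \tr S <= n * (2 * hi).
Proof. by rewrite sig_trace ler_pM2l// (_ : 2 * hi = hi + hi) ?lerD//; ring. Qed.

(** A contraction keeps the mean below [V] times the trace of the covariance, which is of order [n].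
    Used for the identity and for the smoother. *)
Lemma likely_cross_gen j (A : 'M[R]_N.+1) :
  (forall u, dot (A *m u) (A *m u) <= dot u u) ->
  likely P e (fun w => dot (Xj j w) (A *m E w) ^+ 2 <= K * n).
Proof.
move=> A1; have [C SC] := chol_true.
have H := xv_eps_lin N0 vx_gt0 hx hZ pS j A SC.
apply: (likely_markov H) => //; first by move=> w; exact: sqr_ge0.
apply: (@le_trans _ _ (V * (n * (2 * hi)))).
  apply: ler_pM; [exact: ltW| |by []|].
    by apply: sumr_ge0 => c _; exact: dot_ge0.
  apply: le_trans trace_true; rewrite -(sum_col_norm SC).
  by apply: ler_sum => c _.
have Vh : 0 <= V * hi by rewrite mulr_ge0// ltW.
have -> : V * (n * (2 * hi)) = (2 * V * hi) * n by ring.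
apply: scale_n; apply: le_trans hK1; lra.
Qed.

Lemma likely_cross j : likely P e (fun w => dot (Xj j w) (E w) ^+ 2 <= K * n).
Proof.
have h1 : likely P e (fun w => dot (Xj j w) (1%:M *m E w) ^+ 2 <= K * n).
  by apply: likely_cross_gen => u; rewrite mul1mx.
by apply: likely_imp h1 => // w; rewrite mul1mx.
Qed.

Lemma likely_smooth_cross j :
  likely P e (fun w => dot (Xj j w) (Sm *m E w) ^+ 2 <= K * n).
Proof. by apply: likely_cross_gen => u; exact: refsm_norm. Qed.

(** Since [S^2 <= S], it suffices to bound [|S eps|^2] from below. Its mean is at least [v0 tr S^2]
    and its variance is of order [n]; half of [eta] goes to the mean, half to the fluctuation. *)
Lemma likely_smooth_err : likely P e (fun w => n * (v0 - eta) <= dot (E w) (Sm *m E w)).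
Proof.
have H := eps_quad_var hZ pS Sm; set tr := \tr _ in H.
have trE : n * (v0 - eta / 2) <= tr.
  have h1 := smooth_trace_sqr R mN.
  have h2 : v0 * \sum_(k < N.+1) dot (Sm *m delta_mx k ord0) (Sm *m delta_mx k ord0) <= tr.
    rewrite mulr_sumr; apply: ler_sum => k _.
    rewrite -(form_delta (Sm^T *m S *m Sm)) -!mulmxA [X in _ <= X]dot_mulmx trmxK.
    exact: sig_pd.
  apply: le_trans h2; apply: le_trans (_ : v0 * (n * (1 - 4 / m%:R)) <= _); last first.
    by rewrite ler_pM2l.
  rewrite mulrCA ler_pM2l// mulrBr mulr1 lerD2l lerN2.
  rewrite mulrA ler_pdivrMr//; have := hm2; lra.
have H2 : likely P e (fun w => `|dot (Sm^T *m E w) (Sm^T *m E w) - tr| <= eta / 2 * n).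
  apply: (likely_chebyshev H); first by apply: mulr_gt0 => //; apply: divr_gt0.
  have h1 := smoothed_cov_sqr N rho01 s0_gt0 v0_gt0 m0 hC1.
  have -> : e * (eta / 2 * n) ^+ 2 = 2 * (e * (eta ^+ 2 * n) / 8 * n) by field.
  rewrite ler_pM2l//; apply: le_trans h1 _; rewrite mulrC ler_wpM2r ?(ltW n0)//.
  by rewrite ler_pdivlMr// mulrC.
apply: likely_imp H2 => // w.
have ST : Sm^T = Sm by exact: (refsm_psd R N m).1.
rewrite ST ler_norml => /andP[h1 _].
have h2 : dot (Sm *m E w) (Sm *m E w) <= dot (E w) (Sm *m E w) by exact: refsm_contract.
move: h1 h2 trE; set a := dot _ _; set b := dot _ _.
have -> : n * (v0 - eta) = n * (v0 - eta / 2) - eta / 2 * n by field.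
lra.
Qed.

(** After whitening, the form is a squared norm with mean [n] and variance [2 n]. *)
Lemma likely_err_form : likely P e (fun w => qf rho0 s0 v0 (E w) <= n * (1 + eta)).
Proof.
have [H [HS HI]] := whitening N rho01 s0_gt0 v0_gt0.
have h1 := eps_quad_var hZ pS H; rewrite HS mxtrace1 in h1.
have h2 : likely P e (fun w => `|dot (H^T *m E w) (H^T *m E w) - n| <= eta * n).
  apply: (likely_chebyshev h1) => //.
  have -> : \sum_(k < N.+1) \sum_(l < N.+1) ((1%:M : 'M[R]_N.+1) k l) ^+ 2 = n.
    transitivity (\sum_(k < N.+1) (1 : R)); last by rewrite sumr_const card_ord.
    apply: eq_bigr => k _; rewrite (bigD1 k)//= big1 ?addr0 ?mxE ?eqxx ?expr1n// => l lk.
    by rewrite mxE eq_sym (negbTE lk) expr0n.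
  exact: scale_sq.
apply: likely_imp h2 => // w; rewrite ler_norml => /andP[_].
by rewrite /qf HI -mulmxA [dot (E w) _]dot_mulmx mulrDr mulr1; lra.
Qed.

Lemma likely_err_norm : likely P e (fun w => dot (E w) (E w) <= K * n).
Proof.
have h1 := eps_quad hZ pS 1%:M.
have h2 : likely P e (fun w => dot ((1%:M)^T *m E w) ((1%:M)^T *m E w) <= K * n).
  apply: (likely_markov h1) => //; first by move=> w; exact: dot_ge0.
  rewrite trmx1 mul1mx mulmx1; apply: le_trans trace_true _.
  by rewrite mulrC; exact: scale_n.
by apply: likely_imp h2 => // w; rewrite trmx1 mul1mx.
Qed.

Local Notation A g := (gridA (M := M) N D h g).

Lemma chain_mean_bound g j k (y : 'cV[R]_N.+1) :
  chain_mean (A g) (vx j) k y <= 2 * V * dot y y.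
Proof.
have pA i : psd (A g i) by exact: gridA_psd.
have A0 : A g ord0 = 1%:M by [].
apply: le_trans (chain_mean_le pA A0 k y (ltW (vx_gt0 j))) _.
have h1 : dot y (invmx (\sum_i A g i) *m y) <= dot y y.
  by rewrite (WbE A0); apply: inv_le1; exact: Wb_psd.
apply: (@le_trans _ _ (2 * vx j * dot y y)).
  by rewrite ler_wpM2l// mulr_ge0// ltW.
by rewrite ler_wpM2r ?dot_ge0// ler_pM2l.
Qed.

Lemma likely_chain_err (jg : 'I_p * ('I_M * 'I_M)) :
  likely P e (fun w => chain (A jg.2) N.+1 (Xj jg.1 w) (E w) <= K * n).
Proof.
have [C SC] := chol_true; case: jg => j g /=.
have H := chain_hasE (A g) N.+1
  (fun F => xv_eps_lin N0 vx_gt0 hx hZ pS j F SC) 1%:M.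
have h1 : likely P e (fun w => chain (A g) N.+1 (Xj j w) (1%:M *m E w) <= K * n).
  apply: (likely_markov H) => //; first by move=> w; exact: chain_ge0.
  apply: (@le_trans _ _ (2 * V * \tr S)).
    rewrite -(sum_col_norm SC) mulr_sumr; apply: ler_sum => c _.
    by rewrite mul1mx; exact: chain_mean_bound.
  apply: (@le_trans _ _ (2 * V * (n * (2 * hi)))).
    by rewrite ler_wpM2l ?mulr_ge0//; exact: trace_true.
  have -> : 2 * V * (n * (2 * hi)) = 4 * V * hi * n by ring.
  exact: scale_n.
by apply: likely_imp h1 => // w; rewrite mul1mx.
Qed.

Lemma likely_chain_cst j g (y : 'cV[R]_N.+1) t : 0 < t -> 2 * V * dot y y <= e * t ->
  likely P e (fun w => chain (A g) N.+1 (Xj j w) y <= t).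
Proof.
move=> t0 ht.
have H := @chain_hasE R p N.+1 delta d T P x vx (A g) j 1 (fun=> y) y N.+1
  (fun F => hasE_eq _ (xv_lin_cst N0 vx_gt0 hx y j F)) 1%:M.
have yc : col ord0 y = y by apply/colP => i; rewrite mxE.
have h1 : likely P e (fun w => chain (A g) N.+1 (Xj j w) (1%:M *m y) <= t).
  apply: likely_markov (H _) _ t0 _ => [F|w|].
  - by rewrite big_ord1 yc.
  - exact: chain_ge0.
  - by rewrite big_ord1 yc mul1mx; apply: le_trans ht; exact: chain_mean_bound.
by apply: likely_imp h1 => // w; rewrite mul1mx.
Qed.

Lemma likely_good :
  likely P ((#|{: 'I_p * 'I_p}| + (p + (p + (p + (1 + (1 + (1 +
    (#|{: 'I_p * ('I_M * 'I_M)}| + (#|{: 'I_p * ('I_M * 'I_M)}| +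
     #|{: 'I_p * ('I_M * 'I_M)}|)))))))))%:R * e)
  (fun w => good vx m M eta K D h rho0 s0 v0 (Xj ^~ w) (E w)).
Proof.
have ends : dot (ev R N 0 + ev R N N) (ev R N 0 + ev R N N) <= 4.
  have ev1 (i : 'I_N.+1) : dot (ev R N i) (ev R N i) = 1 by rewrite dot_ev mxE eqxx.
  have := psd_parallelogram (ev R N 0) (ev R N N) (psd1 R N.+1).
  by rewrite !mul1mx (ev1 ord0) (ev1 ord_max); lra.
have h9 := likely_forall (fun jg : 'I_p * ('I_M * 'I_M) =>
  @likely_chain_cst jg.1 jg.2 (ones R N) (K * n) Kn _).
have h10 := likely_forall (fun jg : 'I_p * ('I_M * 'I_M) =>
  @likely_chain_cst jg.1 jg.2 (ev R N 0 + ev R N N) K K0 _).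
have H := likely_and (likely_forall likely_gram)
  (likely_and (likely_forall likely_rough) (likely_and (likely_forall likely_cross)
  (likely_and (likely_forall likely_smooth_cross) (likely_and likely_smooth_err
  (likely_and likely_err_form (likely_and likely_err_norm
  (likely_and (likely_forall likely_chain_err) (likely_and (h9 _) (h10 _))))))))).
apply: likely_imp (H _ _); first last.
- apply: le_trans hK3.
  have -> : 8 * V = 2 * V * 4 by ring.
  by rewrite ler_wpM2l ?mulr_ge0.
- by rewrite dot_ones; apply: scale_n; apply: le_trans hK3; have := V0; lra.
- by move=> w [a1 [a2 [a3 [a4 [a5 [a6 [a7 [a8 [a9 a10]]]]]]]]]; split.
- rewrite !natrD !card_ord; lra.
Qed.

End good_event.

(** * Correct models *)

Section correct.
Context (R : realType) (p n : nat) (delta : R) (d : measure_display)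
  (T : measurableType d) (P : probability T R)
  (x : 'I_p -> R -> {RV P >-> R}) (vx2 : 'I_p -> R) (beta0 : 'cV[R]_(1 + p))
  (a : {set 'I_p}).
Hypothesis n_gt0 : (0 < n)%N.
Hypothesis vx2_gt0 : forall j, 0 < vx2 j.
Hypothesis hx : white_noise_regressors n delta x vx2.

(** Turns the almost sure identity in [correct_model] into an equation between moments. *)
Lemma hasE_ae0 (f : T -> R) c : hasE P f c -> {ae P, forall w, f w = 0} -> c = 0.
Proof.
move=> fc f0; have mf := hasE_meas fc; case: fc => _ fc.
have : (\int[P]_w (f w)%:E = \int[P]_w (0 : \bar R))%E.
  apply: ae_eq_integral => //; first exact/measurable_EFinP.
  by apply: filterS f0 => w -> _.
by rewrite fc integral0 => -[].
Qed.

Lemma hasE_affine_sqr s (c0 : R) (c : 'I_p -> R) : domain delta n s ->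
  hasE P (fun w => (c0 + \sum_j c j * x j s w) ^+ 2) (c0 ^+ 2 + \sum_j c j ^+ 2 * vx2 j).
Proof.
move=> ds.
have h1 := hasE_sum (index_enum 'I_p) predT (fun j =>
  hasEZ (c j) (let: And3 m _ _ := wn_moments vx2_gt0 hx j ds in m)).
have h2 := hasE_sum (index_enum 'I_p) predT (fun j => hasE_sum (index_enum 'I_p) predT
  (fun k => hasEZ (c j * c k) (wn_mul vx2_gt0 hx (u := (j, s)) (v := (k, s)) ds ds))).
have h := hasED (hasED (hasE_cst P (c0 ^+ 2)) (hasEZ (2 * c0) h1)) h2.
apply: hasE_eq (hasE_ext _ h).
  rewrite [X in 2 * c0 * X]big1; last by move=> j _; rewrite mulr0.
  rewrite mulr0 addr0; congr (_ + _); apply: eq_bigr => j _.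
  rewrite (bigD1 j)//= eqxx big1 ?addr0 ?expr2// => k kj.
  by rewrite xpair_eqE eq_sym (negbTE kj) mulr0.
move=> w /=.
have -> : \sum_j \sum_k c j * c k * (pt x (j, s) w * pt x (k, s) w) =
    (\sum_j c j * x j s w) ^+ 2.
  rewrite expr2 mulr_suml; apply: eq_bigr => j _; rewrite mulr_sumr.
  by apply: eq_bigr => k _; rewrite /pt/=; ring.
by ring.
Qed.

(** At a single site, the difference of the two mean functions has second moment
    [c0^2 + sum c_j^2 vx2_j]. It vanishes almost surely only if every [c_j] is zero. *)
Lemma correct_modelP : correct_model n delta x beta0 a <->
  forall j, j \notin a -> beta0 (rshift 1 j) ord0 = 0.
Proof.
split=> [[b hb] j ja|hb]; last first.
  exists beta0; apply: aeW => w s _; rewrite /mean_fun /sub_mean_fun; congr (_ + _).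
  rewrite (bigID (mem a))/= [X in _ + X]big1 ?addr0// => j ja.
  by rewrite hb// mul0r.
pose s := site delta (Ordinal n_gt0).
have ds : domain delta n s by exact: site_domain.
pose c0 := beta0 ord0 ord0 - b ord0 ord0.
pose c j := beta0 (rshift 1 j) ord0 - (if j \in a then b (rshift 1 j) ord0 else 0).
have h := hasE_affine_sqr c0 c ds.
have /(hasE_ae0 h) : {ae P, forall w, (c0 + \sum_j c j * x j s w) ^+ 2 = 0}.
  apply: filterS hb => w /(_ s ds); rewrite /mean_fun /sub_mean_fun => E.
  apply/eqP; rewrite sqrf_eq0; apply/eqP.
  have -> : \sum_j c j * x j s w = \sum_j beta0 (rshift 1 j) ord0 * x j s w -
      \sum_(j in a) b (rshift 1 j) ord0 * x j s w.
    rewrite [X in _ - X]big_mkcond -sumrB; apply: eq_bigr => k _.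
    by rewrite /c mulrBl; case: ifP => // _; rewrite mul0r.
  by rewrite /c0 addrACA -opprD E subrr.
move/eqP; rewrite paddr_eq0 ?sqr_ge0//; last first.
  by apply: sumr_ge0 => k _; rewrite mulr_ge0 ?sqr_ge0// ltW.
case/andP => _; rewrite psumr_eq0; last first.
  by move=> k _; rewrite mulr_ge0 ?sqr_ge0// ltW.
move=> /allP /(_ j (mem_index_enum _)); rewrite /= mulf_eq0 sqrf_eq0.
by rewrite (gt_eqF (vx2_gt0 j)) orbF /c (negbTE ja) subr0 => /eqP.
Qed.

End correct.

(** * Comparison of likelihoods *)

Section likelihood_comparison.
Context (R : realType) (p N : nat) (delta : R) (vx : 'I_p -> R) (beta0 : 'cV[R]_(1 + p))
  (x : 'I_p -> R -> R) (z : 'cV[R]_N.+1).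
Variables (theta0 : R * R * R) (lo hi Kc h vmin V eta K : R) (m M : nat).
Local Notation n := (N.+1%:R : R).
Local Notation D := (spacing delta N.+1).
Local Notation rho t := (expR (- kappa t * D)).
Local Notation X := (fun j : 'I_p => \col_i x j (site delta i) : 'cV[R]_N.+1).
Local Notation beta := (fun j : 'I_p => beta0 (rshift 1 j) ord0).
Local Notation err := (z - design delta N.+1 x *m beta0).
Local Notation par t := [/\ lo <= v2 t <= hi, lo <= sigma2 t <= hi & lo <= kappa t <= hi].
Hypothesis hdelta : 0 <= delta < 1.
Hypothesis lo0 : 0 < lo.
Hypothesis Kc1 : 1 <= Kc.
Hypothesis HR : resolvent_bounds lo hi h M.
Hypothesis HC : coefficient_bounds lo hi Kc.
Hypothesis vmin0 : 0 < vmin.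
Hypothesis vxb : forall j, vmin <= vx j <= V.
Hypothesis eta0 : 0 < eta.
Hypothesis eta1 : eta <= 1.
Hypothesis K0 : 0 < K.
Hypothesis m0 : (0 < m)%N.
Hypothesis heta : (4 * p%:R + 1) * eta <= vmin / 2.
Hypothesis hD : hi * Kc * m%:R ^+ 2 * D <= eta * lo.
Hypothesis par0 : par theta0.
Hypothesis G : good vx m M eta K D h (rho theta0) (sigma2 theta0) (v2 theta0) X err.

Let D01 : 0 < D <= 1. Proof. exact: spacing_bounds. Qed.

Lemma design_mul :
  design delta N.+1 x *m beta0 = beta0 ord0 ord0 *: ones R N + lin X beta.
Proof.
rewrite /design -{1}[beta0]vsubmxK mul_row_col; congr (_ + _).
  apply/colP => i; rewrite !mxE big_ord1 !mxE mulrC; congr (beta0 _ _ * _).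
  exact: val_inj.
apply/colP => i; rewrite !mxE summxE; apply: eq_bigr => j _; rewrite !mxE mulrC.
by [].
Qed.

Lemma par_pos t : par t -> [/\ 0 < v2 t, 0 < sigma2 t & 0 < rho t < 1].
Proof.
move=> [h1 h2 h3]; split; last by case: (HC h3 D01).
- by apply: (lt_le_trans lo0); case/andP: h1.
- by apply: (lt_le_trans lo0); case/andP: h2.
Qed.

(** [cb] is of order [1 / D], so the left side is at most of order [m^2 D], which [hD] makes
    small. *)
Lemma smoothing_ratio t : par t ->
  (v2 t / sigma2 t * cb (rho t) / m%:R ^+ 2)^-1 <= eta.
Proof.
move=> pt; have [v0 s0 r01] := par_pos pt; have [h1 h2 h3] := pt.
have [_ _ [b1 _] _] := HC h3 D01; set c := cb _ in b1 *.
have c0 : 0 < c by exact: cb_gt0.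
have mR : 0 < m%:R ^+ 2 :> R by rewrite exprn_gt0// ltr0n.
have /andP[D0 _] := D01; have Kc0 : 0 < Kc by exact: lt_le_trans Kc1.
have q : (hi / lo)^-1 <= v2 t / sigma2 t by have /andP[] := ratio_bounds lo0 h1 h2.
have hi0 : 0 < hi by apply: lt_le_trans v0 _; case/andP: h1.
have big : (hi / lo)^-1 * (D^-1 / Kc) / m%:R ^+ 2 <= v2 t / sigma2 t * c / m%:R ^+ 2.
  rewrite ler_pM2r ?invr_gt0//; apply: ler_pM => //.
    by rewrite invr_ge0 divr_ge0// ltW.
  by rewrite divr_ge0 ?invr_ge0// ltW.
have pos : 0 < (hi / lo)^-1 * (D^-1 / Kc) / m%:R ^+ 2.
  by rewrite divr_gt0// mulr_gt0// ?invr_gt0 ?divr_gt0// invr_gt0.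
apply: (@le_trans _ _ ((hi / lo)^-1 * (D^-1 / Kc) / m%:R ^+ 2)^-1).
  by rewrite lef_pV2 ?posrE//; exact: lt_le_trans big.
have -> : ((hi / lo)^-1 * (D^-1 / Kc) / m%:R ^+ 2)^-1 = hi * Kc * m%:R ^+ 2 * D / lo.
  have aux (H L k M' D' : R) : H != 0 -> L != 0 -> k != 0 -> M' != 0 -> D' != 0 ->
      ((H / L)^-1 * (D'^-1 / k) / M')^-1 = H * k * M' * D' / L.
    by move=> H0 L0 k0 M0 DD0; field; rewrite H0 L0 k0 M0 DD0.
  by apply: aux; rewrite gt_eqF.
by rewrite ler_pdivrMr.
Qed.

Lemma cov_inv_psd t : par t -> psd (invmx (cov delta N.+1 t)).
Proof.
by move=> pt; have [v0 s0 r01] := par_pos pt; rewrite cov_sig; exact: qf_psd.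
Qed.

Lemma loglik_qf a t : par t -> - 2 * loglik delta a t x z =
  n * ln (2 * pi) + ln (\det (sig N (rho t) (sigma2 t) (v2 t))) +
  qf (rho t) (sigma2 t) (v2 t) (z - mu_hat delta a t x z).
Proof. by move=> pt; rewrite loglikE cov_sig. Qed.

Lemma gls_residual_split (a : {set 'I_p}) (t : R * R * R) :
  exists c b, (forall j, j \notin a -> b j = beta j) /\
    z - mu_hat delta a t x z = err + lin X b + c *: ones R N.
Proof.
have [c0 [b [hb E]]] := gls_attained delta a t x z.
exists (beta0 ord0 ord0 - c0), (fun j => beta j - b j); split.
  by move=> j ja; rewrite hb// subr0.
rewrite E design_mul.
have -> : lin X (fun j => beta j - b j) = lin X beta - lin X b.
  by rewrite /lin -sumrB; apply: eq_bigr => j _; rewrite scalerBl.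
rewrite scalerBl; set u := lin X b; set v := lin X beta; set o := c0 *: _.
set w := beta0 _ _ *: _; apply/colP => i; rewrite !mxE; ring.
Qed.

Lemma loglik_underfit a t j0 B : par t -> inverses_exist delta N.+1 a t x ->
  j0 \notin a -> 0 < B -> B <= beta j0 ^+ 2 * vx j0 / 2 ->
  eta * (4 * v2 theta0 + 3 * B + 2) <= B ->
  p%:R * (K / eta) <= eta * n ->
  n * ln (2 * pi) + n * (1 + ln (v2 theta0) + 3 * eta) <= - 2 * loglik delta a t x z.
Proof.
move=> pt it ja B0 hB hBe hn; have [v0 s0 r01] := par_pos pt.
have [v00 _ _] := par_pos par0.
have [c [b [hb E]]] := gls_residual_split a t.
rewrite loglik_qf// E -[X in _ <= X]addrA lerD2l.
apply: (underfit_bound (j0 := j0) c G eta0 K0 r01 s0 v0 v00 B0 m0 _ hn (smoothing_ratio pt) hBe).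
  move=> j; apply: (le_trans heta); have /andP[h1 _] := vxb j.
  by rewrite ler_wpM2r.
by rewrite hb.
Qed.

Lemma gls_upper a t c : par t -> inverses_exist delta N.+1 a t x ->
  (forall j, j \notin a -> beta j = 0) ->
  - 2 * loglik delta a t x z <= n * ln (2 * pi) +
    ln (\det (sig N (rho t) (sigma2 t) (v2 t))) +
    qf (rho t) (sigma2 t) (v2 t) (err - c *: ones R N).
Proof.
move=> pt it hb; rewrite loglik_qf// lerD2l.
have := gls_min it (cov_inv_psd pt) z (beta0 ord0 ord0 + c) hb.
have -> : z - (beta0 ord0 ord0 + c) *: ones R N - lin X beta = err - c *: ones R N.
  rewrite design_mul; apply/colP => i; rewrite !mxE; ring.
by rewrite cov_sig.
Qed.

Lemma loglik_true a : inverses_exist delta N.+1 a theta0 x ->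
  (forall j, j \notin a -> beta j = 0) ->
  ln (\det (sig N (rho theta0) (sigma2 theta0) (v2 theta0))) <= n * (ln (v2 theta0) + eta) ->
  - 2 * loglik delta a theta0 x z <=
  n * ln (2 * pi) + n * (1 + ln (v2 theta0) + 2 * eta).
Proof.
move=> it hb hdet; apply: le_trans (gls_upper 0 par0 it hb) _.
rewrite scale0r subr0; have := good_err_form G.
have -> : n * (1 + ln (v2 theta0) + 2 * eta) =
  n * (ln (v2 theta0) + eta) + n * (1 + eta) by ring.
by move=> hq; rewrite -[X in X <= _]addrA lerD2l lerD.
Qed.

(** At a common parameter the determinants cancel and only residual forms remain. As [a'] is
    correct, fitting it does at least as well as subtracting the true mean and a constant. *)
Lemma loglik_overfit a a' t : par t -> inverses_exist delta N.+1 a t x ->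
  inverses_exist delta N.+1 a' t x ->
  (forall j, j \notin a -> beta j = 0) -> (forall j, j \notin a' -> beta j = 0) ->
  - 2 * loglik delta a' t x z <=
  - 2 * loglik delta a t x z + overfit_cst p lo hi Kc vmin V eta K.
Proof.
move=> pt it it' hb hb'; have [v1 s1 k1] := pt; have [v3 s3 k3] := par0.
have [c [b [_ E]]] := gls_residual_split a t.
have h4 : 4 * p%:R * eta <= vmin / 2.
  by apply: le_trans heta; rewrite ler_wpM2r ?lerDl// ltW.
have [c1 H] := overfit_bound lo0 Kc1 HR HC vmin0 vxb eta0 K0 D01 v1 s1 k1 G m0
  (le_trans (smoothing_ratio pt) eta1) h4 v3 s3 k3 erefl (- c) (fun j => - b j).
apply: le_trans (gls_upper c1 pt it' hb') _.
rewrite loglik_qf// E -addrA -[X in _ <= X]addrA -[X in _ <= X]addrA.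
rewrite !lerD2l; apply: le_trans H _; rewrite lerD2r.
have -> : lin X (fun j => - b j) = - lin X b.
  by rewrite /lin -sumrN; apply: eq_bigr => j _; rewrite scaleNr.
by rewrite scaleNr !opprK addrAC.
Qed.

End likelihood_comparison.

(** * Selection *)

Section selection.
Context (R : realType) (p : nat) (U : Type) (Theta : set U) (theta0 : U)
  (A A0 : {set {set 'I_p}}) (alpha0 : {set 'I_p}) (L : {set 'I_p} -> U -> R)
  (that : {set 'I_p} -> U) (tau g L0 C : R).

(** For an incorrect model, the gap [g] exceeds any difference of penalties. For a correct one,
    [alpha0] is evaluated at the estimate of its competitor, so that both likelihoods use one
    parameter; the gain [C] is then outweighed by the penalty [tau] of a single extra regressor. *)
Lemma criterion_selects (ahat : {set 'I_p}) :
  Theta theta0 -> alpha0 \in A ->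
  (forall a, a \in A -> Theta (that a) /\ forall t, Theta t -> L a (that a) <= L a t) ->
  (forall a t, a \in A -> a \notin A0 -> Theta t -> L0 + 3 * g <= L a t) ->
  L alpha0 theta0 <= L0 + 2 * g ->
  (forall a t, a \in A -> a \in A0 -> Theta t -> L alpha0 t <= L a t + C) ->
  (forall a, a \in A0 -> a != alpha0 -> (#|alpha0| < #|a|)%N) ->
  `|tau| * p%:R < g -> 0 <= tau -> C < tau ->
  is_argmin A (fun a => L a (that a) + tau * #|a|%:R) ahat -> ahat = alpha0.
Proof.
move=> T0 aA ml under true_ over card tg tau0 Ct [hA /(_ _ aA) hmin].
have [Ta0 ml0] := ml _ aA; have [Ta mla] := ml _ hA.
apply/eqP; apply: contraTT hmin => ne; rewrite -ltNge.
have [hA0|hA0] := boolP (ahat \in A0).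
  have h1 := ml0 _ Ta; have h2 := over _ _ hA hA0 Ta.
  have h3 : tau * (#|alpha0|.+1)%:R <= tau * #|ahat|%:R.
    by rewrite ler_wpM2l// ler_nat card.
  by move: h3; rewrite -natr1 mulrDr mulr1; lra.
have h1 := ml0 _ T0; have h2 := under _ _ hA hA0 Ta.
have h3 : tau * #|alpha0|%:R <= tau * p%:R.
  by rewrite ler_wpM2l// ler_nat -[p in leqRHS]card_ord max_card.
have h4 : 0 <= tau * #|ahat|%:R by rewrite mulr_ge0.
by move: tg; rewrite ger0_norm//; lra.
Qed.

End selection.

Section preliminaries.
Context (R : realType).

Lemma positive_lower_bound (I : finType) (f : I -> R) : (forall i, 0 < f i) ->
  exists2 g, 0 < g & forall i, g <= f i.
Proof.
move=> f0.
have : exists2 g, 0 < g & forall i, i \in enum I -> g <= f i.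
  elim: (enum I) => [|i s [g g0 gs]]; first by exists 1.
  exists (Num.min (f i) g); first by rewrite lt_min f0.
  move=> k; rewrite inE => /orP[/eqP ->|/gs gk]; first by rewrite ge_min lexx.
  by rewrite ge_min gk orbT.
by case=> g g0 h; exists g => // i; apply: h; rewrite mem_enum.
Qed.

Lemma sum3_bounds (a b c u : R) : 0 <= a -> 0 <= b -> 0 <= c -> a + b + c <= u ->
  [/\ a <= u, b <= u & c <= u].
Proof. by move=> *; split; lra. Qed.

Lemma ml_estimate_min p n (delta : R) Theta (a : {set 'I_p}) x (z : 'cV[R]_n) t :
  is_ml_estimate delta Theta a x z t ->
  Theta t /\ forall t', Theta t' -> - 2 * loglik delta a t x z <= - 2 * loglik delta a t' x z.
Proof.
move=> [Tt E]; split=> // t' Tt'; rewrite ler_nM2l; last by lra.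
rewrite -lee_fin E; apply: ereal_sup_ubound; by exists t'.
Qed.

(** Uniqueness of the minimizer makes the inequality strict: a correct model of the same size would
    be a second one. *)
Lemma the_argmin_card p (A0 : {set {set 'I_p}}) (alpha0 : {set 'I_p}) :
  is_the_argmin A0 (fun a => #|a|%:R : R) alpha0 ->
  alpha0 \in A0 /\ forall a, a \in A0 -> a != alpha0 -> (#|alpha0| < #|a|)%N.
Proof.
move=> H; have [h0 hmin] := (H alpha0).2 erefl; split=> // a aA0 ne.
rewrite ltnNge; apply: contra ne => le; apply/eqP/(H a).1; split=> // a' a'A0.
by apply: le_trans (hmin _ a'A0); rewrite ler_nat.
Qed.

Lemma likely_ae (d : measure_display) (T : measurableType d) (P : probability T R)
  (Q : T -> Prop) : {ae P, forall w, Q w} -> likely P 0 Q.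
Proof.
move=> [B [mB PB QB]]; exists (~` B); split.
- exact: measurableC.
- by move=> w nBw; apply: contrapT => nQ; exact/nBw/QB.
- by rewrite setCK PB.
Qed.

Lemma likely_prob (d : measure_display) (T : measurableType d) (P : probability T R)
  (B : set T) e : measurable B -> likely P e B -> ((1 - e)%:E <= P B)%E.
Proof.
move=> mB [E [mE EB PE]].
have h : (P (~` B) <= e%:E)%E.
  apply: le_trans PE; apply: le_measure; rewrite ?inE; [exact: measurableC|exact: measurableC|].
  by apply: subsetC.
have PB : P B \is a fin_num by exact: fin_num_measure.
move: h; rewrite probability_setC// -(fineK PB) -EFinB !lee_fin; lra.
Qed.

Lemma cvg_to_one (u : nat -> \bar R) : (\forall n \near \oo, (u n <= 1)%E) ->
  (forall e, 0 < e -> \forall n \near \oo, ((1 - e)%:E <= u n)%E) ->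
  u @ \oo --> 1%E.
Proof.
move=> u1 H; have fin (y : \bar R) e : (y <= 1)%E -> ((1 - e)%:E <= y)%E -> y \is a fin_num.
  by move=> y1 ye; rewrite fin_numE -ltNye -ltey (le_lt_trans y1) ?ltry// (lt_le_trans _ ye)// ltNyr.
apply/fine_cvgP; split.
  by apply: filterS2 u1 (H 1 ltr01) => n; exact: fin.
apply/cvgrPdist_le => e e0; apply: filterS2 u1 (H e e0) => n y1 ye.
have fn := fin _ _ y1 ye; move: y1 ye; rewrite /= -(fineK fn) !lee_fin => h1 h2.
by rewrite ger0_norm; lra.
Qed.

End preliminaries.

Theorem theorem5p2 (R : realType) (p : nat) (delta : R)
  (d : nat -> measure_display) (T : forall n, measurableType (d n))
  (P : forall n, probability (T n) R)
  (x : forall n, 'I_p -> R -> {RV P n >-> R})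
  (Z : forall n, {RV P n >-> n.-tuple R})
  (vx2 : 'I_p -> R) (beta0 : 'cV[R]_(1 + p))
  (Theta : set (R * R * R)) (theta0 : R * R * R)
  (A A0 : {set {set 'I_p}}) (alpha0 : {set 'I_p})
  (tau : nat -> R)
  (theta_hat : forall n, {set 'I_p} -> T n -> R * R * R)
  (alpha_hat : forall n, T n -> {set 'I_p})
  (hdelta : 0 <= delta < 1)
  (hvx2 : forall j, 0 < vx2 j)
  (hx : forall n, (0 < n)%N -> white_noise_regressors n delta (x n) vx2)
  (hZ : forall n, (0 < n)%N ->
     conditionally_multinormal (fun w => design delta n (realization (x n) w))
       (Z n)
       (fun w => design delta n (realization (x n) w) *m beta0)
       (cov delta n theta0))
  (hTheta_pos : forall t, Theta t -> [/\ 0 < v2 t, 0 < sigma2 t & 0 < kappa t])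
  (hTheta_compact : compact Theta)
  (htheta0 : Theta theta0)
  (hA0 : forall n, (0 < n)%N -> forall a,
     a \in A0 <-> a \in A /\ correct_model n delta (x n) beta0 a)
  (hA0_neq0 : A0 != finset.set0)
  (halpha0 : is_the_argmin A0 (fun a => #|a|%:R : R) alpha0)
  (hTheta_shift : forall a, a \in A ->
     Theta (theta0 +
       (\sum_(j in alpha0 :\: a) beta0 (rshift 1 j) ord0 ^+ 2 * vx2 j, 0, 0)))
  (hinv : \forall n \near \oo, {ae P n, forall w, forall a t,
     a \in A -> Theta t -> inverses_exist delta n a t (realization (x n) w)})
  (htheta_hat : forall n, (0 < n)%N -> forall a w, a \in A ->
     is_ml_estimate delta Theta a (realization (x n) w) (tuple_col (Z n w))
       (theta_hat n a w))
  (halpha_hat : forall n, (0 < n)%N -> forall w,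
     is_argmin A
       (fun a => gic delta (tau n) a (theta_hat n a w) (realization (x n) w)
                   (tuple_col (Z n w)))
       (alpha_hat n w))
  (halpha_hat_meas : forall n, (0 < n)%N -> forall a,
     measurable [set w | alpha_hat n w = a])
  (htau_infty : tau @ \oo --> +oo)
  (htau_o : tau =o_\oo (fun n => n%:R : R^o)) :
  (fun n => P n [set w | alpha_hat n w = alpha0]) @ \oo --> 1%E.
Proof.
have [lo [hi [lo0 [lohi par]]]] := parameter_bounds hTheta_pos hTheta_compact htheta0.
have hi0 : 0 < hi by exact: lt_le_trans lohi.
have [Kc Kc1 HC] := coef_bounds lo0 lohi.
have [h [M [h0 HR]]] := resolvent_grid lo0 lohi.
have [v00 s00 _] := hTheta_pos _ htheta0; have par0 := par _ htheta0.
have [v0b s0b k0b] := par0.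
have v0hi : v2 theta0 <= hi by case/andP: v0b.
have s0hi : sigma2 theta0 <= hi by case/andP: s0b.
have Kc0 : 0 < Kc by exact: lt_le_trans Kc1.
pose V := \sum_j vx2 j.
have V0 : 0 <= V by apply: sumr_ge0 => j _; exact: ltW.
have vxV j : vx2 j <= V.
  by rewrite /V (bigD1 j)//= lerDl; apply: sumr_ge0 => k _; exact: ltW.
clearbody V.
have [vmin vmin0 hvmin] := positive_lower_bound hvx2.
have vxb j : vmin <= vx2 j <= V by rewrite hvmin vxV.
pose B j := beta0 (rshift 1 j) ord0 ^+ 2 * vx2 j / 2.
have B0 j : beta0 (rshift 1 j) ord0 != 0 -> 0 < B j.
  move=> bj; rewrite /B divr_gt0// mulr_gt0//.
  by rewrite lt0r sqr_ge0 sqrf_eq0 bj.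
(* The largest [eta] that [log_gap] allows when regressor [j] is missing; a zero coefficient imposes
   no constraint, hence the value [1]. *)
pose gap j := if beta0 (rshift 1 j) ord0 == 0 then 1
              else B j / (4 * v2 theta0 + 3 * B j + 2).
have gap0 j : 0 < gap j.
  rewrite /gap; case: eqVneq => // bj; have Bj := B0 j bj.
  by rewrite divr_gt0// !addr_gt0// mulr_gt0.
have [g g0 hg] := positive_lower_bound gap0.
have pR : 0 < 4 * p%:R + 1 :> R by rewrite ltr_wpDl// mulr_ge0.
have [eta [eta0 eta1 heta etaB]] : exists eta : R, [/\ 0 < eta, eta <= 1,
    (4 * p%:R + 1) * eta <= vmin / 2 & forall j, beta0 (rshift 1 j) ord0 != 0 ->
    eta * (4 * v2 theta0 + 3 * B j + 2) <= B j].
  exists (Num.min 1 (Num.min g (vmin / 2 / (4 * p%:R + 1)))); split.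
  - by rewrite !lt_min ltr01 g0 !divr_gt0.
  - by rewrite ge_min lexx.
  - by rewrite mulrC -ler_pdivlMr// !ge_min lexx !orbT.
  - move=> j bj; have Bj := B0 j bj; rewrite -ler_pdivlMr; last by rewrite !addr_gt0// mulr_gt0.
    by have := hg j; rewrite /gap (negbTE bj) => gj; rewrite !ge_min gj orbT.
have [m1 [dl1 [dl10 hdet]]] := log_det_true HC Kc1 s00 v00 k0b eta0.
(* The set of correct models is the same for all [n], so it is determined from sample size [1]. *)
have hcorr a : a \in A -> (a \in A0 <-> forall j, j \notin a -> beta0 (rshift 1 j) ord0 = 0).
  move=> aA; have cP := correct_modelP beta0 a (ltn0Sn 0) hvx2 (hx 1%N isT).
  have h1 := hA0 1%N isT a; split=> [/h1[_ /cP]//|hb].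
  by apply/h1; split=> //; apply/cP.
have [a0A0 hcard] := the_argmin_card halpha0.
have a0A : alpha0 \in A by case: ((hA0 1%N isT alpha0).1 a0A0).
have a0b := (hcorr _ a0A).1 a0A0.
apply: cvg_to_one => [|ep ep0].
  near=> n; apply: probability_le1; apply: halpha_hat_meas.
  by near: n; exact: nbhs_infty_gt.
pose cnt := (#|{: 'I_p * 'I_p}| + (p + (p + (p + (1 + (1 + (1 +
    (#|{: 'I_p * ('I_M * 'I_M)}| + (#|{: 'I_p * ('I_M * 'I_M)}| +
     #|{: 'I_p * ('I_M * 'I_M)}|)))))))))%N.
have cnt0 : 0 < cnt%:R :> R by rewrite ltr0n /cnt !addn_gt0 /= !orbT.
(* The admissible failure probability is shared equally among the [cnt] events behind
   [likely_good]. *)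
pose e := ep / cnt%:R.
have e0 : 0 < e by rewrite divr_gt0.
have cntE : cnt%:R * e = ep by rewrite /e mulrC divfK// gt_eqF.
clearbody e.
have eeta : 0 < e * eta by rewrite mulr_gt0.
have [m [m0 hm1 hm2]] : exists m : nat, [/\ (0 < m)%N, 2 * V <= e * (m%:R * eta) &
    8 * v2 theta0 <= eta * m%:R].
  exists (Num.trunc (2 * V / (e * eta) + 8 * v2 theta0 / eta)).+1.
  set u := 2 * V / _; set v := _ / eta.
  have u0 : 0 <= u by rewrite divr_ge0 ?mulr_ge0// ltW.
  have v0 : 0 <= v by apply: divr_ge0; [apply: mulr_ge0 => //|]; exact: ltW.
  have := Num.Theory.truncnS_gt (u + v); set mm := _%:R => /ltW um.
  split=> //.
    have -> : e * (mm * eta) = mm * (e * eta) by ring.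
    by rewrite -ler_pdivrMr// -/u; apply: le_trans um; rewrite lerDl.
  by rewrite [eta * _]mulrC -ler_pdivrMr// -/v; apply: le_trans um; rewrite lerDr.
(* One threshold that serves all the Markov bounds of [likely_good]. *)
pose K := (4 * V * hi + 2 * hi + 8 * V) / e.
have Vhi : 0 <= V * hi by rewrite mulr_ge0// ltW.
have eK : e * K = 4 * V * hi + 2 * hi + 8 * V by rewrite /K mulrC divfK// gt_eqF.
have K0 : 0 < K by rewrite -(pmulr_rgt0 _ e0) eK; lra.
have [hK1 hK2 hK3] : [/\ 4 * V * hi <= e * K, 2 * hi <= e * K & 8 * V <= e * K].
  apply: sum3_bounds; [|by apply: mulr_ge0 => //; exact: ltW|exact: mulr_ge0|by rewrite eK].
  by rewrite -mulrA mulr_ge0.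
clearbody K.
(* A bound for the smoothed covariance that is free of [n], because [1 / cb] is at most [Kc] for
   spacings up to [1]. *)
pose C1 := hi + hi * (m%:R ^+ 2 * Kc).
pose B1 := (2 * V ^+ 2 + 8 * C1 ^+ 2 + 2) / (e * eta ^+ 2).
pose C := overfit_cst p lo hi Kc vmin V eta K.
have eeta2 : 0 < e * eta ^+ 2 by rewrite mulr_gt0// exprn_gt0.
have mR : 0 < m%:R ^+ 2 :> R by rewrite exprn_gt0// ltr0n.
have hKm : 0 < hi * Kc * m%:R ^+ 2 by apply: mulr_gt0 => //; apply: mulr_gt0.
pose dl2 := eta * lo / (hi * Kc * m%:R ^+ 2).
have dl20 : 0 < dl2 by apply: divr_gt0 => //; apply: mulr_gt0.
(* [eta], [m], [K] and [C] are fixed before [n]; every remaining condition holds for large [n]. *)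
have core n : (0 < n)%N -> B1 <= n%:R -> (m <= n)%N -> (m1 <= n)%N ->
    spacing delta n <= dl1 -> spacing delta n <= dl2 -> p%:R * (K / eta) / eta <= n%:R ->
    C < tau n -> 0 <= tau n -> `|tau n| <= eta / p.+1%:R * n%:R ->
    {ae P n, forall w, forall a t,
      a \in A -> Theta t -> inverses_exist delta n a t (realization (x n) w)} ->
    likely (P n) ep (fun w => alpha_hat n w = alpha0).
  case: n => // N _ hB1 mN m1N D1 D2 hpK hC tau0 htau hI.
  have D01 : 0 < spacing delta N.+1 <= 1 by exact: spacing_bounds.
  have /andP[D0 Dle1] := D01.
  set rho0 := expR (- kappa theta0 * spacing delta N.+1).
  have [rho01 _ [cb1 _] _] := HC _ _ k0b D01; rewrite -/rho0 in rho01 cb1.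
  have hZ' : conditionally_multinormal (fun w => design delta N.+1 (realization (x N.+1) w))
       (Z N.+1) (fun w => design delta N.+1 (realization (x N.+1) w) *m beta0)
       (sig N rho0 (sigma2 theta0) (v2 theta0)).
    by rewrite -cov_sig; exact: hZ.
  have n0 : 0 < N.+1%:R :> R by rewrite ltr0n.
  have hC1 : v2 theta0 + sigma2 theta0 * (m%:R ^+ 2 / cb rho0) <= C1.
    apply: lerD => //; apply: ler_pM => //; [exact: ltW| |].
      by apply: divr_ge0; [exact: ltW|exact: ltW (cb_gt0 rho01)].
    rewrite ler_pM2l// -[Kc]invrK lef_pV2 ?posrE ?invr_gt0 ?cb_gt0//.
    apply: le_trans cb1; rewrite -[X in X <= _]mul1r ler_pM2r ?invr_gt0//.
    by rewrite invf_ge1.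
  have hB1' : 2 * V ^+ 2 + 8 * C1 ^+ 2 + 2 <= e * (eta ^+ 2 * N.+1%:R).
    by have := hB1; rewrite ler_pdivrMr// [N.+1%:R * _]mulrC -mulrA.
  have [hn1 hn2 hn3] := sum3_bounds (mulr_ge0 (ler0n R 2) (sqr_ge0 V))
    (mulr_ge0 (ler0n R 8) (sqr_ge0 C1)) (ler0n R 2) hB1'.
  have G : likely (P N.+1) (cnt%:R * e) (fun w => good vx2 m M eta K (spacing delta N.+1) h rho0
      (sigma2 theta0) (v2 theta0) (xv N.+1 delta (x N.+1) ^~ w)
      (eps delta (x N.+1) (Z N.+1) beta0 w)).
    apply: (@likely_good R p N delta _ _ _ _ _ _ _ m M eta K (spacing delta N.+1) h rho0
      (sigma2 theta0) (v2 theta0) V hi C1 e) => //; first exact: hx.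
    by rewrite m0.
  have := likely_and G (likely_ae hI); apply: likely_imp; first by rewrite addr0 cntE.
  move=> w [Gw Iw].
  have hD : hi * Kc * m%:R ^+ 2 * spacing delta N.+1 <= eta * lo.
    by rewrite [X in X <= _]mulrC -ler_pdivlMr.
  have hpK' : p%:R * (K / eta) <= eta * N.+1%:R.
    by rewrite [eta * _]mulrC -ler_pdivrMr.
  have hdt := hdet N (spacing delta N.+1) m1N D01 D1.
  apply: (criterion_selects (Theta := Theta) (theta0 := theta0) (A := A) (A0 := A0)
    (L := fun a t => - 2 * loglik delta a t (realization (x N.+1) w) (tuple_col (Z N.+1 w)))
    (that := fun a => theta_hat N.+1 a w) (tau := tau N.+1) (g := eta * N.+1%:R)
    (L0 := N.+1%:R * ln (2 * pi) + N.+1%:R * (1 + ln (v2 theta0))) (C := C)) => //.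
  - by move=> a aA; apply: ml_estimate_min; exact: htheta_hat.
  - move=> a t aA aA0 Tt.
    have [j0 ja bj] : exists2 j0, j0 \notin a & beta0 (rshift 1 j0) ord0 != 0.
      apply: contrapT => H; move/negP: aA0; apply; apply/(hcorr a aA) => j ja.
      by apply/eqP; apply: contrapT => /negP bj; apply: H; exists j.
    have := loglik_underfit hdelta lo0 Kc1 HC vxb eta0 K0 m0 heta hD par0 Gw (par _ Tt)
      (Iw _ _ aA Tt) ja (B0 _ bj) (lexx _) (etaB _ bj) hpK'.
    by apply: le_trans; rewrite le_eqVlt; apply/orP; left; apply/eqP; ring.
  - apply: le_trans (loglik_true hdelta lo0 HC par0 Gw (Iw _ _ a0A htheta0) a0b hdt) _.
    by rewrite le_eqVlt; apply/orP; left; apply/eqP; ring.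
  - move=> a t aA aA0 Tt.
    exact: (loglik_overfit hdelta lo0 Kc1 HR HC vmin0 vxb eta0 eta1 K0 m0 heta hD par0 Gw
      (par _ Tt) (Iw _ _ aA Tt) (Iw _ _ a0A Tt) ((hcorr _ aA).1 aA0) a0b).
  (* Dividing by [p.+1] rather than by [p] makes the inequality strict and covers [p = 0]. *)
  - have p1 : 0 < p.+1%:R :> R by rewrite ltr0n.
    apply: (@le_lt_trans _ _ (eta / p.+1%:R * N.+1%:R * p%:R)); first by rewrite ler_wpM2r.
    have -> : eta / p.+1%:R * N.+1%:R * p%:R = eta * N.+1%:R * (p%:R / p.+1%:R) by ring.
    rewrite -[X in _ < X]mulr1 ltr_pM2l ?mulr_gt0//.
    by rewrite ltr_pdivrMr// mul1r ltr_nat.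
  - exact: halpha_hat.
near=> n.
apply: likely_prob; first by apply: halpha_hat_meas; near: n; exact: nbhs_infty_gt.
apply: core.
- by near: n; exact: nbhs_infty_gt.
- by near: n; exact: nbhs_infty_ger.
- by near: n; exact: nbhs_infty_ge.
- by near: n; exact: nbhs_infty_ge.
- by near: n; exact: spacing_small.
- by near: n; exact: spacing_small.
- by near: n; exact: nbhs_infty_ger.
- by near: n; move/cvgryPgt : htau_infty; apply.
- by near: n; move/cvgryPge : htau_infty; apply.
- near: n; move/eqoP : htau_o => /(_ (eta / p.+1%:R)) H.
  have := H ltac:(by rewrite divr_gt0// ltr0n); apply: filterS => n /=.
  by rewrite [X in _ <= _ * X -> _]ger0_norm.
- by near: n.
Unshelve. all: by end_near. Qed.
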